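(* Let $s\in\mathbb{N}$, $R\ge1$, $r\in(2,\infty)$, and let $\alpha:\mathbb{Z}^n\to\mathcal{A}_s$ be an arbitrary function. Let $\mathfrak{K}_j=K\psi_j$ for $j\in\mathbb{N}_0$, and let $\mathfrak{K}^{a,b}=\sum_{a\le j<b}\mathfrak{K}_j$ whenever $0\le a<b$. Then for each $p\in(1,\infty)$, every $\epsilon>0$ and all $f\in\ell^p(\mathbb{Z}^n)$, $$\Big\|\big(\mathscr{L}_{s,\alpha(x)}[\widehat{\mathfrak{K}^{0,j}}](D)f(x)\big)_{j\in\mathbb{N}}\Big\|_{\ell^p(x\in\mathbb{B}_R;\mathbf{V}^r)}\lesssim_\epsilon R^\epsilon\,2^{-\gamma_ps}\|f\|_{\ell^p(\mathbb{Z}^n)},$$ where $\widehat{\mathfrak{K}^{0,j}}=\mathcal{F}_{\mathbb{R}^n}\mathfrak{K}^{0,j}$.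
   Context: Let $n,d$ be positive integers, $\mathbb{N}=\{1,2,\dots\}$, $\mathbb{N}_0=\mathbb{N}\cup\{0\}$, $[q]=\{1,\dots,q\}$, $e(\theta)=e^{2\pi i\theta}$, $\mathbb{B}_R=\{x\in\mathbb{Z}^n:|x|\le R\}$. Kernel: $K(y)=\Omega(y)/|y|^n$ on $\mathbb{R}^n\setminus\{0\}$, with $\Omega\in\mathcal{C}^1(\mathbb{R}^n\setminus\{0\})$ homogeneous of degree $0$ and $\int_{\mathbb{S}^{n-1}}\Omega\,d\sigma=0$. Cutoffs: $\psi:\mathbb{R}^n\to[0,1]$ is a fixed smooth function supported in $\{1/2\le|\xi|\le2\}$ such that, with $\psi_l(\xi)=\psi(2^{-l}\xi)$, $\sum_{l\in\mathbb{Z}}\psi_l(\xi)=1$ for $\xi\ne0$; and $\chi:=1-\sum_{l\ge1}\psi_l$. Fourier notation: $\mathcal{F}_{\mathbb{R}^n}h(\xi)=\int_{\mathbb{R}^n}e(-\xi\cdot x)h(x)dx$, $\mathcal{F}_{\mathbb{Z}^n}f(\xi)=\sum_{x\in\mathbb{Z}^n}e(-\xi\cdot x)f(x)$, and for a $1$-periodic bounded function $m$ on $\mathbb{R}^n$, $m(D)f(x)=\int_{\mathbb{T}^n}e(\xi\cdot x)m(\xi)\mathcal{F}_{\mathbb{Z}^n}f(\xi)d\xi$ (for finitely supported $f$; the estimate for $f\in\ell^p$ is understood by density). $\mathfrak{A}_s=\{a/q\in\mathbb{Q}:(a,q)=1,\ q\in[2^{s-1},2^s)\cap\mathbb{Z}\}$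 and $\mathcal{A}_s=\mathfrak{A}_s\cap[0,1]$. For $\alpha=a/q\in\mathfrak{A}_s$ in lowest terms and $\beta=b/q\in\frac1q\mathbb{Z}^n$, $S(\alpha,\beta)=q^{-n}\sum_{\rho\in[q]^n}e(\frac aq|\rho|^{2d}+\frac bq\cdot\rho)$. Fix $\kappa\in(0,1)$ and put $\chi_{s,\kappa}(\xi)=\chi(2^{4s2^{2\kappa s}}\xi)$. For a bounded function $m$ on $\mathbb{R}^n$, $$\mathscr{L}_{s,\alpha}[m](\xi)=\sum_{\beta\in\frac1q\mathbb{Z}^n}S(\alpha,\beta)\,m(\xi-\beta)\,\chi_{s,\kappa}(\xi-\beta).$$ $\mathscr{L}_{s,\alpha(x)}[m](D)f(x)$ means $\mathscr{L}_{s,\alpha}[m](D)f$ evaluated at $x$ with $\alpha=\alpha(x)$. $\gamma_p\in(0,1)$ ($1<p<\infty$) is a constant such that $\|\sup_{\alpha\in\mathcal{A}_s}|\mathscr{L}_{s,\alpha}[1](D)f|\|_{\ell^p(\mathbb{Z}^n)}\lesssim2^{-\gamma_ps}\|f\|_{\ell^p(\mathbb{Z}^n)}$ for all $s\in\mathbb{N}$ (such a constant exists by work of Krause and Roos). Variation norm: $\|(\mathfrak{a}_t)_{t\in\mathbb{I}}\|_{V^r}=\sup_J\sup_{t_0<\dots<t_J,\,t_j\in\mathbb{I}}(\sum_{j<J}|\mathfrak{a}_{t_{j+1}}-\mathfrak{a}_{t_j}|^r)^{1/r}$ and $\|(\mathfrak{a}_t)_{t\in\mathbb{I}}\|_{\mathbf{V}^r}=\sup_{t\in\mathbb{I}}|\mathfrak{a}_t|+\|(\mathfrak{a}_t)_{t\in\mathbb{I}}\|_{V^r}$;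 $\ell^p(X;\mathbf{V}^r)$ is the $\ell^p(X)$ norm of the pointwise $\mathbf{V}^r$ norm. The implicit constant is independent of $s$, $R$, $f$ and the function $\alpha(\cdot)$. *)

(* Defs.v *)
From HB Require Import structures.
From mathcomp Require Import all_boot all_order all_algebra.
From mathcomp Require Import complex.
From mathcomp Require Import all_classical all_reals all_analysis.

Set Implicit Arguments.
Unset Strict Implicit.
Unset Printing Implicit Defensive.

Import Order.TTheory GRing.Theory Num.Theory.
Import numFieldNormedType.Exports.

Local Open Scope classical_set_scope.
Local Open Scope ring_scope.

(** Lebesgue measure on R^n is the iterated product measure. The measurable structure of the library is on tuples, its topology and
    linear structure on row vectors; integrands are functions of row vectors. *)

Section cons_measure.
Context d (T : measurableType d) (R : realType) (n : nat).
Variable m : {sigma_finite_measure set T -> \bar R}.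
Variable mu : {sigma_finite_measure set (n.-tuple T) -> \bar R}.

Let cons_pair (p : T * n.-tuple T) : n.+1.-tuple T := [tuple of p.1 :: p.2].

Let measurable_cons_pair : measurable_fun [set: T * n.-tuple T] cons_pair.
Proof. exact: measurable_cons. Qed.

Definition cons_measure : set (n.+1.-tuple T) -> \bar R :=
  pushforward (m \x mu)%E cons_pair.

Let pushforward_cons : {measure set (n.+1.-tuple T) -> \bar R} :=
  measure_function_pushforward__canonical__measure_function_Measure
    (m \x mu)%E measurable_cons_pair.

HB.instance Definition _ := isMeasure.Build _ _ _ cons_measure
  (measure0 pushforward_cons) (measure_ge0 pushforward_cons)
  (@measure_semi_sigma_additive _ _ _ pushforward_cons).

Let cons_measure_sigma_finite : sigma_finite [set: n.+1.-tuple T] cons_measure.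
Proof.
have /sigma_finiteP[F [UF ndF mF]] := sigma_finiteT m.
have /sigma_finiteP[G [UG ndG mG]] := sigma_finiteT mu.
pose uncons (t : n.+1.-tuple T) : T * n.-tuple T :=
  (tnth t ord0, [tuple of behead t]).
have muncons : measurable_fun [set: n.+1.-tuple T] uncons.
  apply/measurable_fun_pairP; split; first exact: measurable_tnth.
  exact: measurable_behead.
have consK p : uncons (cons_pair p) = p.
  by case: p => a t; congr pair; apply: val_inj.
exists (fun k => uncons @^-1` (F k `*` G k)).
  rewrite -preimage_bigcup -[LHS](preimage_setT uncons); congr preimage.
  rewrite -setXTT UF UG predeqE => -[x y]; split.
    move=> [/= [k _ Fkx] [l _ Gly]]; exists (maxn k l) => //; split.
    - by move: x Fkx; exact/subsetPset/ndF/leq_maxl.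
    - by move: y Gly; exact/subsetPset/ndG/leq_maxr.
  by move=> [k _ []/= ? ?]; split; exists k.
move=> k; have [mFk Fk] := mF k; have [mGk Gk] := mG k.
have mFG : measurable (F k `*` G k) by exact: measurableX.
split; first by rewrite -[X in measurable X]setTI; exact: muncons.
rewrite /cons_measure /pushforward (_ : _ @^-1` _ = F k `*` G k); last first.
  by apply/funext => p; rewrite /preimage /mkset consK.
by rewrite product_measure1E// lte_mul_pinfty// ge0_fin_numE.
Qed.

HB.instance Definition _ :=
  Measure_isSigmaFinite.Build _ _ _ cons_measure cons_measure_sigma_finite.

End cons_measure.

Fixpoint lebesgue_tuple (R : realType) (n : nat) :
    {sigma_finite_measure set (n.-tuple (measurableTypeR R)) -> \bar R} :=
  match n with
  | 0 => \d_ [tuple]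
  | m.+1 => cons_measure lebesgue_measure (lebesgue_tuple R m)
  end.

Section defs.
Context (R : realType).
Local Notation C := R[i].
Local Notation normc := ComplexField.Normc.normc.

Definition dot n (x y : 'rV[R]_n) : R := \sum_(i < n) x ord0 i * y ord0 i.

(** The Euclidean norm; the norm of the library on row vectors is the sup norm. *)
Definition enorm n (x : 'rV[R]_n) : R := Num.sqrt (dot x x).

Definition realvec n (x : 'rV[int]_n) : 'rV[R]_n := map_mx intr x.

Definition expi (theta : R) : C :=
  (cos (2 * pi * theta) +i* sin (2 * pi * theta))%C.

Definition integral_Rn n (f : 'rV[R]_n -> R) : R :=
  (\int[lebesgue_tuple R n]_t f (\row_(i < n) tnth t i))%R.

Definition cintegral_Rn n (f : 'rV[R]_n -> C) : C :=
  (integral_Rn (fun x => complex.Re (f x)) +i*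
   integral_Rn (fun x => complex.Im (f x)))%C.

(** Integral over the torus T^n, with fundamental domain [0, 1)^n *)
Definition cintegral_torus n (f : 'rV[R]_n -> C) : C :=
  cintegral_Rn (fun x => if `[< forall i, 0 <= x ord0 i < 1 >] then f x else 0).

(** Integral over the unit sphere for the surface measure, which is defined by
    sigma(E) = n * |{x : 0 < |x| <= 1, x / |x| \in E}|. *)
Definition cintegral_sphere n (g : 'rV[R]_n -> C) : C :=
  n%:R * cintegral_Rn (fun x =>
    if 0 < enorm x <= 1 then g ((enorm x)^-1 *: x) else 0).

Definition partial n (i : 'I_n) (f : 'rV[R]_n -> R) : 'rV[R]_n -> R :=
  fun x => 'D_(delta_mx ord0 i) f x.

Definition iter_partial n (s : seq 'I_n) (f : 'rV[R]_n -> R) :=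
  foldr (@partial n) f s.

Definition C1_on n (U : set 'rV[R]_n) (f : 'rV[R]_n -> R) : Prop :=
  forall (i : 'I_n) x, U x ->
    derivable f x (delta_mx ord0 i) /\ {for x, continuous (partial i f)}.

Definition smooth n (f : 'rV[R]_n -> R) : Prop :=
  forall s : seq 'I_n, C1_on setT (iter_partial s f).

Definition kernel_symbol n (Omega : 'rV[R]_n -> C) : Prop :=
  [/\ C1_on [set x | x != 0] (fun x => complex.Re (Omega x)),
      C1_on [set x | x != 0] (fun x => complex.Im (Omega x)),
      forall (t : R) x, 0 < t -> x != 0 -> Omega (t *: x) = Omega x
    & cintegral_sphere Omega = 0].

Definition K_of n (Omega : 'rV[R]_n -> C) (y : 'rV[R]_n) : C :=
  Omega y / ((enorm y ^+ n)%:C)%C.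

Definition dilate n (psi : 'rV[R]_n -> R) (l : int) (xi : 'rV[R]_n) : R :=
  psi (((2 : R) ^ (- l)) *: xi).

Definition cutoff n (psi : 'rV[R]_n -> R) : Prop :=
  [/\ smooth psi,
      forall xi, 0 <= psi xi <= 1,
      forall xi, psi xi != 0 -> 2^-1 <= enorm xi <= 2
    & forall xi, xi != 0 ->
        (\esum_(l in [set: int]) (dilate psi l xi)%:E = 1)%E].

Definition chi_of n (psi : 'rV[R]_n -> R) (xi : 'rV[R]_n) : R :=
  1 - fine (\esum_(l in [set l : int | (1 <= l)%R]) (dilate psi l xi)%:E)%E.

Definition K_trunc n Omega (psi : 'rV[R]_n -> R) (a b : nat) (x : 'rV[R]_n) : C :=
  \sum_(a <= j < b) K_of Omega x * ((dilate psi j x)%:C)%C.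

Definition fourier_Rn n (h : 'rV[R]_n -> C) (xi : 'rV[R]_n) : C :=
  cintegral_Rn (fun x => expi (- dot xi x) * h x).

Definition finitely_supported n (f : 'rV[int]_n -> C) : Prop :=
  finite_set [set x | f x != 0].

(** For [f] finitely supported (the finite-support sum is 0 otherwise) *)
Definition fourier_Zn n (f : 'rV[int]_n -> C) (xi : 'rV[R]_n) : C :=
  \sum_(x \in [set: 'rV[int]_n]) (expi (- dot xi (realvec x)) * f x).

Definition mult_op n (m : 'rV[R]_n -> C) (f : 'rV[int]_n -> C)
    (x : 'rV[int]_n) : C :=
  cintegral_torus (fun xi =>
    expi (dot xi (realvec x)) * m xi * fourier_Zn f xi).

Definition denom (alpha : rat) : nat := `|denq alpha|%N.

Definition A_ (s : nat) : set rat :=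
  [set alpha | (2 ^ s.-1 <= denom alpha < 2 ^ s)%N /\ 0 <= alpha <= 1].

(** [rho] ranges over {1, ..., q}^n, where q is the denominator of [alpha];
    [(dot _ _) ^+ d] is |rho|^(2d). *)
Definition gauss_sum n (d : nat) (alpha : rat) (beta : 'rV[R]_n) : C :=
  let q := denom alpha in
  ((q%:R : C) ^+ n)^-1 *
  \sum_(rho : 'rV['I_q]_n)
    let v : 'rV[R]_n := \row_(i < n) (rho ord0 i).+1%:R in
    expi (ratr alpha * dot v v ^+ d + dot beta v).

Definition chi_s n (psi : 'rV[R]_n -> R) (kappa : R) (s : nat)
    (xi : 'rV[R]_n) : R :=
  chi_of psi ((2 `^ (4 * s%:R * 2 `^ (2 * kappa * s%:R))) *: xi).

(** The sum over beta in (1/q) Z^n has finitely many nonzero terms for each xi,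
    since [chi_s] has bounded support. *)
Definition L_mult n (d : nat) (psi : 'rV[R]_n -> R) (kappa : R) (s : nat)
    (alpha : rat) (m : 'rV[R]_n -> C) (xi : 'rV[R]_n) : C :=
  \sum_(b \in [set: 'rV[int]_n])
    (let beta := ((denom alpha)%:R : R)^-1 *: realvec b in
     gauss_sum d alpha beta * m (xi - beta) *
     ((chi_s psi kappa s (xi - beta))%:C)%C).

Definition lp_norm (T : choiceType) (p : R) (X : set T) (g : T -> \bar R) : \bar R :=
  (((\esum_(x in X) (g x `^ p)) `^ p^-1)%E).

Definition cabs (T : Type) (f : T -> C) : T -> \bar R :=
  fun x => (normc (f x))%:E.

Definition V_seminorm (r : R) (I : set nat) (a : nat -> C) : \bar R :=
  ereal_sup [set v | exists (J : nat) (t : nat -> nat),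
    [/\ forall j, (j < J)%N -> (t j < t j.+1)%N,
        forall j, (j <= J)%N -> I (t j)
      & v = ((\sum_(j < J) normc (a (t j.+1) - a (t j)) `^ r) `^ r^-1)%:E]].

Definition V_norm (r : R) (I : set nat) (a : nat -> C) : \bar R :=
  (ereal_sup (cabs a @` I) + V_seminorm r I a)%E.

Definition B_ n (rad : R) : set 'rV[int]_n :=
  [set x | enorm (realvec x) <= rad].

(** [z] is the value at [f] of the extension by density to l^p of the
    functional [T], initially defined on finitely supported functions. *)
Definition lp_extension_value n (p : R) (T : ('rV[int]_n -> C) -> C)
    (f : 'rV[int]_n -> C) (z : C) : Prop :=
  forall g : nat -> 'rV[int]_n -> C,
    (forall k, finitely_supported (g k)) ->
    (lp_norm p setT (cabs (fun x => g k x - f x))) @[k --> \oo] --> (0 : \bar R) ->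
    normc (T (g k) - z) @[k --> \oo] --> (0 : R).

(** gamma is an admissible choice of the exponents gamma_p, 1 < p < oo: the
    single-scale maximal estimate with decay 2^(-gamma_p s). *)
Definition maximal_decay n (d : nat) (psi : 'rV[R]_n -> R) (kappa : R)
    (gamma : R -> R) : Prop :=
  forall p : R, 1 < p ->
    0 < gamma p < 1 /\
    exists c : R, forall s : nat, (0 < s)%N ->
      forall f : 'rV[int]_n -> C, finitely_supported f ->
      (lp_norm p setT (fun x : 'rV[int]_n =>
         ereal_sup [set (normc (mult_op
            (L_mult d psi kappa s alpha (fun=> 1)) f x))%:E | alpha in A_ s])
       <= (c * 2 `^ (- gamma p * s%:R))%:E * lp_norm p setT (cabs f))%E.

End defs.
Arguments A_ : clear implicits.
Arguments B_ : clear implicits.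

(* Main.v *)
Require Import Defs.
From mathcomp Require Import all_boot all_order all_algebra.
From mathcomp Require Import complex.
From mathcomp Require Import all_classical all_reals all_analysis.
From mathcomp Require Import measurable_realfun ring lra zify.

Set Implicit Arguments.
Unset Strict Implicit.
Unset Printing Implicit Defensive.

Import Order.TTheory GRing.Theory Num.Theory.
Import numFieldNormedType.Exports.
Import ComplexField.Normc.

Local Open Scope classical_set_scope.
Local Open Scope ring_scope.

(** The estimate has room to spare because the scale lambda = 2^(4 s 2^(2 kappa s))
    inside chi_(s,kappa) outgrows every fixed power of 2^s: any loss 2^(Cs) is paid for
    by a gain lambda^(-tau) with tau > 0, and what remains is at most 2^(-s), hence at
    most 2^(-gamma_p s) because gamma_p < 1 ([lam_absorbs]).

    Let K_i = K psi_i. On Z^n the operator with multiplier L_(s,alpha)[F K_i] is the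
    convolution with G_alpha(y) k_i(y) ([mult_opE], [L_Ktrunc_kernel]). Here G_alpha is a
    sum of q^n characters with Gauss sums as coefficients, so |G_alpha| <= 2^(sn) for
    every alpha; this crude bound disposes of the dependence on alpha(x). The other
    factor is k_i(y) = int K_i(z) phi(y - z) dz, where phi is the inverse Fourier
    transform of chi(lambda xi), a bump of height lambda^(-n) and width lambda.

    Two bounds on k_i suffice. Since K_i has mean zero and lives at scale 2^i, while phi
    varies at scale lambda, the sum of |k_i| over Z^n is O((2^i / lambda)^t) for each
    t in [0, 1/2] ([kern_l1]); and |k_i| is O(2^(-in)) pointwise ([kern_sup]). That K_i
    has mean zero follows from the mean of Omega on the sphere by scaling arguments
    alone ([annulus_int2], [int_Kj]), and the decay of phi by finite differences
    ([invF_fd], [phi_decay]); no polar coordinates or integration by parts occur.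

    The variation norm of a sequence which starts from 0 is at most twice the sum of the
    moduli of its increments ([V_norm_le]), so it remains to bound the sum over i of
    |k_i| * |f| in l^p of the ball B_R. Split the scales at 2^I0 ~ lambda^(1/2) R^2
    ([scales_bound], [constants]). Below I0, Young's inequality gives
    (2^I0 / lambda)^t = lambda^(-t/2) R^(2t), and 2t <= epsilon. Above I0, Jensen's
    inequality and the pointwise bound give |k_i| * |f| <= C 2^(-in/p) ||f||_p at every
    point, and B_R has at most (3R)^n points, so these scales contribute
    (R 2^(-I0))^(n/p) = O(lambda^(-n/(2p))). Both carry a negative power of lambda.

    All inequalities are proved for finite sums and finitely supported functions, then
    passed to the limit along the truncations of f to boxes ([ext_exists],
    [variation_lp]). *)

(** * Affine changes of variables for Lebesgue measure on tuples *)

Section Affine1.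
Context (R : realType).
Notation leb := (@lebesgue_measure R).

Lemma measurable_affine (c v : R) :
  measurable_fun [set: measurableTypeR R] (fun x : measurableTypeR R => (c * x + v : measurableTypeR R)).
Proof. by apply: measurable_funD => //; exact: measurable_funM. Qed.

(** The image of c times Lebesgue measure under x -> c x + v agrees with Lebesgue measure on
    half-open intervals, hence everywhere. *)
Lemma ge0_integral_affine (c v : R) (f : R -> \bar R) : 0 < c ->
  measurable_fun [set: R] f -> (forall x, 0 <= f x)%E ->
  (\int[leb]_x f (c * x + v)%R = (c^-1)%:E * \int[leb]_x f x)%E.
Proof.
move=> c0 mf f0.
pose phi (x : measurableTypeR R) : measurableTypeR R := c * x + v.
have mphi : measurable_fun setT phi by exact: measurable_affine.
pose mu1 : {measure set (measurableTypeR R) -> \bar R} :=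
  measure_function_pushforward__canonical__measure_function_Measure leb mphi.
pose mu2 := mscale (NngNum (ltW c0)) mu1.
have mu2E A : measurable A -> leb A = mu2 A.
  apply: lebesgue_measure_unique => _ [[a b] _ <-]/=.
  rewrite /mu2 /mscale /= /pushforward.
  rewrite (_ : phi @^-1` _ = [set` `](a - v) / c, (b - v) / c]]); last first.
    apply/seteqP; split => x /=; rewrite !in_itv/= /phi.
      by rewrite ltr_pdivrMr // ler_pdivlMr // ltrBlDr lerBrDr [x * c]mulrC.
    by rewrite ltr_pdivrMr // ler_pdivlMr // ltrBlDr lerBrDr [x * c]mulrC.
  rewrite lebesgue_measure_itv/= lebesgue_measure_itv/= !lte_fin.
  rewrite ltr_pM2r ?invr_gt0// ltrD2r.
  case: ifPn => ab; last by rewrite mule0.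
  rewrite -!EFinD -EFinM; congr EFin; field.
  by rewrite gt_eqF.
have -> : (\int[leb]_x f x)%E = (\int[mu2]_x f x)%E.
  by apply: eq_measure_integral => A mA _; exact/mu2E.
rewrite /mu2 ge0_integral_mscale// muleA -EFinM mulVf ?gt_eqF// mul1e.
rewrite /mu1 /= ge0_integral_pushforward//.
Qed.
End Affine1.

Section AffineN.
Context (R : realType).
Notation T1 := (measurableTypeR R).
Notation leb := (@lebesgue_measure R).

Lemma ge0_integral_cons n (f : n.+1.-tuple T1 -> \bar R) :
  measurable_fun setT f -> (forall x, 0 <= f x)%E ->
  (\int[lebesgue_tuple R n.+1]_t f t =
   \int[leb]_a \int[lebesgue_tuple R n]_t f [the n.+1.-tuple T1 of a :: t])%E.
Proof.
move=> mf f0.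
have mc : measurable_fun setT (fun p : T1 * n.-tuple T1 => [tuple of p.1 :: p.2]).
  exact: measurable_cons.
transitivity (\int[leb \x lebesgue_tuple R n]_p f [tuple of p.1 :: p.2])%E.
  by rewrite [LHS]/= [LHS]ge0_integral_pushforward.
rewrite fubini_tonelli1 //=.
by apply: measurableT_comp.
Qed.

Definition afft n (c : R) (v : 'I_n -> R) (t : n.-tuple T1) : n.-tuple T1 :=
  [tuple c * tnth t i + v i | i < n].

Lemma measurable_afft n c (v : 'I_n -> R) : measurable_fun setT (afft c v).
Proof.
apply/measurable_fun_tnthP => i.
rewrite (_ : _ \o _ = (fun x : T1 => (c * x + v i : T1)) \o (fun t => tnth t i)).
  apply: measurableT_comp; first exact: measurable_affine.
  exact: measurable_tnth.
by apply/funext => t /=; rewrite tnth_mktuple.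
Qed.

(** Tonelli, one coordinate at a time. *)
Lemma ge0_integral_afft n (c : R) (v : 'I_n -> R) (f : n.-tuple T1 -> \bar R) :
  0 < c -> measurable_fun setT f -> (forall x, 0 <= f x)%E ->
  (\int[lebesgue_tuple R n]_t f (afft c v t) =
   (c^-n)%:E * \int[lebesgue_tuple R n]_t f t)%E.
Proof.
move=> c0; elim: n v f => [|n IH] v f mf f0.
  rewrite expr0 invr1 mul1e; apply: eq_integral => t _.
  by congr f; apply/val_inj; rewrite (tuple0 t) tuple0.
rewrite !ge0_integral_cons//; last first.
  by apply: measurableT_comp => //; exact: measurable_afft.
pose v' i := v (lift ord0 i).
have E a (t : n.-tuple T1) : afft c v [the n.+1.-tuple T1 of a :: t] =
    [the n.+1.-tuple T1 of (c * a + v ord0) :: afft c v' t].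
  apply: eq_from_tnth => i; rewrite tnth_mktuple.
  case: (unliftP ord0 i) => [j ->|->]; last by rewrite !tnth0.
  by rewrite !tnthS tnth_mktuple.
have mcons (a : T1) : measurable_fun setT (fun t : n.-tuple T1 => f [the n.+1.-tuple T1 of a :: t]).
  apply: measurableT_comp => //; apply: measurable_cons => //.
under eq_integral => a _.
  under eq_integral => t _ do rewrite E.
  rewrite (IH v' (fun t : n.-tuple T1 => f [the n.+1.-tuple T1 of (c * a + v ord0) :: t]))//.
  over.
rewrite /=.
pose g (a : R) := (\int[lebesgue_tuple R n]_t f [the n.+1.-tuple T1 of a :: t])%E.
have g0 a : (0 <= g a)%E by apply: integral_ge0.
have mg : measurable_fun [set: T1] g.
  have mf' : measurable_fun [set: T1 * n.-tuple T1]
      (fun p : T1 * n.-tuple T1 => f [tuple of p.1 :: p.2]).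
    by apply: measurableT_comp => //; exact: measurable_cons.
  exact: (measurable_fun_fubini_tonelli_F (m2 := lebesgue_tuple R n) _ mf').
have cn : 0 <= c ^- n by rewrite invr_ge0 exprn_ge0// ltW.
have mg2 : measurable_fun [set: T1] (fun a : T1 => g (c * a + v ord0)).
  by apply: (@measurableT_comp _ _ _ _ _ _ g) => //; exact: measurable_affine.
rewrite (@ge0_integralZl _ _ _ leb setT measurableT (fun a : T1 => g (c * a + v ord0)) mg2)//.
rewrite (@ge0_integral_affine _ c (v ord0) g)// muleA -EFinM exprSr invfM.
by rewrite mulrC.
Qed.

End AffineN.

(** * Integrals of bounded compactly supported functions *)

Section Rows.
Context (R : realType).
Notation T1 := (measurableTypeR R).
Notation leb := (@lebesgue_measure R).

Lemma row_coord n (x : 'rV[R]_n) i : `|x ord0 i| <= `|x|.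
Proof.
rewrite /Num.norm/= mx_normrE.
by apply/bigmax_geP; right; exists (ord0, i).
Qed.

Lemma row_norm_le n (x : 'rV[R]_n) M : 0 <= M ->
  (forall i, `|x ord0 i| <= M) -> `|x| <= M.
Proof.
move=> M0 h; rewrite /Num.norm/= mx_normrE.
by apply/bigmax_leP; split => // -[a b] _ /=; rewrite (ord1 a).
Qed.

Definition tbox n (M : R) : set (n.-tuple T1) := [set t | forall i, `|tnth t i| <= M].

Lemma measurable_tbox n M : measurable (@tbox n M).
Proof.
rewrite (_ : tbox M = \bigcap_(i in [set: 'I_n]) [set t | `|tnth t i| <= M]).
  apply: fin_bigcap_measurable => // i _.
  rewrite -[X in measurable X]setTI.
  have := @measurable_tnth _ T1 n i.
  move=> /(_ measurableT [set x | `|x| <= M]); apply.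
  rewrite (_ : [set x | _] = [set` `[- M, M]]); first exact: measurable_itv.
  by apply/seteqP; split=> x /=; rewrite in_itv/= ler_norml.
by apply/seteqP; split => t /= h i; [move=> _|]; apply: h.
Qed.

Lemma tbox_fin n M : (lebesgue_tuple R n (@tbox n M) < +oo)%E.
Proof.
elim: n => [|n IH].
  by rewrite (le_lt_trans _ (ltry 1))//= /dirac indicE lee_fin; case: (_ \in _).
have lf : (leb [set` `[- M, M]%R] < +oo)%E.
  by rewrite lebesgue_measure_itv/=; case: ifP => // _; rewrite -EFinD ltry.
have lf' : leb [set` `[- M, M]] \is a fin_num by rewrite ge0_fin_numE.
rewrite /= /cons_measure /pushforward /=.
(* A box in dimension n+1 is the product of an interval and a box. *)
rewrite (_ : _ @^-1` _ = [set` `[- M, M]] `*` @tbox n M).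
  rewrite product_measure1E//; last exact: measurable_tbox.
  rewrite lte_mul_pinfty//.
apply/seteqP; split => -[a t] /=.
  move=> h; split; first by have /= := h ord0; rewrite tnth0 in_itv/= ler_norml.
  by move=> i; have /= := h (lift ord0 i); rewrite tnthS.
move=> [/=]; rewrite in_itv/= => ha ht i; rewrite /=.
case: (unliftP ord0 i) => [j ->|->]; first by rewrite tnthS; exact: ht.
by rewrite tnth0 ler_norml.
Qed.

(** The bridge between the two presentations of R^n: the measure lives on tuples, the functions
    on row vectors. *)
Definition rowt n (t : n.-tuple T1) : 'rV[R]_n := \row_(i < n) tnth t i.

Lemma rowt_norm n (t : n.-tuple T1) M : 0 <= M -> (tbox M t <-> `|rowt t| <= M).
Proof.
move=> M0; split=> [h|h i].
  by apply: row_norm_le => // i; rewrite mxE; exact: h.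
by apply: le_trans h; have := row_coord (rowt t) i; rewrite mxE.
Qed.

Definition mrow n (f : 'rV[R]_n -> R) :=
  measurable_fun [set: n.-tuple T1] (f \o @rowt n).

(** Bounded, measurable and of compact support, with one constant for the bound and the support.
    All integrands below are of this kind, so that the real-valued integral, which is 0 on
    non-integrable functions, is additive and Fubini applies. *)
Definition bcs n (f : 'rV[R]_n -> R) :=
  mrow f /\ exists M : R, forall x, `|f x| <= M /\ (M < `|x| -> f x = 0).

Lemma bcs_integrable n (f : 'rV[R]_n -> R) : bcs f ->
  (lebesgue_tuple R n).-integrable setT (EFin \o (f \o @rowt n)).
Proof.
move=> [mf [M hM]].
have M0 : 0 <= M by apply: le_trans (hM 0).1.
have mB := @measurable_tbox n M.
apply/integrableP; split; first by apply/measurable_EFinP.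
apply: (@le_lt_trans _ _ (\int[lebesgue_tuple R n]_t (M%:E * (\1_(@tbox n M) t)%:E)))%E.
  apply: ge0_le_integral => //.
  - apply: measurableT_comp => //; exact/measurable_EFinP.
  - by apply/measurable_EFinP; apply: measurable_funM.
  - move=> t _ /=; rewrite -EFinM lee_fin indicE.
    have [h|h] := boolP (t \in tbox M); first by rewrite mulr1; exact: (hM _).1.
    rewrite mulr0 (hM _).2 ?normr0// ltNge; apply/negP => /(rowt_norm t M0) ht.
    by move: h; rewrite notin_setE; apply.
rewrite ge0_integralZl//.
- rewrite integral_indic// ?setIT.
  by rewrite lte_mul_pinfty//; exact: tbox_fin.
- by apply/measurable_EFinP.
Qed.

Local Notation "\I f" := (integral_Rn f) (at level 10).

Lemma integral_RnE n (f : 'rV[R]_n -> R) :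
  \I f = (\int[lebesgue_tuple R n]_t (f \o @rowt n) t)%R.
Proof. by []. Qed.

Lemma mrow_ext n (f g : 'rV[R]_n -> R) : f =1 g -> mrow f -> mrow g.
Proof. by move=> /funext ->. Qed.

Lemma bcs_ext n (f g : 'rV[R]_n -> R) : f =1 g -> bcs f -> bcs g.
Proof. by move=> /funext ->. Qed.

Lemma iRn_ext n (f g : 'rV[R]_n -> R) : f =1 g -> \I f = \I g.
Proof. by move=> /funext ->. Qed.

Lemma mrow_cst n c : @mrow n (fun=> c). Proof. exact: measurable_cst. Qed.

Lemma mrow_coord n i : @mrow n (fun x => x ord0 i).
Proof.
rewrite /mrow (_ : _ \o _ = (fun t : n.-tuple T1 => tnth t i : T1)).
  exact: measurable_tnth.
by apply/funext => t /=; rewrite mxE.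
Qed.

Lemma mrowD n (f g : 'rV[R]_n -> R) : mrow f -> mrow g -> mrow (fun x => f x + g x).
Proof. by move=> mf mg; exact: measurable_funD mf mg. Qed.

Lemma mrowM n (f g : 'rV[R]_n -> R) : mrow f -> mrow g -> mrow (fun x => f x * g x).
Proof. by move=> mf mg; exact: measurable_funM mf mg. Qed.

Lemma mrowN n (f : 'rV[R]_n -> R) : mrow f -> mrow (fun x => - f x).
Proof. by move=> mf; exact: measurable_funN mf. Qed.

Lemma mrowB n (f g : 'rV[R]_n -> R) : mrow f -> mrow g -> mrow (fun x => f x - g x).
Proof. by move=> mf mg; apply: mrowD => //; exact: mrowN. Qed.

Lemma mrow_sum n I (s : seq I) (P : pred I) (f : I -> 'rV[R]_n -> R) :
  (forall i, mrow (f i)) -> mrow (fun x => \sum_(i <- s | P i) f i x).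
Proof.
move=> mf; elim: s => [|a s IH].
  apply: (@mrow_ext _ (fun=> 0)) => [x|]; first by rewrite big_nil.
  exact: mrow_cst.
case Pa: (P a).
  apply: (@mrow_ext _ (fun x => f a x + \sum_(i <- s | P i) f i x)) => [x|].
    by rewrite big_cons Pa.
  exact: mrowD.
by apply: (@mrow_ext _ (fun x => \sum_(i <- s | P i) f i x)) => // x; rewrite big_cons Pa.
Qed.

Lemma mrow_comp n (g : R -> R) (f : 'rV[R]_n -> R) :
  measurable_fun setT g -> mrow f -> mrow (fun x => g (f x)).
Proof. by move=> mg mf; exact: (measurableT_comp mg mf). Qed.

Lemma mrow_norm n (f : 'rV[R]_n -> R) : mrow f -> mrow (fun x => `|f x|).
Proof. by apply: mrow_comp. Qed.

Lemma mrow_if n (b : 'rV[R]_n -> bool) (f g : 'rV[R]_n -> R) :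
  measurable_fun setT (b \o @rowt n) -> mrow f -> mrow g ->
  mrow (fun x => if b x then f x else g x).
Proof. move=> mb mf mg; exact: (measurable_fun_ifT mb mf mg). Qed.

Lemma mrow_affine n (f : 'rV[R]_n -> R) (c : R) v : mrow f -> mrow (fun x => f (c *: x + v)).
Proof.
move=> mf; rewrite /mrow (_ : _ \o _ = (f \o @rowt n) \o (afft c (fun i => v ord0 i))).
  by apply: measurableT_comp mf _; exact: measurable_afft.
apply/funext => t /=; congr f; apply/rowP => i.
by rewrite !mxE tnth_mktuple.
Qed.

Lemma bcs0 n : @bcs n (fun=> 0).
Proof. by split; [exact: mrow_cst|exists 0 => x; rewrite normr0]. Qed.

Lemma bcsD n (f g : 'rV[R]_n -> R) : bcs f -> bcs g -> bcs (fun x => f x + g x).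
Proof.
move=> [mf [M hM]] [mg [N hN]]; split; first exact: mrowD.
have M0 : 0 <= M by apply: le_trans (hM 0).1.
have N0 : 0 <= N by apply: le_trans (hN 0).1.
exists (M + N) => x; split.
  by rewrite (le_trans (ler_normD _ _))// lerD ?(hM x).1 ?(hN x).1.
by move=> h; rewrite (hM x).2 ?(hN x).2 ?addr0//; lra.
Qed.

Lemma bcsM n (f g : 'rV[R]_n -> R) N : bcs f -> mrow g -> (forall x, `|g x| <= N) ->
  bcs (fun x => f x * g x).
Proof.
move=> [mf [M hM]] mg hN; split; first exact: mrowM.
have M0 : 0 <= M by apply: le_trans (hM 0).1.
have N0 : 0 <= N by apply: le_trans (hN 0).
exists (M * (1 + N)) => x; split.
  rewrite normrM ler_pM ?(hM x).1// (le_trans (hN x))//; lra.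
move=> h; rewrite (hM x).2 ?mul0r//; apply: le_lt_trans h.
by rewrite ler_peMr//; lra.
Qed.

Lemma bcsZ n (f : 'rV[R]_n -> R) c : bcs f -> bcs (fun x => c * f x).
Proof.
move=> hf; apply: (@bcs_ext _ (fun x => f x * c)) => [x|]; first by rewrite mulrC.
by apply: (bcsM (N := `|c|)) => //; exact: mrow_cst.
Qed.

Lemma bcsN n (f : 'rV[R]_n -> R) : bcs f -> bcs (fun x => - f x).
Proof.
move=> hf; apply: (@bcs_ext _ (fun x => -1 * f x)) => [x|]; first by rewrite mulN1r.
exact: bcsZ.
Qed.

Lemma bcsB n (f g : 'rV[R]_n -> R) : bcs f -> bcs g -> bcs (fun x => f x - g x).
Proof. by move=> hf hg; apply: bcsD => //; exact: bcsN. Qed.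

Lemma bcs_sum n I (s : seq I) (P : pred I) (f : I -> 'rV[R]_n -> R) :
  (forall i, bcs (f i)) -> bcs (fun x => \sum_(i <- s | P i) f i x).
Proof.
move=> mf; elim: s => [|a s IH].
  apply: (@bcs_ext _ (fun=> 0)) => [x|]; first by rewrite big_nil.
  exact: bcs0.
case Pa: (P a).
  apply: (@bcs_ext _ (fun x => f a x + \sum_(i <- s | P i) f i x)) => [x|].
    by rewrite big_cons Pa.
  exact: bcsD.
by apply: (@bcs_ext _ (fun x => \sum_(i <- s | P i) f i x)) => // x; rewrite big_cons Pa.
Qed.

Lemma bcs_norm n (f : 'rV[R]_n -> R) : bcs f -> bcs (fun x => `|f x|).
Proof.
move=> [mf [M hM]]; split; first exact: mrow_norm.
by exists M => x; rewrite normr_id; split; [exact: (hM x).1|move=> /(hM x).2 ->; rewrite normr0].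
Qed.

Lemma bcs_affine n (f : 'rV[R]_n -> R) (c : R) v : 0 < c -> bcs f ->
  bcs (fun x => f (c *: x + v)).
Proof.
move=> c0 [mf [M hM]]; split; first exact: mrow_affine.
have M0 : 0 <= M by apply: le_trans (hM 0).1.
have dM : 0 <= (M + `|v|) / c by rewrite divr_ge0 ?addr_ge0// ltW.
exists (M + (M + `|v|) / c) => x; split.
  by rewrite (le_trans (hM _).1)//; lra.
move=> h; apply: (hM _).2.
have h1 : (M + `|v|) / c < `|x| by lra.
rewrite ltr_pdivrMr// mulrC in h1.
have : c * `|x| <= `|c *: x + v| + `|v|.
  rewrite -{1}(gtr0_norm c0) -normrZ -{1}[c *: x](addrK v) (le_trans (ler_normB _ _))//.
lra.
Qed.

Lemma iRnD n (f g : 'rV[R]_n -> R) : bcs f -> bcs g ->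
  \I (fun x => f x + g x) = \I f + \I g.
Proof.
by move=> hf hg; apply: RintegralD => //; exact: bcs_integrable.
Qed.

Lemma iRnZ n (f : 'rV[R]_n -> R) c : bcs f -> \I (fun x => c * f x) = c * \I f.
Proof. by move=> hf; apply: RintegralZl => //; exact: bcs_integrable. Qed.

Lemma iRnN n (f : 'rV[R]_n -> R) : bcs f -> \I (fun x => - f x) = - \I f.
Proof.
move=> hf; rewrite -mulN1r -iRnZ//; apply: iRn_ext => x.
by rewrite mulN1r.
Qed.

Lemma iRnB n (f g : 'rV[R]_n -> R) : bcs f -> bcs g ->
  \I (fun x => f x - g x) = \I f - \I g.
Proof. by move=> hf hg; rewrite iRnD ?iRnN//; exact: bcsN. Qed.

Lemma iRn0 n : \I (fun _ : 'rV[R]_n => 0 : R) = 0.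
Proof.
by have := @iRnZ n (fun=> 0) 0 (@bcs0 n); rewrite !mul0r.
Qed.

Lemma iRn_sum n I (s : seq I) (P : pred I) (f : I -> 'rV[R]_n -> R) :
  (forall i, bcs (f i)) ->
  \I (fun x => \sum_(i <- s | P i) f i x) = \sum_(i <- s | P i) \I (f i).
Proof.
move=> mf; elim: s => [|a s IH].
  by rewrite big_nil -[RHS](iRn0 n); apply: iRn_ext => x; rewrite big_nil.
rewrite big_cons; case Pa: (P a); rewrite -IH.
  by rewrite -iRnD//; [apply: iRn_ext => x; rewrite big_cons Pa|exact: bcs_sum].
by apply: iRn_ext => x; rewrite big_cons Pa.
Qed.

Lemma iRn_le n (f g : 'rV[R]_n -> R) : bcs f -> bcs g -> (forall x, f x <= g x) ->
  \I f <= \I g.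
Proof.
by move=> hf hg h; apply: le_Rintegral => //; try exact: bcs_integrable; move=> t _; exact: h.
Qed.

Lemma iRn_norm n (f : 'rV[R]_n -> R) : bcs f -> `|\I f| <= \I (fun x => `|f x|).
Proof. by move=> hf; apply: le_normr_Rintegral => //; exact: bcs_integrable. Qed.

Lemma iRn_normle n (f g : 'rV[R]_n -> R) : bcs f -> bcs g -> (forall x, `|f x| <= g x) ->
  `|\I f| <= \I g.
Proof.
by move=> hf hg h; rewrite (le_trans (iRn_norm hf))// iRn_le//; exact: bcs_norm.
Qed.

Lemma iRn_ge0 n (f : 'rV[R]_n -> R) : (forall x, 0 <= f x) -> 0 <= \I f.
Proof. by move=> h; apply: Rintegral_ge0 => t _; exact: h. Qed.

Lemma iRn_affine n (f : 'rV[R]_n -> R) (c : R) v : 0 < c -> bcs f ->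
  \I (fun x => f (c *: x + v)) = c ^- n * \I f.
Proof.
move=> c0 bf; rewrite !integral_RnE /Rintegral.
set F := EFin \o (f \o @rowt n).
have iF : (lebesgue_tuple R n).-integrable setT F by exact: bcs_integrable.
have -> : (\int[lebesgue_tuple R n]_t (((fun x => f (c *: x + v)) \o @rowt n) t)%:E)%E =
  (\int[lebesgue_tuple R n]_t F (afft c (fun i => v ord0 i) t))%E.
  apply: eq_integral => t _; rewrite /F /=; congr (f _)%:E; apply/rowP => i.
  by rewrite !mxE tnth_mktuple.
have mF : measurable_fun setT F by exact: measurable_int iF.
rewrite [in LHS]integralE.
have cn : 0 <= c ^- n by rewrite invr_ge0 exprn_ge0// ltW.
have -> : (\int[lebesgue_tuple R n]_x (fun t => F (afft c (fun i => v ord0 i) t))^\+ x =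
   (c ^- n)%:E * \int[lebesgue_tuple R n]_x F^\+ x)%E.
  rewrite -(@ge0_integral_afft _ _ _ (fun i => v ord0 i) (F^\+)%E)//; last exact: measurable_funepos.
  by apply: eq_integral => t _; rewrite !funeposE.
have -> : (\int[lebesgue_tuple R n]_x (fun t => F (afft c (fun i => v ord0 i) t))^\- x =
   (c ^- n)%:E * \int[lebesgue_tuple R n]_x F^\- x)%E.
  rewrite -(@ge0_integral_afft _ _ _ (fun i => v ord0 i) (F^\-)%E)//; last exact: measurable_funeneg.
  by apply: eq_integral => t _; rewrite !funenegE.
rewrite -muleBr//; last first.
  by rewrite fin_num_adde_defl// fin_numN integrable_neg_fin_num.
rewrite -[in X in (_ * X)%E]integralE fineM//.
exact: integrable_fin_num.
Qed.

Lemma iRn_shift n (f : 'rV[R]_n -> R) v : bcs f -> \I (fun x => f (x + v)) = \I f.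
Proof.
move=> bf; rewrite -[RHS]mul1r -{1}invr1 -{1}(expr1n R n) -(iRn_affine v ltr01 bf).
by apply: iRn_ext => x; rewrite scale1r.
Qed.

Lemma iRn_scale n (f : 'rV[R]_n -> R) c : 0 < c -> bcs f ->
  \I (fun x => f (c *: x)) = c ^- n * \I f.
Proof.
by move=> c0 bf; rewrite -(iRn_affine 0 c0 bf); apply: iRn_ext => x; rewrite addr0.
Qed.
End Rows.

(** * Complex-valued integrands and characters *)

Section Cplx.
Context (R : realType).
Notation T1 := (measurableTypeR R).
Local Notation C := R[i].
Local Notation "\I f" := (integral_Rn f) (at level 10).
Local Notation "\J f" := (cintegral_Rn f) (at level 10).
Local Notation Re := (@complex.Re R).
Local Notation Im := (@complex.Im R).

Lemma normc_ReIm (z : C) : normc z = Num.sqrt (Re z ^+ 2 + Im z ^+ 2).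
Proof. by case: z. Qed.

Lemma normc_ge0 (z : C) : 0 <= normc z.
Proof. by rewrite normc_ReIm sqrtr_ge0. Qed.

Lemma Re_le_normc (z : C) : `|Re z| <= normc z.
Proof. by rewrite normc_ReIm -sqrtr_sqr ler_wsqrtr// lerDl sqr_ge0. Qed.

Lemma Im_le_normc (z : C) : `|Im z| <= normc z.
Proof. by rewrite normc_ReIm -sqrtr_sqr ler_wsqrtr// lerDr sqr_ge0. Qed.

Lemma normc_le_ReIm (z : C) : normc z <= `|Re z| + `|Im z|.
Proof.
rewrite normc_ReIm -[leRHS]ger0_norm ?addr_ge0// -sqrtr_sqr ler_wsqrtr//.
rewrite -[Re z ^+ 2]real_normK ?num_real// -[Im z ^+ 2]real_normK ?num_real//.
by rewrite sqrrD lerD2r lerDl mulrn_wge0// mulr_ge0.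
Qed.

Lemma normcB (x y : C) : normc (x - y) <= normc x + normc y.
Proof. by rewrite (le_trans (le_normcD _ _))// normcN. Qed.

Lemma normcX (x : C) k : normc (x ^+ k) = normc x ^+ k.
Proof. by elim: k => [|k IH]; rewrite ?expr0 ?normc1// !exprS normcM IH. Qed.

Lemma normcR (a : R) : normc (a%:C)%C = `|a|.
Proof. by rewrite normc_ReIm/= expr0n addr0 sqrtr_sqr. Qed.

Lemma normc_nat k : normc (k%:R : C) = k%:R.
Proof.
have -> : (k%:R : C) = ((k%:R : R)%:C)%C by rewrite rmorph_nat.
by rewrite normcR normr_nat.
Qed.

Lemma normc_sum I (s : seq I) (P : pred I) (f : I -> C) :
  normc (\sum_(i <- s | P i) f i) <= \sum_(i <- s | P i) normc (f i).
Proof.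
elim/big_ind2 : _ => [|x a y b xa yb|//]; first by rewrite normc0.
by rewrite (le_trans (le_normcD _ _))// lerD.
Qed.

Lemma ReD (x y : C) : Re (x + y) = Re x + Re y. Proof. by case: x y => ? ? [? ?]. Qed.

Lemma ImD (x y : C) : Im (x + y) = Im x + Im y. Proof. by case: x y => ? ? [? ?]. Qed.

Lemma ReN (x : C) : Re (- x) = - Re x. Proof. by case: x => ? ?. Qed.

Lemma ImN (x : C) : Im (- x) = - Im x. Proof. by case: x => ? ?. Qed.

Lemma ReM (x y : C) : Re (x * y) = Re x * Re y - Im x * Im y.
Proof. by case: x y => ? ? [? ?]. Qed.

Lemma ImM (x y : C) : Im (x * y) = Re x * Im y + Im x * Re y.
Proof. by case: x y => ? ? [? ?]. Qed.

Lemma complex_ext (x y : C) : Re x = Re y -> Im x = Im y -> x = y.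
Proof. by case: x y => ? ? [? ?] /= -> ->. Qed.

Definition cmrow n (f : 'rV[R]_n -> C) := mrow (Re \o f) /\ mrow (Im \o f).
Definition cbcs n (f : 'rV[R]_n -> C) :=
  cmrow f /\ exists M : R, forall x, normc (f x) <= M /\ (M < `|x| -> f x = 0).

Lemma cbcs_Re n (f : 'rV[R]_n -> C) : cbcs f -> bcs (Re \o f).
Proof.
move=> [[mr mi] [M hM]]; split=> //; exists M => x; split.
  exact: le_trans (Re_le_normc _) (hM x).1.
by move=> /(hM x).2 /= ->.
Qed.

Lemma cbcs_Im n (f : 'rV[R]_n -> C) : cbcs f -> bcs (Im \o f).
Proof.
move=> [[mr mi] [M hM]]; split=> //; exists M => x; split.
  exact: le_trans (Im_le_normc _) (hM x).1.
by move=> /(hM x).2 /= ->.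
Qed.

Lemma cbcsP n (f : 'rV[R]_n -> C) : bcs (Re \o f) -> bcs (Im \o f) -> cbcs f.
Proof.
move=> [mf [M hM]] [mg [N hN]]; split=> //.
have M0 : 0 <= M by apply: le_trans (hM 0).1.
have N0 : 0 <= N by apply: le_trans (hN 0).1.
exists (M + N) => x; split.
  by rewrite (le_trans (normc_le_ReIm _))// lerD ?(hM x).1 ?(hN x).1.
move=> h; apply: complex_ext; first by rewrite [LHS](hM x).2//; lra.
by rewrite [LHS](hN x).2//; lra.
Qed.

Lemma cbcs_ext n (f g : 'rV[R]_n -> C) : f =1 g -> cbcs f -> cbcs g.
Proof. by move=> /funext ->. Qed.

Lemma cmrow_ext n (f g : 'rV[R]_n -> C) : f =1 g -> cmrow f -> cmrow g.
Proof. by move=> /funext ->. Qed.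

Lemma cint_ext n (f g : 'rV[R]_n -> C) : f =1 g -> \J f = \J g.
Proof. by move=> /funext ->. Qed.

Lemma cmrow_cst n c : @cmrow n (fun=> c). Proof. by split; exact: mrow_cst. Qed.

Lemma cmrowD n (f g : 'rV[R]_n -> C) : cmrow f -> cmrow g -> cmrow (fun x => f x + g x).
Proof.
move=> [f1 f2] [g1 g2]; split.
  by apply: mrow_ext (mrowD f1 g1) => x /=; rewrite ReD.
by apply: mrow_ext (mrowD f2 g2) => x /=; rewrite ImD.
Qed.

Lemma cmrowM n (f g : 'rV[R]_n -> C) : cmrow f -> cmrow g -> cmrow (fun x => f x * g x).
Proof.
move=> [f1 f2] [g1 g2]; split.
  by apply: mrow_ext (mrowB (mrowM f1 g1) (mrowM f2 g2)) => x /=; rewrite ReM.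
by apply: mrow_ext (mrowD (mrowM f1 g2) (mrowM f2 g1)) => x /=; rewrite ImM.
Qed.

Lemma cmrow_real n (f : 'rV[R]_n -> R) : mrow f -> cmrow (fun x => ((f x)%:C)%C).
Proof. by move=> mf; split => //; exact: mrow_cst. Qed.

Lemma cmrow_if n (b : 'rV[R]_n -> bool) (f g : 'rV[R]_n -> C) :
  measurable_fun setT (b \o @rowt R n) -> cmrow f -> cmrow g ->
  cmrow (fun x => if b x then f x else g x).
Proof.
move=> mb [f1 f2] [g1 g2]; split.
  by apply: mrow_ext (mrow_if mb f1 g1) => x /=; case: (b x).
by apply: mrow_ext (mrow_if mb f2 g2) => x /=; case: (b x).
Qed.

Lemma cbcsM n (f g : 'rV[R]_n -> C) N : cbcs f -> cmrow g -> (forall x, normc (g x) <= N) ->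
  cbcs (fun x => f x * g x).
Proof.
move=> [mf [M hM]] mg hN; split; first exact: cmrowM.
have M0 : 0 <= M by apply: le_trans (hM 0).1; exact: normc_ge0.
have N0 : 0 <= N by apply: le_trans (hN 0); exact: normc_ge0.
exists (M * (1 + N)) => x; split.
  rewrite normcM ler_pM ?normc_ge0 ?(hM x).1// (le_trans (hN x))//; lra.
move=> h; rewrite (hM x).2 ?mul0r//; apply: le_lt_trans h.
by rewrite ler_peMr//; lra.
Qed.

Lemma cbcsMl n (f g : 'rV[R]_n -> C) N : cbcs f -> cmrow g -> (forall x, normc (g x) <= N) ->
  cbcs (fun x => g x * f x).
Proof.
by move=> bf mg hN; apply: (@cbcs_ext _ (fun x => f x * g x));
  [move=> x; rewrite mulrC|exact: cbcsM hN].
Qed.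

Lemma cbcsZ n (f : 'rV[R]_n -> C) c : cbcs f -> cbcs (fun x => c * f x).
Proof. by move=> bf; apply: (@cbcsMl _ _ (fun=> c) (normc c)) => //; exact: cmrow_cst. Qed.

Lemma cbcs0 n : @cbcs n (fun=> 0).
Proof.
by split; [exact: cmrow_cst|exists 0 => x; rewrite normc0].
Qed.

Lemma cbcsD n (f g : 'rV[R]_n -> C) : cbcs f -> cbcs g -> cbcs (fun x => f x + g x).
Proof.
move=> bf bg; apply: cbcsP.
  by apply: bcs_ext (bcsD (cbcs_Re bf) (cbcs_Re bg)) => x /=; rewrite ReD.
by apply: bcs_ext (bcsD (cbcs_Im bf) (cbcs_Im bg)) => x /=; rewrite ImD.
Qed.

Lemma cbcs_sum n I (s : seq I) (P : pred I) (f : I -> 'rV[R]_n -> C) :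
  (forall i, cbcs (f i)) -> cbcs (fun x => \sum_(i <- s | P i) f i x).
Proof.
move=> mf; elim: s => [|a s IH].
  apply: (@cbcs_ext _ (fun=> 0)) => [x|]; first by rewrite big_nil.
  exact: cbcs0.
case Pa: (P a).
  apply: (@cbcs_ext _ (fun x => f a x + \sum_(i <- s | P i) f i x)) => [x|].
    by rewrite big_cons Pa.
  exact: cbcsD.
by apply: (@cbcs_ext _ (fun x => \sum_(i <- s | P i) f i x)) => // x; rewrite big_cons Pa.
Qed.

Lemma cbcs_affine n (f : 'rV[R]_n -> C) (c : R) v : 0 < c -> cbcs f ->
  cbcs (fun x => f (c *: x + v)).
Proof.
move=> c0 bf; apply: cbcsP; first exact: bcs_affine c0 (cbcs_Re bf).
exact: bcs_affine c0 (cbcs_Im bf).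
Qed.

Lemma cbcs_real n (f : 'rV[R]_n -> R) : bcs f -> cbcs (fun x => ((f x)%:C)%C).
Proof. by move=> bf; apply: cbcsP => //; exact: bcs0. Qed.

Lemma Re_cint n (f : 'rV[R]_n -> C) : Re (\J f) = \I (Re \o f). Proof. by []. Qed.

Lemma Im_cint n (f : 'rV[R]_n -> C) : Im (\J f) = \I (Im \o f). Proof. by []. Qed.

Lemma cintD n (f g : 'rV[R]_n -> C) : cbcs f -> cbcs g ->
  \J (fun x => f x + g x) = \J f + \J g.
Proof.
move=> bf bg; apply: complex_ext; rewrite ?ReD ?ImD ?Re_cint ?Im_cint.
  rewrite -iRnD; [|exact: cbcs_Re|exact: cbcs_Re].
  by apply: iRn_ext => x /=; rewrite ReD.
rewrite -iRnD; [|exact: cbcs_Im|exact: cbcs_Im].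
by apply: iRn_ext => x /=; rewrite ImD.
Qed.

Lemma cintZ n (f : 'rV[R]_n -> C) c : cbcs f -> \J (fun x => c * f x) = c * \J f.
Proof.
move=> bf; have br := cbcs_Re bf; have bi := cbcs_Im bf.
apply: complex_ext; rewrite ?ReM ?ImM ?Re_cint ?Im_cint.
  rewrite -!iRnZ// -iRnB; [|exact: bcsZ|exact: bcsZ].
  by apply: iRn_ext => x /=; rewrite ReM.
rewrite -!iRnZ// -iRnD; [|exact: bcsZ|exact: bcsZ].
by apply: iRn_ext => x /=; rewrite ImM.
Qed.

Lemma cintN n (f : 'rV[R]_n -> C) : cbcs f -> \J (fun x => - f x) = - \J f.
Proof. by move=> bf; rewrite -mulN1r -cintZ//; apply: cint_ext => x; rewrite mulN1r. Qed.

Lemma cbcsN n (f : 'rV[R]_n -> C) : cbcs f -> cbcs (fun x => - f x).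
Proof. by move=> bf; apply: cbcs_ext (cbcsZ (-1) bf) => x; rewrite mulN1r. Qed.

Lemma cintB n (f g : 'rV[R]_n -> C) : cbcs f -> cbcs g ->
  \J (fun x => f x - g x) = \J f - \J g.
Proof. by move=> bf bg; rewrite cintD ?cintN//; exact: cbcsN. Qed.

Lemma cint0 n : \J (fun _ : 'rV[R]_n => 0 : C) = 0.
Proof. by have := @cintZ n (fun=> 0) 0 (@cbcs0 n); rewrite !mul0r. Qed.

Lemma cint_sum n I (s : seq I) (P : pred I) (f : I -> 'rV[R]_n -> C) :
  (forall i, cbcs (f i)) ->
  \J (fun x => \sum_(i <- s | P i) f i x) = \sum_(i <- s | P i) \J (f i).
Proof.
move=> mf; elim: s => [|a s IH].
  by rewrite big_nil -[RHS](cint0 n); apply: cint_ext => x; rewrite big_nil.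
rewrite big_cons; case Pa: (P a); rewrite -IH.
  by rewrite -cintD//; [apply: cint_ext => x; rewrite big_cons Pa|exact: cbcs_sum].
by apply: cint_ext => x; rewrite big_cons Pa.
Qed.

Lemma cint_shift n (f : 'rV[R]_n -> C) v : cbcs f -> \J (fun x => f (x + v)) = \J f.
Proof.
move=> bf; apply: complex_ext; first exact: iRn_shift v (cbcs_Re bf).
exact: iRn_shift v (cbcs_Im bf).
Qed.

Lemma cint_scale n (f : 'rV[R]_n -> C) c : 0 < c -> cbcs f ->
  \J (fun x => f (c *: x)) = ((c ^- n)%:C)%C * \J f.
Proof.
move=> c0 bf; apply: complex_ext; rewrite ?ReM ?ImM /= ?mul0r ?subr0 ?addr0.
  exact: iRn_scale c0 (cbcs_Re bf).
exact: iRn_scale c0 (cbcs_Im bf).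
Qed.

(** The factor 2 comes from bounding real and imaginary parts separately; it is harmless. *)
Lemma cint_le n (f : 'rV[R]_n -> C) g : cbcs f -> bcs g -> (forall x, normc (f x) <= g x) ->
  normc (\J f) <= 2 * \I g.
Proof.
move=> bf bg h; rewrite (le_trans (normc_le_ReIm _))// mulr_natl mulr2n lerD//.
  apply: iRn_normle => //; first exact: cbcs_Re.
  by move=> x; exact: le_trans (Re_le_normc _) (h x).
apply: iRn_normle => //; first exact: cbcs_Im.
by move=> x; exact: le_trans (Im_le_normc _) (h x).
Qed.

Lemma expiD (a b : R) : expi (a + b) = expi a * expi b.
Proof.
apply: complex_ext; rewrite ?ReM ?ImM /= mulrDr ?cosD// sinD addrC; ring.
Qed.

Lemma normc_expi (a : R) : normc (expi a) = 1.
Proof. by rewrite normc_ReIm/= cos2Dsin2 sqrtr1. Qed.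

Lemma expi0 : expi (0 : R) = 1.
Proof. by rewrite /expi mulr0 cos0 sin0. Qed.

Lemma expi_nat k : expi (k%:R : R) = 1.
Proof.
elim: k => [|k IH]; first exact: expi0.
rewrite -natr1 expiD IH mul1r /expi mulr1 mulr_natl cos2pi.
by rewrite -[pi *+ 2]add0r (sinD2pi 0) sin0.
Qed.

Lemma expi_int (z : int) : expi (z%:~R : R) = 1.
Proof.
case: z => k; first exact: expi_nat.
rewrite NegzE mulrNz -[LHS]mulr1 -[in LHS](expi_nat k.+1) -expiD.
by rewrite -pmulrn addNr expi0.
Qed.

(** This sign change is what turns a translation by 1/(2 y_l) in frequency into decay in y_l. *)
Lemma expi_half : expi (2^-1 : R) = -1.
Proof.
rewrite /expi [2 * pi]mulrC -mulrA divff// ?mulr1 ?cospi ?sinpi.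
by apply: complex_ext; rewrite ?ReN ?ImN /= ?oppr0.
Qed.

Lemma mvt_bound (f df : R -> R) (M : R) : (forall x : R, is_derive x 1 f (df x)) ->
  (forall x, `|df x| <= M) -> forall a b, `|f b - f a| <= M * `|b - a|.
Proof.
move=> hd hM a b; wlog ab : a b / a <= b.
  by move=> h; have [/h//|/ltW/h] := leP a b; rewrite distrC [in leRHS]distrC.
have [c _ ->] := @MVT_segment _ f df a b ab (fun x _ => hd x)
  (derivable_within_continuous (fun x _ => @ex_derive _ _ _ _ _ _ _ (hd x))).
by rewrite normrM ler_wpM2r.
Qed.

Lemma expi_lip (a : R) : normc (expi a - 1) <= 4 * pi * `|a|.
Proof.
have p0 : 0 <= pi :> R := pi_ge0 R.
rewrite (le_trans (normc_le_ReIm _))// ReD ImD ReN ImN /= subr0.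
have h1 : `|cos (2 * pi * a) - 1| <= 1 * `|2 * pi * a - 0|.
  rewrite -[X in _ - X](cos0 R).
  apply: (@mvt_bound cos (fun x => - sin x)) => x.
  by rewrite normrN sin_max.
have h2 : `|sin (2 * pi * a)| <= 1 * `|2 * pi * a - 0|.
  rewrite -[X in `|X|]subr0 -[X in _ - X](sin0 R).
  by apply: (@mvt_bound sin cos) => x; exact: cos_max.
rewrite subr0 mul1r !normrM (ger0_norm p0) ger0_norm// in h1 h2; lra.
Qed.
End Cplx.

(** * Lattice unfolding and Fubini *)

Section Vol.
Context (R : realType).
Notation T1 := (measurableTypeR R).
Local Notation C := R[i].
Local Notation "\I f" := (integral_Rn f) (at level 10).
Local Notation "\J f" := (cintegral_Rn f) (at level 10).
Local Notation Re := (@complex.Re R).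
Local Notation Im := (@complex.Im R).

Lemma measurable_set_bool n (A : set (n.-tuple T1)) (b : n.-tuple T1 -> bool) :
  measurable A -> (forall t, b t <-> A t) -> measurable_fun setT b.
Proof.
move=> mA bA; apply: (measurable_fun_bool true); rewrite setTI.
rewrite (_ : _ @^-1` _ = A)//.
by apply/seteqP; split=> t /= => [/bA|/bA].
Qed.

Lemma mbool_box n M : 0 <= M -> measurable_fun setT ((fun x : 'rV[R]_n => `|x| <= M) \o @rowt R n).
Proof.
move=> M0; apply: measurable_set_bool (@measurable_tbox R n M) _ => t /=.
by apply: iff_sym; exact: rowt_norm.
Qed.

Definition ibox n (M : R) (x : 'rV[R]_n) : R := if `|x| <= M then 1 else 0.
Lemma ibox_ge0 n M (x : 'rV[R]_n) : 0 <= ibox M x.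
Proof. by rewrite /ibox; case: ifP. Qed.

Lemma bcs_ibox n M : 0 <= M -> bcs (@ibox n M).
Proof.
move=> M0; split.
  by apply: (@mrow_if _ _ (fun x => `|x| <= M) (fun=> 1) (fun=> 0));
    [exact: mbool_box|exact: mrow_cst|exact: mrow_cst].
exists (M + 1) => x; rewrite /ibox; case: ifPn => h.
  by rewrite normr1; split; [lra|move=> h'; exfalso; lra].
by rewrite normr0; split => //; lra.
Qed.

Definition boxvol n : R := \I (@ibox n 1).
Lemma boxvol_ge0 n : 0 <= boxvol n.
Proof. by apply: iRn_ge0 => x; exact: ibox_ge0. Qed.

Lemma int_ibox n M : 0 < M -> \I (@ibox n M) = M ^+ n * boxvol n.
Proof.
move=> M0; have Mi : 0 < M^-1 by rewrite invr_gt0.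
have -> : M ^+ n = M^-1 ^- n by rewrite exprVn invrK.
rewrite /boxvol -(iRn_scale Mi (bcs_ibox n ler01)); apply: iRn_ext => x.
by rewrite /ibox normrZ (gtr0_norm Mi) ler_pdivrMl// mulr1.
Qed.

Lemma iRn_bound n (f : 'rV[R]_n -> R) (M rho : R) : bcs f -> 0 < rho ->
  (forall x, `|f x| <= M) -> (forall x, rho < `|x| -> f x = 0) ->
  `|\I f| <= M * rho ^+ n * boxvol n.
Proof.
move=> bf r0 hM h0; rewrite -mulrA -int_ibox// -iRnZ; last exact/bcs_ibox/ltW.
apply: iRn_normle => //; first exact/bcsZ/bcs_ibox/ltW.
move=> x; rewrite /ibox; case: ifPn => h; first by rewrite mulr1.
by rewrite h0 ?normr0 ?mulr0// ltNge.
Qed.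

Lemma cint_bound n (f : 'rV[R]_n -> C) (M rho : R) : cbcs f -> 0 < rho ->
  (forall x, normc (f x) <= M) -> (forall x, rho < `|x| -> f x = 0) ->
  normc (\J f) <= 2 * (M * rho ^+ n * boxvol n).
Proof.
move=> bf r0 hM h0; rewrite -mulrA -int_ibox// -iRnZ; last exact/bcs_ibox/ltW.
apply: cint_le => //; first exact/bcsZ/bcs_ibox/ltW.
move=> x; rewrite /ibox; case: ifPn => h; first by rewrite mulr1.
by rewrite h0 ?normc0 ?mulr0// ltNge.
Qed.

Definition cube n (x : 'rV[R]_n) : bool := `[< forall i, 0 <= x ord0 i < 1 >].

Lemma mbool_cube n : measurable_fun setT (@cube n \o @rowt R n).
Proof.
pose A := \bigcap_(i in [set: 'I_n]) [set t : n.-tuple T1 | 0 <= tnth t i < 1].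
apply: (@measurable_set_bool _ A).
  apply: fin_bigcap_measurable => // i _.
  rewrite -[X in measurable X]setTI.
  have := @measurable_tnth _ T1 n i.
  move=> /(_ measurableT [set x | 0 <= x < 1]); apply.
  rewrite (_ : [set x | _] = [set` `[0, 1[%R]); first exact: measurable_itv.
  by apply/seteqP; split=> x /=; rewrite in_itv.
move=> t; split=> [/asboolP h i _|h].
  by have := h i; rewrite mxE.
by apply/asboolP => i; rewrite mxE; exact: h.
Qed.

(** The box of radius N is indexed by a finite type, so that sums over it factor into
    one-dimensional sums. *)
Definition zrow n N (l : 'rV['I_N.*2.+1]_n) : 'rV[int]_n :=
  \row_i ((l ord0 i : nat)%:Z - N%:Z).

Lemma realvec_coord n (x : 'rV[int]_n) i : (realvec R x) ord0 i = (x ord0 i)%:~R.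
Proof. by rewrite mxE. Qed.

(** The unit cube is a fundamental domain for Z^n: each point has exactly one translate in it,
    found by taking integer parts. *)
Lemma cube_unique n N (x : 'rV[R]_n) : `|x| <= N%:R ->
  \sum_(l : 'rV['I_N.*2.+1]_n) (if cube (x + realvec R (zrow l)) then 1 else 0) = 1 :> R.
Proof.
move=> xN.
have hfl i : - N%:Z <= - Num.floor (x ord0 i) <= N%:Z.
  have := row_coord x i; have := floor_itv (x ord0 i).
  move=> /andP[h1 h2] h3.
  have {}h3 : `|x ord0 i| <= N%:R by apply: le_trans xN.
  move: h3; rewrite ler_norml => /andP[h3 h4].
  rewrite lerN2 -(ler_int R) (le_trans h1)//=.
  rewrite lerNl -ltzD1 -(ltr_int R) (le_lt_trans _ h2)//.
  by rewrite rmorphN/=.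
(* The index of the shift by minus the integer part of x, counted from -N. *)
pose k (i : 'I_n) : nat := `|(N%:Z - Num.floor (x ord0 i))|%N.
have kE i : (k i)%:Z = N%:Z - Num.floor (x ord0 i).
  rewrite /k gez0_abs//; have := hfl i; lia.
have kN i : (k i < N.*2.+1)%N.
  by have := hfl i; rewrite -muln2; have := kE i; lia.
pose l0 : 'rV['I_N.*2.+1]_n := \row_i Ordinal (kN i).
have l0E i : (zrow l0) ord0 i = - Num.floor (x ord0 i).
  by rewrite !mxE /= kE; lia.
rewrite (bigD1 l0)//= big1 ?addr0.
  rewrite ifT//; apply/asboolP => i; rewrite mxE realvec_coord l0E rmorphN/=.
  by have /andP[h1 h2] := floor_itv (x ord0 i); rewrite intrD in h2; lra.
move=> l ll0; rewrite ifF//; apply/asboolP => h.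
move/eqP : ll0; apply; apply/rowP => i; apply/val_inj => /=.
rewrite mxE /=; have := h i; rewrite mxE realvec_coord => /andP[h1 h2].
have E : (zrow l) ord0 i = - Num.floor (x ord0 i).
  apply/eqP; rewrite -eqr_oppLR eq_sym; apply/eqP.
  by apply: floor_def; rewrite intrD rmorphN/=; lra.
have {}E : (l ord0 i : nat)%:Z = (k i)%:Z by rewrite kE; move: E; rewrite mxE; lia.
by case: E => <-; congr (nat_of_ord (l _ i)); apply: val_inj.
Qed.

(** Cut R^n into translates of the unit cube, which tile by [cube_unique], and move each of them
    back to the cube. *)
Lemma unfold_int n (f : 'rV[R]_n -> C) N : cbcs f -> (forall x, N%:R < `|x| -> f x = 0) ->
  \J f = \sum_(l : 'rV['I_N.*2.+1]_n)
     \J (fun x => if cube x then f (x - realvec R (zrow l)) else 0).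
Proof.
move=> bf hf.
pose g (l : 'rV['I_N.*2.+1]_n) x := if cube x then f (x - realvec R (zrow l)) else 0.
have bg l : cbcs (g l).
  apply: (@cbcs_ext _ _ (fun x => f (1 *: x + (- realvec R (zrow l))) *
      (if cube x then 1 else 0))).
    by move=> x; rewrite /g scale1r; case: ifP => _; rewrite ?mulr1 ?mulr0.
  apply: (@cbcsM _ _ _ _ 1); first exact: cbcs_affine.
    by apply: cmrow_if; [exact: mbool_cube|exact: cmrow_cst|exact: cmrow_cst].
  by move=> x; case: ifP; rewrite ?normc1 ?normc0.
rewrite [RHS](eq_bigr (fun l => \J (fun x => g l (x + realvec R (zrow l))))); last first.
  by move=> l _; rewrite cint_shift//.
rewrite -cint_sum; last first.
  move=> l; apply: (@cbcs_ext _ _ (fun x => g l (1 *: x + realvec R (zrow l)))).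
    by move=> x; rewrite scale1r.
  exact: cbcs_affine.
apply: cint_ext => x; rewrite /g.
have [xN|xN] := leP `|x| N%:R; last first.
  rewrite hf// big1// => l _; rewrite addrK; case: ifP => // _; exact: hf.
have := cube_unique xN => /(congr1 (fun z => f x * (z%:C)%C)).
rewrite mulr1 => <-; rewrite rmorph_sum/= mulr_sumr; apply: eq_bigr => l _.
by rewrite addrK; case: ifP => _; rewrite ?mulr1 ?mulr0.
Qed.

(** Unfolding turns uniform bounds for lattice sums of g into a bound for its integral. This
    transfers the lattice estimates for decaying weights to integrals. *)
Lemma int_le_lattice n (g : 'rV[R]_n -> R) (B : R) : bcs g -> (forall x, 0 <= g x) -> 0 <= B ->
  (forall x N, \sum_(l : 'rV['I_N.*2.+1]_n) g (x - realvec R (zrow l)) <= B) ->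
  \I g <= B * boxvol n.
Proof.
move=> bg g0 B0 hB.
have [M hM] := bg.2.
have M0 : 0 <= M by apply: le_trans (hM 0).1.
pose N := Num.bound M.
have MN : M <= N%:R by apply/ltW/archi_boundP.
have bgc := cbcs_real bg.
have := unfold_int (N := N) bgc => /(_ _)/(congr1 Re).
have hN x : N%:R < `|x| -> ((g x)%:C)%C = 0 :> C.
  by move=> h; rewrite (hM x).2//; exact: le_lt_trans h.
move=> /(_ hN).
have -> : Re (\J (fun x => (g x)%:C%C)) = \I g by [].
move=> ->.
pose gl (l : 'rV['I_N.*2.+1]_n) x := if cube x then g (x - realvec R (zrow l)) else 0.
have bgl l : bcs (gl l).
  apply: (@bcs_ext _ _ (fun x => g (1 *: x + (- realvec R (zrow l))) *
      (if cube x then 1 else 0))).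
    by move=> x; rewrite scale1r /gl; case: ifP => _; rewrite ?mulr1 ?mulr0.
  apply: (@bcsM _ _ _ _ 1); first exact: bcs_affine.
    by apply: mrow_if; [exact: mbool_cube|exact: mrow_cst|exact: mrow_cst].
  by move=> x; case: ifP; rewrite ?normr1 ?normr0.
have -> : Re (\sum_(l : 'rV['I_N.*2.+1]_n)
    \J (fun x => if cube x then (g (x - realvec R (zrow l)))%:C%C else 0)) =
    \sum_(l : 'rV['I_N.*2.+1]_n) \I (gl l).
  rewrite (big_morph Re (id1 := 0) (op1 := +%R))//; last exact: ReD.
  apply: eq_bigr => l _; rewrite Re_cint; apply: iRn_ext => x /=.
  by rewrite /gl; case: ifP.
rewrite -(iRn_sum _ _ bgl) /boxvol -iRnZ; last exact: bcs_ibox.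
apply: iRn_le; [exact: bcs_sum|exact/bcsZ/bcs_ibox|move=> x].
rewrite /gl; case hc: (cube x); last by rewrite big1// mulr_ge0// ibox_ge0.
apply: (le_trans (hB x N)); rewrite /ibox ifT ?mulr1//.
apply: row_norm_le => // i; move/asboolP : hc => /(_ i) /andP[h1 h2].
by rewrite ger0_norm// ltW.
Qed.

Definition mjoint n (f : 'rV[R]_n -> 'rV[R]_n -> R) :=
  measurable_fun [set: n.-tuple T1 * n.-tuple T1]
    (fun p : n.-tuple T1 * n.-tuple T1 => f (rowt p.1) (rowt p.2)).

Lemma fubini_real n (f : 'rV[R]_n -> 'rV[R]_n -> R) (M : R) : mjoint f ->
  (forall x y, `|f x y| <= M) ->
  (forall x y, M < `|x| -> f x y = 0) -> (forall x y, M < `|y| -> f x y = 0) ->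
  \I (fun x => \I (f x)) = \I (fun y => \I (f ^~ y)) /\ bcs (fun x => \I (f x)).
Proof.
move=> mf hM hx hy.
have M0 : 0 <= M by apply: le_trans (hM 0 0).
pose mu := lebesgue_tuple R n.
pose F (p : n.-tuple T1 * n.-tuple T1) := (f (rowt p.1) (rowt p.2))%:E.
have mF : measurable_fun setT F by exact/measurable_EFinP.
have rowtK (x : 'rV[R]_n) : rowt [tuple x ord0 i | i < n] = x.
  by apply/rowP => i; rewrite mxE tnth_mktuple.
have bfx x : bcs (f x).
  split; last by exists M => y; split; [exact: hM|exact: hy].
  rewrite /mrow (_ : _ \o _ = (fun p : n.-tuple T1 * n.-tuple T1 => f (rowt p.1) (rowt p.2)) \o
    (fun s : n.-tuple T1 => ([tuple x ord0 i | i < n] : n.-tuple T1, s))).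
    apply: (measurableT_comp mf); apply/measurable_fun_pairP.
    by split; [exact: measurable_cst|exact: measurable_id].
  by apply/funext => s /=; rewrite rowtK.
have bfy y : bcs (f ^~ y).
  split; last by exists M => x; split; [exact: hM|exact: hx].
  rewrite /mrow (_ : _ \o _ = (fun p : n.-tuple T1 * n.-tuple T1 => f (rowt p.1) (rowt p.2)) \o
    (fun s : n.-tuple T1 => (s, [tuple y ord0 i | i < n] : n.-tuple T1))).
    apply: (measurableT_comp mf); apply/measurable_fun_pairP.
    by split; [exact: measurable_id|exact: measurable_cst].
  by apply/funext => s /=; rewrite rowtK.
have M1 : 0 < M + 1 by lra.
have bI x : `|\I (f x)| <= M * (M + 1) ^+ n * boxvol n.
  by apply: iRn_bound => // y h; apply: hy; lra.
have mB := @measurable_tbox R n M.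
have iF : (mu \x mu)%E.-integrable setT F.
  pose D := @tbox R n M `*` @tbox R n M.
  have mD : measurable D by exact: measurableX.
  have e : (mu \x mu)%E D = (mu (@tbox R n M) * mu (@tbox R n M))%E.
    exact: product_measure1E.
  have fB : (mu (@tbox R n M) < +oo)%E by exact: tbox_fin.
  have fD : ((mu \x mu)%E D < +oo)%E.
    by rewrite e lte_mul_pinfty// ge0_fin_numE.
  have FD : F = F \_ D.
    apply/funext => -[t s]; rewrite /patch; case: ifPn => //.
    rewrite notin_setE /D /setX /F /= => /not_andP[] /(rowt_norm _ M0)/negP.
      by rewrite -ltNge => h; rewrite hx.
    by rewrite -ltNge => h; rewrite hy.
  rewrite FD; apply: (iffLR (integrable_mkcond F mD)).
  have -> : F = EFin \o (fun p : n.-tuple T1 * n.-tuple T1 => f (rowt p.1) (rowt p.2)) by [].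
  apply: measurable_bounded_integrable => //.
  - exact: measurable_funTS.
  - exists M; split; first exact: num_real.
    by move=> N MN p _ /=; rewrite (le_trans (hM _ _))// ltW.
have Ex (t : n.-tuple T1) : (\int[mu]_s F (t, s))%E = (\I (f (rowt t)))%:E.
  rewrite integral_RnE /Rintegral fineK//; apply: integrable_fin_num => //.
  exact: bcs_integrable.
have Ey (s : n.-tuple T1) : (\int[mu]_t F (t, s))%E = (\I (f ^~ (rowt s)))%:E.
  rewrite integral_RnE /Rintegral fineK//; apply: integrable_fin_num => //.
  exact: (bcs_integrable (bfy (rowt s))).
split.
  rewrite 2!integral_RnE /Rintegral; congr fine.
  transitivity (\int[mu]_t \int[mu]_s F (t, s))%E.
    by apply: eq_integral => t _; rewrite Ex.
  by rewrite Fubini//; apply: eq_integral => s _; rewrite Ey.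
split.
  apply/measurable_EFinP.
  have := measurable_fubini_F iF.
  by apply: eq_measurable_fun => t _; rewrite /fubini_F /= Ex.
exists (M + M * (M + 1) ^+ n * boxvol n) => x.
have b0 := le_trans (normr_ge0 _) (bI 0).
split; first by rewrite (le_trans (bI x))//; lra.
move=> h; rewrite -(iRn0 R n); apply: iRn_ext => y; apply: hx; lra.
Qed.
End Vol.

(** * Measurability, mean value bounds and finite differences *)

Section Reg.
Context (R : realType).
Notation T1 := (measurableTypeR R).

Lemma floor_cell_measurable n (c : R) (z : 'rV[int]_n) :
  measurable [set t : n.-tuple T1 | forall i, Num.floor (c * tnth t i) = z ord0 i].
Proof.
rewrite (_ : [set t | _] = \bigcap_(i in [set: 'I_n])
    [set t : n.-tuple T1 | Num.floor (c * tnth t i) = z ord0 i]); last first.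
  by apply/seteqP; split => t /= h i; [move=> _|]; apply: h.
apply: fin_bigcap_measurable => // i _.
rewrite -[X in measurable X]setTI.
have mt : measurable_fun setT (fun t : n.-tuple T1 => (c * tnth t i : T1)).
  apply: measurable_funM; first exact: measurable_cst.
  exact: (@measurable_tnth _ T1 n i).
move: mt => /(_ measurableT [set x : T1 | Num.floor x = z ord0 i]); apply.
rewrite (_ : [set x | _] = [set` `[(z ord0 i)%:~R, (z ord0 i + 1)%:~R[%R]).
  exact: measurable_itv.
apply/seteqP; split=> x /=; rewrite in_itv/=.
  by move=> <-; exact: floor_itv.
by move=> h; apply: floor_def.
Qed.

Definition grid n (k : nat) (x : 'rV[R]_n) : 'rV[R]_n :=
  \row_i ((Num.floor (k%:R * x ord0 i))%:~R / k%:R).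

(** The composition with [grid] takes countably many values, each on a cell of a grid. *)
Lemma mrow_grid n k (f : 'rV[R]_n -> R) : mrow (fun x => f (grid k x)).
Proof.
move=> _ Y mY; rewrite setTI.
pose g (z : 'rV[int]_n) : 'rV[R]_n := \row_i ((z ord0 i)%:~R / k%:R).
pose cell (z : 'rV[int]_n) :=
  [set t : n.-tuple T1 | forall i, Num.floor (k%:R * tnth t i) = z ord0 i].
pose F j := if unpickle j is Some z then
  (if `[< Y (f (g z)) >] then cell z else set0) else set0.
rewrite (_ : _ @^-1` _ = \bigcup_j F j).
  apply: bigcupT_measurable => j; rewrite /F; case: unpickle => // z.
  by case: ifP => // _; exact: floor_cell_measurable.
apply/seteqP; split=> t /=.
  pose z : 'rV[int]_n := \row_i Num.floor (k%:R * tnth t i).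
  move=> hY; exists (pickle z) => //; rewrite /F pickleK.
  have -> : g z = grid k (rowt t) by apply/rowP => i; rewrite !mxE.
  by rewrite ifT ?asboolT//= => i; rewrite mxE.
move=> [j _]; rewrite /F; case: unpickle => // z; case: ifP => // /asboolP hz ht.
rewrite (_ : grid k (rowt t) = g z)//.
by apply/rowP => i; rewrite !mxE ht.
Qed.

Lemma grid_dist n k (x : 'rV[R]_n) : (0 < k)%N -> `|x - grid k x| <= k%:R^-1.
Proof.
move=> k0; have k0' : 0 < k%:R :> R by rewrite ltr0n.
apply: row_norm_le => [|i]; first by rewrite invr_ge0 ltW.
rewrite !mxE; set y := x ord0 i.
have /andP[h1 h2] := floor_itv (k%:R * y).
rewrite intrD in h2.
rewrite (_ : y - _ = (k%:R * y - (Num.floor (k%:R * y))%:~R) / k%:R); last first.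
  by field; rewrite gt_eqF.
by rewrite normrM normfV (gtr0_norm k0') ler_pdivrMr// mulVf ?gt_eqF// ger0_norm; lra.
Qed.

(** Such a function is the pointwise limit of its values on finer and finer grids. The origin is
    allowed as an exceptional point because [grid] maps it to itself. *)
Lemma mrow_cont n (f : 'rV[R]_n -> R) : (forall x, x != 0 -> {for x, continuous f}) -> mrow f.
Proof.
move=> cf; apply: (@measurable_fun_cvg _ _ _ _ (fun k t => f (grid k.+1 (rowt t)))).
  by move=> k; exact: mrow_grid.
move=> t _ /=; have [->|x0] := eqVneq (rowt t) 0.
  rewrite (_ : (fun k => _) = fun=> f 0); first exact: cvg_cst.
  apply/funext => k; congr f; apply/rowP => i.
  by rewrite !mxE mulr0 floor0 mul0r.
have := cf _ x0; apply: cvg_comp.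
apply/cvgrPdist_le => e e0.
near=> k.
rewrite (le_trans (grid_dist _ _))//.
apply/ltW; near: k; exact: (near_infty_natSinv_lt (PosNum e0)).
Unshelve. all: by end_near. Qed.

Lemma cont_bounded n (f : 'rV[R]_n -> R) (A : set 'rV[R]_n) : compact A ->
  (forall x, A x -> {for x, continuous f}) -> exists M : R, forall x, A x -> `|f x| <= M.
Proof.
move=> cA cf; have [A0|/set0P A0] := eqVneq A set0.
  by exists 0 => x; rewrite A0.
have wc : {within A, continuous (fun x => `|f x|)}.
  apply: continuous_in_subspaceT => x /set_mem Ax.
  by apply: continuous_comp; [exact: cf|exact: norm_continuous].
have [c _ hc] := EVT_max_rV A0 cA wc.
by exists `|f c| => x Ax; apply: hc; apply/mem_set.
Qed.

Lemma box_compact n (M : R) : compact [set x : 'rV[R]_n | `|x| <= M].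
Proof.
apply: bounded_closed_compact.
  by exists M; split; [exact: num_real|move=> N MN x /= h; rewrite (le_trans h)// ltW].
rewrite (_ : [set x | _] = Num.norm @^-1` [set y : R | y <= M])//.
apply: closed_comp; last exact: closed_le.
by move=> x _; exact: norm_continuous.
Qed.

Lemma sphere_compact n : compact [set x : 'rV[R]_n | `|x| = 1].
Proof.
apply: bounded_closed_compact.
  by exists 1; split; [exact: num_real|move=> N MN x /= h; rewrite h ltW].
rewrite (_ : [set x | _] = Num.norm @^-1` [set y : R | y = 1])//.
apply: closed_comp; last exact: closed_eq.
by move=> x _; exact: norm_continuous.
Qed.

Lemma line_derive n (f : 'rV[R]_n -> R) x v (t : R) : derivable f (x + t *: v) v ->
  is_derive t 1 (fun s : R => f (x + s *: v)) ('D_v f (x + t *: v)).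
Proof.
move=> df; have E : (fun h : R => h^-1 *: (((fun s : R => f (x + s *: v)) \o shift t) (h *: 1) -
    f (x + t *: v))) = (fun h : R => h^-1 *: ((f \o shift (x + t *: v)) (h *: v) - f (x + t *: v))).
  apply/funext => h /=; congr (_ *: (f _ - _)).
  by rewrite [h *: 1]mulr1 scalerDl addrCA.
by split; rewrite /derivable /derive E.
Qed.

(** Derivatives are only assumed along the segment from x to x + u v, whence the restriction on t. *)
Lemma mvt_line n (f : 'rV[R]_n -> R) x v (u M : R) :
  (forall t, `|t| <= `|u| -> derivable f (x + t *: v) v /\ `|'D_v f (x + t *: v)| <= M) ->
  `|f (x + u *: v) - f x| <= M * `|u|.
Proof.
move=> h.
pose g (s : R) := f (x + s *: v); pose dg (s : R) := 'D_v f (x + s *: v).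
have key a b : a <= b -> (forall t, a <= t <= b -> `|t| <= `|u|) ->
    `|g b - g a| <= M * `|b - a|.
  move=> ab hab.
  have hd (t : R) : a <= t <= b -> is_derive t 1 g (dg t).
    by move=> /hab /h[? _]; exact: line_derive.
  have [||c] := @MVT_segment _ g dg a b ab.
  - move=> t; rewrite in_itv/= => /andP[h1 h2]; apply: hd.
    by rewrite (ltW h1) (ltW h2).
  - apply: derivable_within_continuous => t; rewrite in_itv/= => ht.
    by have [] := hd _ ht.
  rewrite in_itv/= => hc ->; rewrite normrM ler_wpM2r//.
  by have [] := h _ (hab _ hc).
have g0 : g 0 = f x by rewrite /g scale0r addr0.
have [u0|u0] := leP 0 u.
  have := key 0 u u0; rewrite g0 subr0; apply.
  by move=> t /andP[t0 tu]; rewrite !ger0_norm.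
have := key u 0 (ltW u0); rewrite g0 sub0r normrN distrC; apply.
by move=> t /andP[t0 tu]; rewrite ler0_norm// ltr0_norm// lerN2.
Qed.

Definition bv n (i : 'I_n) : 'rV[R]_n := delta_mx ord0 i.

Lemma bvE n (i j : 'I_n) : bv i ord0 j = (i == j)%:R.
Proof. by rewrite mxE eqxx/= eq_sym. Qed.

(** Move from x0 to x one coordinate at a time. *)
Lemma partial_lip n (f : 'rV[R]_n -> R) (x0 : 'rV[R]_n) (d M : R) :
  (forall i x, `|x - x0| <= d -> derivable f x (bv i) /\ `|partial i f x| <= M) ->
  forall x, `|x - x0| <= d -> `|f x - f x0| <= n%:R * (M * `|x - x0|).
Proof.
move=> h x xd.
have d0 : 0 <= d by apply: le_trans xd.
(* path k has the first k coordinates of x and the others of x0. *)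
pose path (k : nat) : 'rV[R]_n := \row_(i < n) (if (i < k)%N then x ord0 i else x0 ord0 i).
have p0 : path 0%N = x0 by apply/rowP => i; rewrite mxE.
have pn : path n = x by apply/rowP => i; rewrite mxE ltn_ord.
rewrite -pn -p0 -(telescope_sumr (fun k => f (path k)))// p0 pn.
rewrite (le_trans (ler_norm_sum _ _ _))//.
have -> : n%:R * (M * `|x - x0|) = \sum_(0 <= k < n) (M * `|x - x0|).
  by rewrite sumr_const_nat subn0 mulr_natl.
rewrite !big_mkord; apply: ler_sum => k _.
pose u := x ord0 k - x0 ord0 k.
have uxx : `|u| <= `|x - x0|.
  by have := row_coord (x - x0) k; rewrite !mxE.
have pk : path k.+1 = path k + u *: bv k.
  apply/rowP => j; rewrite !mxE eqxx/= ltnS /u.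
  have [->|jk] := eqVneq j k; first by rewrite leqnn ltnn mulr1 addrC subrK.
  by rewrite mulr0 addr0 leq_eqVlt (negbTE (jk : (j : nat) != k)).
have M0 : 0 <= M.
  have [|_] := h k x0; first by rewrite subrr normr0.
  exact: le_trans.
rewrite pk; apply: (@le_trans _ _ (M * `|u|)); last by rewrite ler_wpM2l.
apply: mvt_line => t tu; apply: h.
apply: row_norm_le => // j; rewrite !mxE eqxx/=.
have [->|jk] := eqVneq j k.
  by rewrite ltnn mulr1 addrAC subrr add0r (le_trans tu)// (le_trans uxx).
rewrite mulr0 addr0; case: ifP => _; last by rewrite subrr normr0.
by apply: le_trans xd; have := row_coord (x - x0) j; rewrite !mxE.
Qed.

Lemma near_ball_le n (x0 : 'rV[R]_n) (e : R) : 0 < e -> \forall x \near x0, `|x0 - x| <= e.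
Proof.
move=> e0; apply/nbhs_ballP; exists e => //= x.
by rewrite mx_norm_ball /ball_/= => /ltW.
Qed.

(** Partial derivatives that are continuous at every point are locally bounded near x0, so f is
    Lipschitz at x0 by [partial_lip]. *)
Lemma C1_continuous n (U : set 'rV[R]_n) (f : 'rV[R]_n -> R) x0 :
  open U -> C1_on U f -> U x0 -> {for x0, continuous f}.
Proof.
move=> oU hf Ux0.
have : \forall x \near x0, forall i : 'I_n, derivable f x (bv i) /\
    `|partial i f x| <= `|partial i f x0| + 1.
  pose P (i : 'I_n) (x : 'rV[R]_n) := derivable f x (bv i) /\
    `|partial i f x| <= `|partial i f x0| + 1.
  apply: (@filter_forall _ _ P (nbhs x0)) => i.
  have c := (hf i x0 Ux0).2.
  near=> x; split.
    apply: (hf i x _).1; near: x; exact: open_nbhs_nbhs.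
  have : `|partial i f x - partial i f x0| <= 1.
    rewrite distrC; near: x; by move/cvgrPdist_le : c; apply.
  have := ler_normD (partial i f x - partial i f x0) (partial i f x0).
  by rewrite subrK; lra.
move=> /nbhs_ballP[d /= d0 hd].
pose M := \sum_(i < n) (`|partial i f x0| + 1).
have M0 : 0 <= M by apply: sumr_ge0 => i _; rewrite addr_ge0.
have hd2 : forall i x, `|x - x0| <= d / 2 -> derivable f x (bv i) /\ `|partial i f x| <= M.
  move=> i x hx; have [|h1 h2] := hd x _ i.
    by rewrite mx_norm_ball /ball_/= distrC; lra.
  split => //; rewrite (le_trans h2)// /M (bigD1 i)//= lerDl.
  by apply: sumr_ge0 => j _; rewrite addr_ge0.
have L := partial_lip hd2.
rewrite /continuous_at; apply/(@cvgrPdist_le _ _ _ (nbhs x0)) => e e0.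
have nM : 0 < n%:R * M + 1 by rewrite ltr_pwDr// mulr_ge0.
near=> x.
have xd : `|x - x0| <= d / 2.
  rewrite distrC; near: x; apply: near_ball_le.
  by rewrite divr_gt0.
have xe : `|x - x0| <= e / (n%:R * M + 1).
  rewrite distrC; near: x; apply: near_ball_le.
  by rewrite divr_gt0.
rewrite distrC (le_trans (L x xd))//.
rewrite ler_pdivlMr// in xe.
have := normr_ge0 (x - x0); lra.
Unshelve. all: by end_near. Qed.

(** The difference operator replaces derivatives in the decay estimates: it commutes with
    translations, and it acts on Fourier transforms without integration by parts. *)
Definition fd n (l : 'I_n) (u : R) (f : 'rV[R]_n -> R) : 'rV[R]_n -> R :=
  fun x => f (x + u *: bv l) - f x.

Lemma derive_shift n (f : 'rV[R]_n -> R) (w x v : 'rV[R]_n) : derivable f (x + w) v ->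
  derivable (fun y => f (y + w)) x v /\ 'D_v (fun y => f (y + w)) x = 'D_v f (x + w).
Proof.
have E : (fun h : R => h^-1 *: (((fun y => f (y + w)) \o shift x) (h *: v) - f (x + w))) =
   (fun h : R => h^-1 *: ((f \o shift (x + w)) (h *: v) - f (x + w))).
  by apply/funext => h /=; rewrite addrA.
by rewrite /derivable /derive E.
Qed.

Lemma partial_fd n (l : 'I_n) u (f : 'rV[R]_n -> R) : (forall x, derivable f x (bv l)) ->
  (forall x, derivable (fd l u f) x (bv l)) /\ partial l (fd l u f) = fd l u (partial l f).
Proof.
move=> df.
have h x := derive_shift (df (x + u *: bv l)).
split=> [x|]; first by apply: derivableB => //; exact: (h x).1.
apply/funext => x; rewrite /partial /fd.
rewrite (@deriveB _ _ _ (fun x => f (x + u *: bv l)) f)//; last exact: (h x).1.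
by rewrite (h x).2.
Qed.

(** Iterated mean value theorem. *)
Lemma fd_bound n (l : 'I_n) u k (f : 'rV[R]_n -> R) (B : R) :
  (forall m, (m < k)%N -> forall x, derivable (iter m (partial l) f) x (bv l)) ->
  (forall x, `|iter k (partial l) f x| <= B) ->
  forall x, `|iter k (fd l u) f x| <= `|u| ^+ k * B.
Proof.
elim: k f B => [|k IH] f B df hB x; first by rewrite /= expr0 mul1r; exact: hB.
have E m : (m <= k)%N -> iter m (partial l) (fd l u f) = fd l u (iter m (partial l) f).
  elim: m => [//|m IHm] mk; rewrite !iterS IHm 1?ltnW//.
  by have [_ ->] := partial_fd u (df m (ltnW mk)).
rewrite iterSr exprSr -mulrA; apply: IH.
  move=> m mk y; rewrite E 1?ltnW//.
  by have [+ _] := partial_fd u (df m (ltnW mk)); apply.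
move=> y; rewrite E// /fd mulrC.
apply: mvt_line => t _; split; first exact: df.
by have := hB (y + t *: bv l); rewrite iterS.
Qed.

End Reg.

(** * The dyadic cutoffs *)

Section Enorm.
Context (R : realType).

Lemma dotxx_ge0 n (x : 'rV[R]_n) : 0 <= dot x x.
Proof. by apply: sumr_ge0 => i _; rewrite -expr2 sqr_ge0. Qed.

Lemma enorm_ge0 n (x : 'rV[R]_n) : 0 <= enorm x.
Proof. exact: sqrtr_ge0. Qed.

Lemma enorm_sqr n (x : 'rV[R]_n) : enorm x ^+ 2 = dot x x.
Proof. by rewrite sqr_sqrtr// dotxx_ge0. Qed.

Lemma enormZ n (c : R) (x : 'rV[R]_n) : enorm (c *: x) = `|c| * enorm x.
Proof.
rewrite /enorm (_ : dot (c *: x) (c *: x) = c ^+ 2 * dot x x).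
  by rewrite sqrtrM ?sqr_ge0// sqrtr_sqr.
by rewrite /dot mulr_sumr; apply: eq_bigr => i _; rewrite !mxE; ring.
Qed.

Lemma coord_le_enorm n (x : 'rV[R]_n) i : `|x ord0 i| <= enorm x.
Proof.
rewrite -sqrtr_sqr ler_wsqrtr// /dot (bigD1 i)//= -expr2 lerDl.
by apply: sumr_ge0 => j _; rewrite -expr2 sqr_ge0.
Qed.

Lemma norm_le_enorm n (x : 'rV[R]_n) : `|x| <= enorm x.
Proof. by apply: row_norm_le => [|i]; [exact: enorm_ge0|exact: coord_le_enorm]. Qed.

Lemma enorm0 n : enorm (0 : 'rV[R]_n) = 0.
Proof. by rewrite /enorm /dot big1 ?sqrtr0// => i _; rewrite mxE mul0r. Qed.

Lemma enorm_gt0 n (x : 'rV[R]_n) : x != 0 -> 0 < enorm x.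
Proof. by move=> x0; apply: lt_le_trans (norm_le_enorm x); rewrite normr_gt0. Qed.

Lemma enorm_gt0P n (x : 'rV[R]_n) : (0 < enorm x) = (x != 0).
Proof.
apply/idP/idP; last exact: enorm_gt0.
by apply: contraTneq => ->; rewrite enorm0 ltxx.
Qed.

Lemma enorm_add1 n (x : 'rV[R]_n) u (l : 'I_n) : enorm (x + u *: bv R l) <= enorm x + `|u|.
Proof.
have e0 : 0 <= enorm x + `|u| by rewrite addr_ge0// enorm_ge0.
rewrite -[leRHS]ger0_norm// -sqrtr_sqr ler_wsqrtr//.
have -> : dot (x + u *: bv R l) (x + u *: bv R l) = dot x x + 2 * u * x ord0 l + u ^+ 2.
  rewrite /dot (bigD1 l)//= [in RHS](bigD1 l)//= !mxE eqxx/= eqxx.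
  have -> : \sum_(i < n | i != l) (x + u *: bv R l) ord0 i * (x + u *: bv R l) ord0 i =
     \sum_(i < n | i != l) x ord0 i * x ord0 i.
    by apply: eq_bigr => i il; rewrite !mxE eqxx/= (negbTE il) mulr0 addr0.
  rewrite mulr1; ring.
rewrite -enorm_sqr sqrrD real_normK ?num_real// lerD2r lerD2l.
have h := coord_le_enorm x l.
have : u * x ord0 l <= `|u| * enorm x.
  by rewrite (le_trans (ler_norm _))// normrM ler_wpM2l.
rewrite mulr2n; lra.
Qed.

Lemma mrow_enorm n : mrow (@enorm R n).
Proof.
apply: (@mrow_comp _ _ Num.sqrt); first by apply: continuous_measurable_fun; exact: sqrt_continuous.
by apply: mrow_sum => i; apply: mrowM; exact: mrow_coord.
Qed.

Lemma mbool_enorm_lt n (a : R) : measurable_fun setT ((fun x : 'rV[R]_n => enorm x < a) \o @rowt R n).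
Proof. exact: (measurable_fun_ltr (@mrow_enorm n) (measurable_cst a)). Qed.

Lemma mbool_enorm_le n (a : R) : measurable_fun setT ((fun x : 'rV[R]_n => enorm x <= a) \o @rowt R n).
Proof. exact: (measurable_fun_ler (@mrow_enorm n) (measurable_cst a)). Qed.

Lemma mbool_enorm_gt n (a : R) : measurable_fun setT ((fun x : 'rV[R]_n => a < enorm x) \o @rowt R n).
Proof. exact: (measurable_fun_ltr (measurable_cst a) (@mrow_enorm n)). Qed.
End Enorm.

Section FdMore.
Context (R : realType) (n : nat) (l : 'I_n).
Implicit Types f g : 'rV[R]_n -> R.

Lemma iter_fdS u k f x :
  iter k.+1 (fd l u) f x = iter k (fd l u) f (x + u *: bv R l) - iter k (fd l u) f x.
Proof. by []. Qed.

(** A k-fold difference at x only sees the points x + i u e_l with i <= k. *)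
Lemma fd_local u k f g x : (forall i, (i <= k)%N ->
    f (x + (i%:R * u) *: bv R l) = g (x + (i%:R * u) *: bv R l)) ->
  iter k (fd l u) f x = iter k (fd l u) g x.
Proof.
elim: k x => [|k IH] x h.
  by have := h 0%N isT; rewrite mul0r scale0r addr0.
rewrite !iter_fdS (IH x) ?(IH (x + u *: bv R l))// => i ik.
  have -> : x + u *: bv R l + (i%:R * u) *: bv R l = x + (i.+1%:R * u) *: bv R l.
    by rewrite -natr1 mulrDl mul1r scalerDl addrAC -addrA.
  exact: h.
by apply: h; apply: leqW.
Qed.

Lemma fd_scale u k (c : R) f x :
  iter k (fd l u) (fun x => f (c *: x)) x = iter k (fd l (c * u)) f (c *: x).
Proof.
elim: k x => [//|k IH] x.
by rewrite !iter_fdS !IH scalerDr scalerA.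
Qed.

Lemma fd_sub u k f g x :
  iter k (fd l u) (fun x => f x - g x) x = iter k (fd l u) f x - iter k (fd l u) g x.
Proof.
elim: k x => [//|k IH] x.
by rewrite !iter_fdS !IH; ring.
Qed.

Lemma fd_cst u k (c : R) x : iter k.+1 (fd l u) (fun=> c) x = 0.
Proof.
elim: k x => [|k IH] x; first by rewrite /= /fd subrr.
by rewrite iter_fdS !IH subrr.
Qed.
End FdMore.

Section Cutoff.
Context (R : realType) (n : nat) (psi : 'rV[R]_n -> R) (hpsi : cutoff psi).
Let hsm : smooth psi. Proof. by case: hpsi. Qed.
Let h01 : forall xi, 0 <= psi xi <= 1. Proof. by case: hpsi. Qed.
Let hsupp : forall xi, psi xi != 0 -> 2^-1 <= enorm xi <= 2. Proof. by case: hpsi. Qed.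
Let hsum : forall xi, xi != 0 -> (\esum_(l in [set: int]) (dilate psi l xi)%:E = 1)%E.
Proof. by case: hpsi. Qed.

Lemma psi_cont : continuous psi.
Proof. by move=> x; apply: (@C1_continuous _ _ setT) => //; [exact: openT|exact: (hsm [::])]. Qed.

(** The closed annulus of the support condition can be opened: where psi does not vanish it does
    not vanish on a neighbourhood either. *)
Lemma psi_supp x : psi x != 0 -> 2^-1 < enorm x < 2.
Proof.
move=> px.
have /andP[h1 h2] := hsupp px.
have e0 : 0 < enorm x by lra.
have ct : (fun t : R => psi (t *: x)) t @[t --> (1:R)] --> psi (1 *: x).
  apply: (@continuous_comp _ _ _ (fun t : R => t *: x) psi); last exact: psi_cont.
  exact: scalel_continuous.
have : \forall t \near (1:R), psi (t *: x) != 0.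
  rewrite scale1r in ct; apply: (ct [set y : R | y != 0]).
  by apply: open_nbhs_nbhs; split => //; exact: open_neq.
move=> /nbhs_ballP[d /= d0 hd].
(* Along the ray through x, the support condition holds for t slightly above and below 1. *)
have hb (t : R) : `|t - 1| < d -> 2^-1 <= `|t| * enorm x <= 2.
  by move=> td; rewrite -enormZ; apply/hsupp/hd; rewrite /ball/= distrC.
pose e := Num.min (d / 2) (2^-1).
have e1 : 0 < e by rewrite lt_min divr_gt0//= invr_gt0.
have e2 : e <= 2^-1 by rewrite ge_min lexx orbT.
have e3 : e < d.
  by apply: (@le_lt_trans _ _ (d / 2)); [rewrite ge_min lexx|rewrite ltr_pdivrMr// ltr_pMr// ltr1n].
have /andP[_ h3] : 2^-1 <= `|1 + e| * enorm x <= 2.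
  by apply: hb; rewrite addrAC subrr add0r gtr0_norm.
have /andP[h4 _] : 2^-1 <= `|1 - e| * enorm x <= 2.
  by apply: hb; rewrite addrAC subrr add0r normrN gtr0_norm.
rewrite gtr0_norm in h3; last by lra.
rewrite ger0_norm in h4; last by lra.
have p := mulr_gt0 e1 e0.
by apply/andP; split; nra.
Qed.

Lemma psi_out x : enorm x <= 2^-1 \/ 2 <= enorm x -> psi x = 0.
Proof.
move=> h; apply/eqP; apply/negP => /negP /psi_supp /andP[h1 h2]; case: h; lra.
Qed.

(** A derivative of psi is continuous and vanishes off a compact set. *)
Lemma psi_deriv_bound k : exists B : R, 0 <= B /\ forall l x, `|iter k (partial l) psi x| <= B.
Proof.
have key l : exists B : R, 0 <= B /\ forall x, `|iter k (partial l) psi x| <= B.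
  have E : iter k (partial l) psi = iter_partial (nseq k l) psi.
    by rewrite /iter_partial; elim: k => //= k ->.
  have c x : {for x, continuous (iter k (partial l) psi)}.
    by rewrite E; exact: (C1_continuous openT (hsm (nseq k l)) I).
  (* Derivatives of psi vanish where psi vanishes locally. *)
  have z x : 2 < `|x| -> iter k (partial l) psi x = 0.
    elim: k {E c} x => [|k IH] x hx /=.
      by apply: psi_out; right; apply: le_trans (norm_le_enorm x); exact: ltW.
    rewrite /partial (@near_eq_derive _ _ _ _ (fun=> 0)) ?derive_cst//.
    have : \forall y \near x, 2 < `|y|.
      apply: (@norm_continuous R _ x [set y : R | 2 < y]).
      by apply: open_nbhs_nbhs; split => //; exact: open_gt.
    by apply: filterS => y; exact: IH.
  have [B hB] := cont_bounded (@box_compact R n 2) (fun x _ => c x).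
  exists `|B|; split=> // x; have [h|h] := leP `|x| 2.
    exact: le_trans (hB x h) (ler_norm _).
  by rewrite z// normr0.
have [F hF] := boolp.choice key.
exists (\sum_l F l); split.
  by apply: sumr_ge0 => l _; have [] := hF l.
move=> l x; rewrite (bigD1 l)//=; have [F0 /(_ x) h] := hF l.
by rewrite (le_trans h)// lerDl; apply: sumr_ge0 => j _; have [] := hF j.
Qed.

Lemma psi_fd_bound k : exists B : R, 0 <= B /\ forall l u x, `|iter k (fd l u) psi x| <= `|u| ^+ k * B.
Proof.
have [B [B0 hB]] := psi_deriv_bound k.
exists B; split=> // l u x; apply: fd_bound; last exact: hB.
move=> m _ y; have E : iter m (partial l) psi = iter_partial (nseq m l) psi.
  by rewrite /iter_partial; elim: m => //= m ->.
by rewrite E; have [] := hsm (nseq m l) l (x := y) I.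
Qed.

Lemma dilate_nat (m : nat) x : dilate psi m%:Z x = psi ((2^-1 ^+ m) *: x).
Proof. by rewrite /dilate -exprz_inv. Qed.

Lemma dilate_ge0 l x : (0 <= (dilate psi l x)%:E)%E.
Proof. by rewrite lee_fin; have /andP[] := h01 ((2:R) ^ (- l) *: x). Qed.

Lemma enorm_dilate (l : int) (x : 'rV[R]_n) : enorm ((2:R) ^ (- l) *: x) = (2:R) ^ (- l) * enorm x.
Proof. by rewrite enormZ ger0_norm// exprz_ge0. Qed.

(** On this ball only the terms l = 1 and l = 2 of the defining sum survive, which makes chi an
    explicit smooth function. *)
Lemma chi_lt4 x : enorm x < 4 -> chi_of psi x = 1 - (psi (2^-1 *: x) + psi (4^-1 *: x)).
Proof.
move=> x4; rewrite /chi_of; congr (1 - _).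
have -> : (\esum_(l in [set l : int | (1 <= l)%R]) (dilate psi l x)%:E =
  \esum_(l in [set 1%:Z; 2%:Z]) (dilate psi l x)%:E)%E.
  have -> : [set 1%:Z; 2%:Z] = [set l : int | (1 <= l)%R] `&` [set 1%:Z; 2%:Z].
    by apply/seteqP; split => l /= => [[]->//|[]//]; split=> //; [left|right].
  rewrite esum_mkcondr; apply: eq_esum => l /= l1; case: ifPn => // hl.
  congr EFin; apply: psi_out; left; rewrite enorm_dilate.
  (* For l >= 3 the dilated point has norm below 4/8. *)
  have {}hl : (3 <= l)%R.
    move: hl; rewrite notin_setE /= => /not_orP[]/eqP h1 /eqP h2.
    by move: l1 h1 h2; lia.
  case: l {l1} hl => [m m3|m]; last by rewrite NegzE; lia.
  have {}m3 : (3 <= m)%N by lia.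
  rewrite -exprz_inv -[_ ^ _]/(2^-1 ^+ m) -(subnK m3) exprD.
  have h1 : 2^-1 ^+ (m - 3) <= 1 :> R by rewrite exprn_ile1//; lra.
  have h2 : 0 <= 2^-1 ^+ (m - 3) :> R by rewrite exprn_ge0.
  rewrite (_ : 2^-1 ^+ 3 = 8^-1); last by rewrite exprVn; congr (_^-1); ring.
  have := enorm_ge0 x; nra.
rewrite esum_fset//; last by move=> l _; exact: dilate_ge0.
rewrite fsbigU//; last by move=> l /= [-> ].
by rewrite !fsbig_set1 (dilate_nat 1) (dilate_nat 2) expr1 expr2 -invfM -natrM.
Qed.

(** The terms with l <= 0 vanish there, so that the sum over l >= 1 is the full partition of unity. *)
Lemma chi_ge2 x : 2 <= enorm x -> chi_of psi x = 0.
Proof.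
move=> x2; rewrite /chi_of.
have -> : (\esum_(l in [set l : int | (1 <= l)%R]) (dilate psi l x)%:E =
  \esum_(l in [set: int]) (dilate psi l x)%:E)%E.
  rewrite -[X in esum X _]setTI esum_mkcondr; apply: eq_esum => l _; case: ifPn => // hl.
  apply/esym; congr EFin; apply: psi_out; right; rewrite enorm_dilate.
  have {}hl : (l <= 0)%R by move: hl; rewrite notin_setE /=; lia.
  have : 1 <= (2:R) ^ (- l) by rewrite -(expr0z 2) ler_weXz2l ?ler1n// oppr_ge0.
  by move=> h; apply: (le_trans x2); rewrite ler_peMl// enorm_ge0.
by rewrite hsum ?subrr// -enorm_gt0P; lra.
Qed.

(** Each dyadic piece is a difference of two dilates of chi; used to compute the mean of K psi_1. *)
Lemma psi1E x : psi (2^-1 *: x) = chi_of psi (2^-1 *: x) - chi_of psi x.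
Proof.
have E : enorm (2^-1 *: x) = 2^-1 * enorm x by rewrite enormZ gtr0_norm.
have [x4|x4] := ltP (enorm x) 4.
  rewrite !chi_lt4 ?E; [|lra|lra].
  rewrite !scalerA (_ : 2^-1 * 2^-1 = 4^-1); last by lra.
  rewrite [psi ((4^-1 * 2^-1) *: x)]psi_out; first by ring.
  by left; rewrite enormZ gtr0_norm; lra.
rewrite psi_out; last by right; rewrite E; lra.
by rewrite !chi_ge2 ?subrr ?E//; lra.
Qed.

Lemma chi_one x : enorm x <= 1 -> chi_of psi x = 1.
Proof.
move=> x1; rewrite chi_lt4; last lra.
rewrite !psi_out ?addr0 ?subr0//; left; rewrite enormZ gtr0_norm; lra.
Qed.

Lemma chi_bound x : `|chi_of psi x| <= 3.
Proof.
have [x4|x4] := ltP (enorm x) 4; last by rewrite chi_ge2 ?normr0//; lra.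
rewrite chi_lt4//.
have /andP[h1 h2] := h01 (2^-1 *: x); have /andP[h3 h4] := h01 (4^-1 *: x).
by rewrite ler_norml; apply/andP; split; lra.
Qed.

Lemma mrow_psi c : mrow (fun x => psi (c *: x)).
Proof.
apply: mrow_cont => x _.
have h := @continuous_comp _ _ _ (fun x : 'rV[R]_n => c *: x) psi x
  (@scaler_continuous _ _ c x) (@psi_cont _).
exact: h.
Qed.

Lemma mrow_chi : mrow (chi_of psi).
Proof.
apply: (@mrow_ext _ _ (fun x => if enorm x < 4 then 1 - (psi (2^-1 *: x) + psi (4^-1 *: x)) else 0)).
  by move=> x; case: ltP => h; [rewrite chi_lt4|rewrite chi_ge2//; lra].
apply: (@mrow_if _ _ (fun x => enorm x < 4)); [exact: mbool_enorm_lt| |exact: mrow_cst].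
by apply: mrowB; [exact: mrow_cst|apply: mrowD; exact: mrow_psi].
Qed.

Lemma bcs_chi : bcs (chi_of psi).
Proof.
split; first exact: mrow_chi.
exists 3 => x; split; first exact: chi_bound.
move=> h; apply: chi_ge2; have := norm_le_enorm x; lra.
Qed.

(** Where chi is [chi_lt4] the bound comes from psi; further out the difference vanishes. The
    step is restricted so that the points of the difference stay on one side. *)
Lemma chi_fd k : (0 < k)%N -> exists B : R, 0 <= B /\ forall l u x, k%:R * `|u| <= 1 ->
  `|iter k (fd l u) (chi_of psi) x| <= `|u| ^+ k * B.
Proof.
move=> k0; have [B [B0 hB]] := psi_fd_bound k.
exists (2 * B); split; first lra.
move=> l u x ku.
have hi (i : nat) : (i <= k)%N -> `|i%:R * u| <= 1.
  move=> ik; rewrite normrM normr_nat (le_trans _ ku)//.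
  by rewrite ler_wpM2r// ler_nat.
have u0 : 0 <= `|u| ^+ k by rewrite exprn_ge0.
(* The points of the difference are within distance 1 of x: beyond radius 2 if |x| >= 3, inside
   radius 4 otherwise. *)
have [x3|x3] := ltP (enorm x) 3; last first.
  rewrite (@fd_local _ _ _ _ _ _ (fun=> 0)).
    by case: k k0 {hB ku hi u0} => // k _; rewrite fd_cst normr0 mulr_ge0 ?exprn_ge0//; lra.
  move=> i ik; apply: chi_ge2.
  have := enorm_add1 (x + (i%:R * u) *: bv R l) (- (i%:R * u)) l.
  by rewrite scaleNr addrK normrN; have := hi i ik; lra.
pose g (x : 'rV[R]_n) := 1 - psi (2^-1 *: x) - psi (4^-1 *: x).
rewrite (@fd_local _ _ _ _ _ _ g); last first.
  move=> i ik; rewrite chi_lt4 /g ?opprD ?addrA//.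
  by have := enorm_add1 x (i%:R * u) l; have := hi i ik; lra.
rewrite /g fd_sub fd_sub.
have -> : iter k (fd l u) (fun=> 1) x = 0 by case: k k0 {hB ku hi u0} => // k _; exact: fd_cst.
rewrite !fd_scale sub0r (le_trans (ler_normB _ _))// normrN.
have h c : 0 <= c <= 1 -> `|iter k (fd l (c * u)) psi (c *: x)| <= `|u| ^+ k * B.
  move=> /andP[c0 c1]; rewrite (le_trans (hB _ _ _))// normrM exprMn ger0_norm//.
  rewrite ler_wpM2r// ler_piMl// exprn_ile1//.
have h2 := h 2^-1; have h4 := h 4^-1.
rewrite mulrCA mulr_natl mulr2n; apply: lerD; [apply: h2|apply: h4]; lra.
Qed.
End Cutoff.

(** * Lattice sums of a product weight *)

Section Lattice.
Context (R : realType).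

(** One-dimensional weight at scale lam; its square is summable over Z with sum O(lam). *)
Definition decay (lam a : R) : R := (1 + `|a| / lam)^-1.

Lemma decay_gt0 lam a : 0 < lam -> 0 < decay lam a.
Proof. by move=> l0; rewrite invr_gt0 ltr_pwDl// divr_ge0// ltW. Qed.

Lemma decay_le1 lam a : 0 < lam -> decay lam a <= 1.
Proof.
move=> l0; rewrite invf_le1 ?lerDl ?divr_ge0// ?(ltW l0)//.
by rewrite ltr_pwDl// divr_ge0// ltW.
Qed.

(** A bounded increasing function whose increments over unit steps dominate the square of [decay];
    it replaces the comparison of the sum with an integral. *)
Definition telescoper (lam a : R) : R := 2 * lam * a / (lam + `|a|).

Lemma telescoper_bound lam a : 0 < lam -> `|telescoper lam a| <= 2 * lam.
Proof.
move=> l0; have h : 0 < lam + `|a| by rewrite ltr_pwDl.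
rewrite /telescoper !normrM normfV (gtr0_norm l0) (gtr0_norm h) ger0_norm//.
rewrite ler_pdivrMr//; have := normr_ge0 a; nra.
Qed.

Lemma telescoper_step lam a : 1 <= lam -> decay lam a ^+ 2 <= telescoper lam (a + 1) - telescoper lam a.
Proof.
move=> l1; have l0 : 0 < lam by lra.
have decayE : decay lam a = lam / (lam + `|a|).
  have := normr_ge0 a => an; rewrite /decay; field; rewrite !gt_eqF//; lra.
have [a0|a0] := leP 0 a.
  rewrite decayE /telescoper !ger0_norm; [|lra|lra].
  have -> : 2 * lam * (a + 1) / (lam + (a + 1)) - 2 * lam * a / (lam + a) =
     2 * lam ^+ 2 / ((lam + a) * (lam + (a + 1))).
    by field; rewrite !gt_eqF//; lra.
  rewrite ler_pdivlMr; last by apply: mulr_gt0; lra.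
  have -> : (lam / (lam + a)) ^+ 2 * ((lam + a) * (lam + (a + 1))) =
     lam ^+ 2 * ((lam + (a + 1)) / (lam + a)).
    by field; rewrite !gt_eqF//; lra.
  rewrite [leRHS]mulrC ler_wpM2l ?sqr_ge0// ler_pdivrMr; lra.
(* On either half-line the increment is 2 lam^2 / ((lam + |a|)(lam + |a + 1|)). *)
have [a1|a1] := leP a (-1).
  rewrite decayE /telescoper !ler0_norm; [|lra|lra].
  have -> : 2 * lam * (a + 1) / (lam + - (a + 1)) - 2 * lam * a / (lam + - a) =
     2 * lam ^+ 2 / ((lam - a) * (lam - a - 1)).
    by field; apply/andP; split; rewrite gt_eqF//; lra.
  rewrite ler_pdivlMr; last by apply: mulr_gt0; lra.
  have -> : (lam / (lam - a)) ^+ 2 * ((lam - a) * (lam - a - 1)) =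
     lam ^+ 2 * ((lam - a - 1) / (lam - a)).
    by field; rewrite !gt_eqF//; lra.
  rewrite [leRHS]mulrC ler_wpM2l ?sqr_ge0// ler_pdivrMr; lra.
(* When 0 lies between a and a + 1, the increment is at least 2 lam / (lam + 1) >= 1. *)
apply: (@le_trans _ _ 1).
  by rewrite exprn_ile1//; [apply/ltW/decay_gt0|exact: decay_le1].
rewrite /telescoper (ltr0_norm a0) (ger0_norm (x := a + 1)); last lra.
have h1 : (a + 1) / (lam + 1) <= (a + 1) / (lam + (a + 1)).
  by rewrite ler_wpM2l ?lef_pV2 ?posrE; lra.
have h2 : (- a) / (lam + 1) <= (- a) / (lam - a).
  by rewrite ler_wpM2l ?lef_pV2 ?posrE; lra.
have h3 : 1 <= 2 * lam * (1 / (lam + 1)) by rewrite mulrA mulr1 ler_pdivlMr; lra.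
have -> : 2 * lam * (a + 1) / (lam + (a + 1)) - 2 * lam * a / (lam - a) =
   2 * lam * ((a + 1) / (lam + (a + 1)) + (- a) / (lam - a)).
  by field; apply/andP; split; rewrite gt_eqF//; lra.
apply: (le_trans h3); rewrite ler_wpM2l//; first lra.
have -> : 1 / (lam + 1) = (a + 1) / (lam + 1) + (- a) / (lam + 1) by field; rewrite gt_eqF//; lra.
exact: lerD.
Qed.

Lemma decay_sum1 lam w M : 1 <= lam -> \sum_(j < M) decay lam (j%:R - w) ^+ 2 <= 4 * lam.
Proof.
move=> l1; have l0 : 0 < lam by lra.
apply: (@le_trans _ _ (\sum_(0 <= j < M) (telescoper lam (j.+1%:R - w) - telescoper lam (j%:R - w)))).
  rewrite big_mkord; apply: ler_sum => j _.
  by have := telescoper_step (j%:R - w) l1; rewrite -natr1 addrAC.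
rewrite (@telescope_sumr _ 0 M (fun j => telescoper lam (j%:R - w)))//.
have := telescoper_bound (M%:R - w) l0; have := telescoper_bound (0%:R - w) l0.
by rewrite !ler_norml => /andP[h1 h2] /andP[h3 h4]; lra.
Qed.

Definition decay_prod n (lam : R) (y : 'rV[R]_n) : R := \prod_(i < n) decay lam (y ord0 i).

Lemma decay_prod_gt0 n lam (y : 'rV[R]_n) : 0 < lam -> 0 < decay_prod lam y.
Proof. by move=> l0; apply: prodr_gt0 => i _; exact: decay_gt0. Qed.

Lemma decay_prod_le1 n lam (y : 'rV[R]_n) : 0 < lam -> decay_prod lam y <= 1.
Proof.
move=> l0; rewrite /decay_prod -[leRHS](_ : \prod_(i < n) 1 = 1); last by rewrite big1.
by apply: ler_prod => i _; rewrite (ltW (decay_gt0 _ l0)) decay_le1.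
Qed.

(** The sum over a box is a product of one-dimensional sums. *)
Lemma decay_prod_box n N lam (z : 'rV[R]_n) : 1 <= lam ->
  \sum_(l : 'rV['I_N.*2.+1]_n) decay_prod lam (realvec R (zrow l) - z) ^+ 2 <= (4 * lam) ^+ n.
Proof.
move=> l1; have l0 : 0 < lam by lra.
pose F (i : 'I_n) (j : 'I_N.*2.+1) := decay lam (j%:R - (N%:R + z ord0 i)) ^+ 2.
have -> : \sum_(l : 'rV['I_N.*2.+1]_n) decay_prod lam (realvec R (zrow l) - z) ^+ 2 =
   \prod_i \sum_j F i j.
  rewrite bigA_distr_bigA /=.
  rewrite (reindex (fun f : {ffun 'I_n -> 'I_N.*2.+1} => \row_i f i)) /=.
    apply: eq_bigr => f _; rewrite /decay_prod -prodrXl; apply: eq_bigr => i _.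
    rewrite /F !mxE; congr (decay _ _ ^+ 2).
    by rewrite intrD rmorphN/= opprD addrA.
  exists (fun l : 'rV_n => [ffun i => l ord0 i]) => l _.
    by apply/ffunP => i; rewrite ffunE mxE.
  by apply/rowP => i; rewrite mxE ffunE.
rewrite -[leRHS](_ : \prod_(i < n) (4 * lam) = _); last by rewrite prodr_const card_ord.
apply: ler_prod => i _; rewrite decay_sum1// andbT.
by apply: sumr_ge0 => j _; rewrite sqr_ge0.
Qed.

Lemma zrow_inj n N : injective (@zrow n N).
Proof.
move=> a b /rowP ab; apply/rowP => i; apply/val_inj => /=.
have := ab i; rewrite !mxE => /(congr1 (fun z => z + N%:Z)).
by rewrite !subrK => -[].
Qed.

Lemma zrow_surj n N (y : 'rV[int]_n) : (forall i, - N%:Z <= y ord0 i <= N%:Z) ->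
  exists l : 'rV['I_N.*2.+1]_n, zrow l = y.
Proof.
move=> h; pose k i : nat := absz (y ord0 i + N%:Z).
have kE i : (k i)%:Z = y ord0 i + N%:Z.
  by rewrite /k gez0_abs//; have := h i; lia.
have kN i : (k i < N.*2.+1)%N by have := h i; rewrite -muln2; have := kE i; lia.
exists (\row_i Ordinal (kN i)); apply/rowP => i; rewrite !mxE /= kE addrK //.
Qed.

Lemma seq_in_box n (X : seq 'rV[int]_n) :
  exists N : nat, forall y, y \in X -> forall i, - N%:Z <= y ord0 i <= N%:Z.
Proof.
elim: X => [|y X [N hN]]; first by exists 0%N.
exists (N + \sum_i absz (y ord0 i))%N => z; rewrite inE => /orP[/eqP -> i|/hN h i].
  rewrite (bigD1 i)//=; lia.
by have := h i; lia.
Qed.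

(** Every finite set of lattice points lies in a box. *)
Lemma sum_le_box n (X : seq 'rV[int]_n) (F : 'rV[int]_n -> R) (B : R) : uniq X ->
  (forall y, 0 <= F y) ->
  (forall N, \sum_(l : 'rV['I_N.*2.+1]_n) F (zrow l) <= B) -> \sum_(y <- X) F y <= B.
Proof.
move=> uX F0 hB; have [N hN] := seq_in_box X.
apply: le_trans (hB N).
rewrite -(big_map (@zrow n N) predT F).
set s := map _ _.
have us : uniq s by rewrite map_inj_uniq ?index_enum_uniq//; exact: zrow_inj.
have sub : {subset X <= s}.
  move=> y /hN hy; have [l <-] := zrow_surj hy.
  by apply: map_f; rewrite mem_index_enum.
apply: (@le_trans _ _ (\sum_(y <- s | y \in X) F y)); last first.
  rewrite [leRHS](bigID (mem X)) /= lerDl.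
  by apply: sumr_ge0.
rewrite -[leRHS]big_filter le_eqVlt (perm_big [seq y <- s | y \in X]) ?eqxx//=.
apply: uniq_perm => //; first exact: filter_uniq.
move=> y; rewrite mem_filter; case yX: (y \in X) => //=.
by rewrite (sub _ yX).
Qed.

Lemma decay_prod_sum n lam (z : 'rV[R]_n) (X : seq 'rV[int]_n) : 1 <= lam -> uniq X ->
  \sum_(y <- X) decay_prod lam (realvec R y - z) ^+ 2 <= (4 * lam) ^+ n.
Proof.
move=> l1 uX; apply: (sum_le_box (F := fun y => decay_prod lam (realvec R y - z) ^+ 2)) => //.
  by move=> y; rewrite sqr_ge0.
by move=> N; exact: decay_prod_box.
Qed.
End Lattice.

(** * The smoothing kernel *)

Section Phi.
Context (R : realType) (n : nat).
Local Notation C := R[i].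
Local Notation "\I f" := (integral_Rn f) (at level 10).
Local Notation "\J f" := (cintegral_Rn f) (at level 10).
Implicit Types (x y z : 'rV[R]_n).

Lemma dotC x y : dot x y = dot y x.
Proof. by apply: eq_bigr => i _; rewrite mulrC. Qed.

Lemma dotDl x y z : dot (x + y) z = dot x z + dot y z.
Proof. by rewrite /dot -big_split; apply: eq_bigr => i _; rewrite mxE mulrDl. Qed.

Lemma dotDr x y z : dot z (x + y) = dot z x + dot z y.
Proof. by rewrite dotC dotDl !(dotC z). Qed.

Lemma dotZl (c : R) x y : dot (c *: x) y = c * dot x y.
Proof. by rewrite /dot mulr_sumr; apply: eq_bigr => i _; rewrite mxE mulrA. Qed.

Lemma dotNl x y : dot (- x) y = - dot x y.
Proof. by rewrite -scaleN1r dotZl mulN1r. Qed.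

Lemma dotNr x y : dot x (- y) = - dot x y.
Proof. by rewrite dotC dotNl dotC. Qed.

Lemma dot_bv l y : dot (bv R l) y = y ord0 l.
Proof.
rewrite /dot (bigD1 l)//= bvE eqxx mul1r big1 ?addr0// => i il.
by rewrite bvE eq_sym (negbTE il) mul0r.
Qed.

Lemma dot_le x y : `|dot x y| <= n%:R * (`|x| * `|y|).
Proof.
rewrite (le_trans (ler_norm_sum _ _ _))//.
apply: (@le_trans _ _ (\sum_(i < n) `|x| * `|y|)).
  by apply: ler_sum => i _; rewrite normrM ler_pM// row_coord.
by rewrite sumr_const card_ord mulr_natl.
Qed.

Lemma mrow_dot y : mrow (fun x => dot x y).
Proof. by apply: mrow_sum => i; apply: mrowM; [exact: mrow_coord|exact: mrow_cst]. Qed.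

Lemma cmrow_expi (f : 'rV[R]_n -> R) : mrow f -> cmrow (fun x => expi (f x)).
Proof.
move=> mf; have mg : mrow (fun x => 2 * pi * f x) by apply: mrowM => //; exact: mrow_cst.
split; apply: mrow_comp mg; apply: continuous_measurable_fun.
  exact: continuous_cos.
exact: continuous_sin.
Qed.

Definition invF (g : 'rV[R]_n -> R) y : C := \J (fun eta => expi (dot eta y) * ((g eta)%:C)%C).

Lemma cbcs_expi (f : 'rV[R]_n -> C) y : cbcs f -> cbcs (fun eta => expi (dot eta y) * f eta).
Proof.
move=> bf; apply: (@cbcsMl _ _ _ _ 1) => //; first by apply: cmrow_expi; exact: mrow_dot.
by move=> x; rewrite normc_expi.
Qed.

Lemma bcs_fd l u (g : 'rV[R]_n -> R) : bcs g -> bcs (fd l u g).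
Proof.
move=> bg; apply: bcsB => //.
by apply: bcs_ext (bcs_affine (u *: bv R l) ltr01 bg) => x; rewrite scale1r.
Qed.

Lemma bcs_iter_fd l u k (g : 'rV[R]_n -> R) : bcs g -> bcs (iter k (fd l u) g).
Proof. by move=> bg; elim: k => //= k IH; exact: bcs_fd. Qed.

(** Translating g by u = 1/(2 y_l) along the l-th axis multiplies its inverse transform at y by
    exp(-i pi) = -1, so the difference multiplies it by -2. *)
Lemma invF_fd l (g : 'rV[R]_n -> R) y : bcs g -> y ord0 l != 0 ->
  invF (fd l (2 * y ord0 l)^-1 g) y = - 2 * invF g y.
Proof.
move=> bg yl; set u := (2 * y ord0 l)^-1.
have b1 := cbcs_expi y (cbcs_real bg).
have bgu : bcs (fun x => g (x + u *: bv R l)).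
  by apply: bcs_ext (bcs_affine (u *: bv R l) ltr01 bg) => x; rewrite scale1r.
have b2 := cbcs_expi y (cbcs_real bgu).
transitivity (\J (fun eta => expi (dot eta y) * ((g (eta + u *: bv R l))%:C)%C) - invF g y).
  rewrite -cintB//; apply: cint_ext => x; rewrite /fd rmorphB/= mulrBr //.
have -> : \J (fun eta => expi (dot eta y) * ((g (eta + u *: bv R l))%:C)%C) = - invF g y.
  rewrite /invF -[in RHS](cint_shift (u *: bv R l))// -cintN; last first.
    by apply: cbcs_ext (cbcs_affine (u *: bv R l) ltr01 b1) => x; rewrite scale1r.
  apply: cint_ext => x; rewrite dotDl dotZl dot_bv.
  have -> : u * y ord0 l = 2^-1 by rewrite /u; field.
  by rewrite expiD expi_half mulrN1 mulNr opprK.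
by rewrite mulNr mulr_natl mulr2n opprD.
Qed.

Lemma invF_iter_fd l k (g : 'rV[R]_n -> R) y : bcs g -> y ord0 l != 0 ->
  invF (iter k (fd l (2 * y ord0 l)^-1) g) y = (- 2) ^+ k * invF g y.
Proof.
move=> bg yl; elim: k => [|k IH]; first by rewrite expr0 mul1r.
by rewrite iterS invF_fd ?IH ?exprS ?mulrA//; exact: bcs_iter_fd.
Qed.

Section WithPsi.
Context (psi : 'rV[R]_n -> R) (hpsi : cutoff psi).
Local Notation chi := (chi_of psi).
Local Notation V := (boxvol R n).

Definition chi_dil (lam : R) x := chi (lam *: x).
Definition phi lam y := invF (chi_dil lam) y.

Lemma bcs_chi_dil lam : 0 < lam -> bcs (chi_dil lam).
Proof.
move=> l0; apply: bcs_ext (bcs_affine 0 l0 (bcs_chi hpsi)) => x.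
by rewrite addr0.
Qed.

Lemma chi_dil_out lam x : 0 < lam -> 2 / lam <= `|x| -> chi_dil lam x = 0.
Proof.
move=> l0 h; apply: (chi_ge2 hpsi); apply: le_trans (norm_le_enorm _).
by rewrite normrZ gtr0_norm// mulrC -ler_pdivrMr.
Qed.

Lemma chi_dil_bound lam x : `|chi_dil lam x| <= 3. Proof. exact: chi_bound. Qed.

(** The bump has height lam^(-n), since the cutoff lives on a ball of radius 2/lam. *)
Lemma phi_triv lam y : 0 < lam -> normc (phi lam y) <= 6 * 2 ^+ n * V * lam ^- n.
Proof.
move=> l0.
have -> : 6 * 2 ^+ n * V * lam ^- n = 2 * (3 * (2 / lam) ^+ n * V).
  by rewrite exprMn exprVn; ring.
apply: cint_bound.
- by apply: cbcs_expi; apply: cbcs_real; exact: bcs_chi_dil.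
- by rewrite divr_gt0.
- by move=> x; rewrite normcM normc_expi mul1r normcR chi_dil_bound.
- by move=> x h; rewrite chi_dil_out// ?mulr0// ltW.
Qed.

(** Apply [invF_iter_fd] k times with step 1/(2 y_l); each difference of the dilated cutoff gains
    a factor lam / y_l. The condition on y_l is what [chi_fd] requires of the step. *)
Lemma phi_far k : (0 < k)%N -> exists B : R, 0 <= B /\ forall lam y l, 0 < lam ->
  k%:R * lam <= 2 * `|y ord0 l| ->
  normc (phi lam y) <= B * lam ^- n * (lam / `|y ord0 l|) ^+ k.
Proof.
move=> k0; have [B [B0 hB]] := chi_fd hpsi k0.
exists (2 * 3 ^+ n * V * B); split.
  by rewrite !mulr_ge0 ?exprn_ge0 ?boxvol_ge0.
move=> lam y l l0 hy; set a := y ord0 l.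
have kge1 : 1 <= k%:R :> R by rewrite ler1n.
have a0 : 0 < `|a| by rewrite -/a in hy; nra.
have a0' : a != 0 by rewrite -normr_gt0.
set u := (2 * a)^-1.
have un : `|u| = (2 * `|a|)^-1 by rewrite /u normfV normrM ger0_norm.
(* The k steps of length lam u stay within distance 1, as required by the cutoff estimate. *)
have ku : k%:R * `|lam * u| <= 1.
  rewrite normrM un (gtr0_norm l0) mulrA ler_pdivrMr ?mul1r//.
  by rewrite mulr_gt0.
have step := @invF_iter_fd l k (chi_dil lam) y (bcs_chi_dil l0) a0'.
have -> : normc (phi lam y) = 2 ^- k * normc (invF (iter k (fd l u) (chi_dil lam)) y).
  by rewrite step normcM normcX normcN normc_nat mulrA mulVf ?mul1r//.
have hb : normc (invF (iter k (fd l u) (chi_dil lam)) y) <=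
    2 * (`|lam * u| ^+ k * B * (3 / lam) ^+ n * V).
  apply: cint_bound.
  - by apply: cbcs_expi; apply: cbcs_real; apply: bcs_iter_fd; exact: bcs_chi_dil.
  - by rewrite divr_gt0.
  - move=> x; rewrite normcM normc_expi mul1r normcR.
    by rewrite /chi_dil fd_scale hB.
  (* The radius 3/lam is 2/lam for the support of the cutoff plus 1/lam for the k steps. *)
  - move=> x hx; rewrite (@fd_local _ _ _ _ _ _ (fun=> 0)).
      by case: k k0 {hB hy kge1 ku step} => // k _; rewrite fd_cst mulr0.
    move=> i ik; apply: chi_dil_out => //.
    have h1 : `|(i%:R * u) *: bv R l| <= 1 / lam.
      rewrite normrZ; have : `|bv R l| <= 1.
        by apply: row_norm_le => // j; rewrite bvE; case: (_ == _); rewrite ?normr1 ?normr0.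
      move=> hbv; apply: (@le_trans _ _ `|i%:R * u|); first by rewrite ler_piMr.
      rewrite ler_pdivlMr// normrM normr_nat (le_trans _ ku)// normrM (gtr0_norm l0).
      by rewrite -mulrA [`|u| * _]mulrC ler_wpM2r ?ler_nat// mulr_ge0// ltW.
    have h2 : 3 / lam = 2 / lam + 1 / lam by rewrite -mulrDl; congr (_ / _); ring.
    have := ler_normB (x + (i%:R * u) *: bv R l) ((i%:R * u) *: bv R l).
    by rewrite addrK; lra.
apply: (@le_trans _ _ (2 ^- k * (2 * (`|lam * u| ^+ k * B * (3 / lam) ^+ n * V)))).
  by rewrite ler_wpM2l// invr_ge0 exprn_ge0.
have -> : `|lam * u| = 2^-1 * (lam / `|a|).
  by rewrite normrM (gtr0_norm l0) un; field; rewrite ?normr_eq0 ?a0'.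
have p1 : 0 <= (lam / `|a|) ^+ k by rewrite exprn_ge0// divr_ge0// ltW.
rewrite [(2^-1 * _) ^+ k]exprMn [(3 / lam) ^+ n]exprMn [lam^-1 ^+ n]exprVn.
have c1 : 0 <= 2^-1 ^+ k :> R by rewrite exprn_ge0.
have c2 : 2^-1 ^+ k <= 1 :> R by rewrite exprn_ile1//; lra.
have c3 : 2 ^- k <= 1 :> R by rewrite -exprVn.
have c4 : 0 <= 2 ^- k :> R by rewrite invr_ge0 exprn_ge0.
set A := lam ^- n; have A0 : 0 <= A by rewrite invr_ge0 exprn_ge0// ltW.
have -> : 2 ^- k * (2 * (2^-1 ^+ k * (lam / `|a|) ^+ k * B * (3 ^+ n * A) * V)) =
   (2 ^- k * 2^-1 ^+ k) * (2 * 3 ^+ n * V * B * A * (lam / `|a|) ^+ k) by ring.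
have V0 := boxvol_ge0 R n.
have t3 : 0 <= 3 ^+ n :> R by rewrite exprn_ge0.
rewrite -[leRHS]mul1r; apply: ler_wpM2r; first by rewrite !mulr_ge0.
by rewrite mulr_ile1.
Qed.

Lemma phi_decay1 k : (0 < k)%N -> exists B : R, 0 <= B /\ forall lam y l, 0 < lam ->
  normc (phi lam y) <= B * lam ^- n * decay lam (y ord0 l) ^+ k.
Proof.
move=> k0; have [B [B0 hB]] := phi_far k0.
have V0 := boxvol_ge0 R n.
set B1 := 6 * 2 ^+ n * V.
have B10 : 0 <= B1 by rewrite !mulr_ge0 ?exprn_ge0.
exists (3 ^+ k * B + (1 + k%:R) ^+ k * B1); split.
  by rewrite addr_ge0// mulr_ge0// exprn_ge0// addr_ge0.
move=> lam y l l0; set a := y ord0 l.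
have A0 : 0 <= lam ^- n by rewrite invr_ge0 exprn_ge0// ltW.
have d0 := decay_gt0 a l0.
have dk0 : 0 <= decay lam a ^+ k by rewrite exprn_ge0// ltW.
have kge1 : 1 <= k%:R :> R by rewrite ler1n.
(* Close to the hyperplane y_l = 0 the weight is bounded below and the trivial bound is enough. *)
have [h|h] := leP (k%:R * lam) (2 * `|a|).
  have a0 : 0 < `|a| by nra.
  apply: (le_trans (hB lam y l l0 h)); rewrite -/a.
  apply: (@le_trans _ _ (3 ^+ k * B * lam ^- n * decay lam a ^+ k)).
    have -> : 3 ^+ k * B * lam ^- n * decay lam a ^+ k = B * lam ^- n * (3 * decay lam a) ^+ k.
      by rewrite [(3 * _) ^+ k]exprMn; ring.
    rewrite ler_wpM2l ?mulr_ge0//; apply: lerXn2r; rewrite ?nnegrE.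
    - by rewrite divr_ge0// ltW.
    - by rewrite mulr_ge0// ltW.
    - rewrite /decay ler_pdivlMr ?ltr_pwDl ?divr_ge0 ?(ltW l0)// mulrDr mulr1.
      have -> : lam / `|a| * (`|a| / lam) = 1 by field; rewrite !gt_eqF.
      have : lam / `|a| <= 2 by rewrite ler_pdivrMr//; nra.
      lra.
  do 2 apply: ler_wpM2r => //.
  by rewrite lerDl mulr_ge0// exprn_ge0// addr_ge0.
apply: (le_trans (phi_triv y l0)); rewrite -/B1.
apply: (@le_trans _ _ ((1 + k%:R) ^+ k * B1 * lam ^- n * decay lam a ^+ k)).
  have -> : (1 + k%:R) ^+ k * B1 * lam ^- n * decay lam a ^+ k =
     B1 * lam ^- n * ((1 + k%:R) * decay lam a) ^+ k by rewrite [(_ * decay _ _) ^+ k]exprMn; ring.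
  rewrite ler_peMr ?mulr_ge0//; apply: exprn_ege1.
  rewrite /decay ler_pdivlMr ?mul1r ?ltr_pwDl ?divr_ge0 ?(ltW l0)// lerD2l ler_pdivrMr//.
  by have := normr_ge0 a; nra.
do 2 apply: ler_wpM2r => //.
by rewrite lerDr mulr_ge0// exprn_ge0.
Qed.

Context (n0 : (0 < n)%N).

(** Take 4n differences along the coordinate with the smallest weight: its 4n-th power is at most
    the fourth power of the product of all the weights. *)
Lemma phi_decay : exists B : R, 0 <= B /\ forall lam y, 0 < lam ->
  normc (phi lam y) <= B * lam ^- n * decay_prod lam y ^+ 4.
Proof.
have k0 : (0 < n * 4)%N by rewrite muln_gt0 n0.
have [B [B0 hB]] := phi_decay1 k0.
exists B; split=> // lam y l0.
have A0 : 0 <= lam ^- n by rewrite invr_ge0 exprn_ge0// ltW.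
pose l := [arg min_(i < Ordinal n0) decay lam (y ord0 i)]%O.
have lmin i : decay lam (y ord0 l) <= decay lam (y ord0 i).
  rewrite /l; case: Order.TotalTheory.arg_minP => // j _; exact.
apply: (le_trans (hB lam y l l0)); rewrite ler_wpM2l ?mulr_ge0// exprM.
have d0 := ltW (decay_gt0 (y ord0 l) l0).
apply: lerXn2r; rewrite ?nnegrE ?exprn_ge0// ?(ltW (decay_prod_gt0 _ l0))//.
rewrite -[leLHS](_ : \prod_(i < n) decay lam (y ord0 l) = _); last by rewrite prodr_const card_ord.
by apply: ler_prod => i _; rewrite d0 lmin.
Qed.

(** Translating by z multiplies the Fourier transform by a character, which differs from 1 by
    O(|z| / lam) on the support of the cutoff. *)
Lemma phi_lip : exists B : R, 0 <= B /\ forall lam y z, 0 < lam ->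
  normc (phi lam (y - z) - phi lam y) <= B * lam ^- n * (`|z| / lam).
Proof.
have p0 : 0 <= pi :> R := pi_ge0 R.
exists (2 * (12 * pi * (2 * n%:R)) * 2 ^+ n * V); split.
  by rewrite !mulr_ge0 ?exprn_ge0 ?boxvol_ge0.
move=> lam y z l0.
have b y' := cbcs_expi y' (cbcs_real (bcs_chi_dil l0)).
have -> : phi lam (y - z) - phi lam y = \J (fun eta => expi (dot eta y) *
     ((expi (- dot eta z) - 1) * ((chi_dil lam eta)%:C)%C)).
  rewrite -cintB//; apply: cint_ext => x.
  by rewrite dotDr dotNr expiD; ring.
have -> : 2 * (12 * pi * (2 * n%:R)) * 2 ^+ n * V * lam ^- n * (`|z| / lam) =
    2 * ((12 * pi * (n%:R * (2 / lam * `|z|))) * (2 / lam) ^+ n * V).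
  by rewrite [(2 / lam) ^+ n]exprMn exprVn; ring.
apply: cint_bound.
- apply: cbcs_expi; apply: (@cbcsMl _ _ _ _ 2); first by apply: cbcs_real; exact: bcs_chi_dil.
    apply: cmrowD; last exact: cmrow_cst.
    by apply: cmrow_expi; apply: mrowN; exact: mrow_dot.
  move=> x; rewrite (le_trans (normcB _ _))// normc_expi normc1; lra.
- by rewrite divr_gt0.
- move=> x; rewrite normcM normc_expi mul1r normcM normcR.
  have [h|h] := leP (2 / lam) `|x|.
    rewrite chi_dil_out// normr0 mulr0 !mulr_ge0 ?invr_ge0 ?(ltW l0)//.
  apply: (@le_trans _ _ (4 * pi * `|- dot x z| * 3)).
    rewrite ler_pM ?normc_ge0 ?chi_dil_bound//; exact: expi_lip.
  rewrite normrN.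
  have : `|dot x z| <= n%:R * (2 / lam * `|z|).
    rewrite (le_trans (dot_le _ _))// ler_wpM2l// ler_wpM2r//; exact: ltW.
  nra.
- by move=> x h; rewrite chi_dil_out// ?mulr0// ltW.
Qed.

End WithPsi.
End Phi.

(** * Kernels of multipliers localized near the origin *)

Section Joint.
Context (R : realType) (n : nat).
Notation T1 := (measurableTypeR R).
Local Notation C := R[i].
Local Notation "\I f" := (integral_Rn f) (at level 10).
Local Notation "\J f" := (cintegral_Rn f) (at level 10).
Local Notation Re := (@complex.Re R).
Local Notation Im := (@complex.Im R).

Definition cmjoint (F : 'rV[R]_n -> 'rV[R]_n -> C) :=
  mjoint (fun x y => Re (F x y)) /\ mjoint (fun x y => Im (F x y)).

Lemma mjointM (f g : 'rV[R]_n -> 'rV[R]_n -> R) : mjoint f -> mjoint g ->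
  mjoint (fun x y => f x y * g x y).
Proof. by move=> mf mg; exact: measurable_funM mf mg. Qed.

Lemma mjointD (f g : 'rV[R]_n -> 'rV[R]_n -> R) : mjoint f -> mjoint g ->
  mjoint (fun x y => f x y + g x y).
Proof. by move=> mf mg; exact: measurable_funD mf mg. Qed.

Lemma mjointB (f g : 'rV[R]_n -> 'rV[R]_n -> R) : mjoint f -> mjoint g ->
  mjoint (fun x y => f x y - g x y).
Proof. by move=> mf mg; exact: measurable_funB mf mg. Qed.

Lemma mjoint_ext (f g : 'rV[R]_n -> 'rV[R]_n -> R) : (forall x y, f x y = g x y) ->
  mjoint f -> mjoint g.
Proof. by move=> h; have -> : f = g by apply/funext => x; apply/funext => y; exact: h. Qed.

Lemma mjoint_fst (f : 'rV[R]_n -> R) : mrow f -> mjoint (fun x _ => f x).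
Proof. by move=> mf; exact: (measurableT_comp mf measurable_fst). Qed.

Lemma mjoint_snd (f : 'rV[R]_n -> R) : mrow f -> mjoint (fun _ y => f y).
Proof. by move=> mf; exact: (measurableT_comp mf measurable_snd). Qed.

Lemma mjoint_comp (g : R -> R) (f : 'rV[R]_n -> 'rV[R]_n -> R) : measurable_fun setT g ->
  mjoint f -> mjoint (fun x y => g (f x y)).
Proof. by move=> mg mf; exact: (measurableT_comp mg mf). Qed.

Lemma mjoint_sum I (s : seq I) (f : I -> 'rV[R]_n -> 'rV[R]_n -> R) :
  (forall i, mjoint (f i)) -> mjoint (fun x y => \sum_(i <- s) f i x y).
Proof.
move=> mf; elim: s => [|a s IH].
  apply: (@mjoint_ext (fun _ _ => 0)) => [x y|]; first by rewrite big_nil.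
  exact: (mjoint_fst (mrow_cst 0)).
apply: (@mjoint_ext (fun x y => f a x y + \sum_(i <- s) f i x y)) => [x y|].
  by rewrite big_cons.
exact: mjointD.
Qed.

Lemma mjoint_dot : mjoint (@dot R n).
Proof.
apply: mjoint_sum => i; apply: mjointM.
  exact: (mjoint_fst (@mrow_coord R n i)).
exact: (mjoint_snd (@mrow_coord R n i)).
Qed.

Lemma cmjointM F G : cmjoint F -> cmjoint G -> cmjoint (fun x y => F x y * G x y).
Proof.
move=> [f1 f2] [g1 g2]; split.
  by apply: mjoint_ext (mjointB (mjointM f1 g1) (mjointM f2 g2)) => x y; rewrite ReM.
by apply: mjoint_ext (mjointD (mjointM f1 g2) (mjointM f2 g1)) => x y; rewrite ImM.
Qed.

Lemma cmjoint_fst (f : 'rV[R]_n -> C) : cmrow f -> cmjoint (fun x _ => f x).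
Proof. by move=> [f1 f2]; split; [exact: (mjoint_fst f1)|exact: (mjoint_fst f2)]. Qed.

Lemma cmjoint_snd (f : 'rV[R]_n -> C) : cmrow f -> cmjoint (fun _ y => f y).
Proof. by move=> [f1 f2]; split; [exact: (mjoint_snd f1)|exact: (mjoint_snd f2)]. Qed.

Lemma cmjoint_expi (f : 'rV[R]_n -> 'rV[R]_n -> R) : mjoint f -> cmjoint (fun x y => expi (f x y)).
Proof.
move=> mf; have mg : mjoint (fun x y => 2 * pi * f x y).
  by apply: mjointM => //; exact: (mjoint_fst (mrow_cst (2 * pi))).
split; apply: mjoint_comp mg; apply: continuous_measurable_fun.
  exact: continuous_cos.
exact: continuous_sin.
Qed.

Lemma cfubini (F : 'rV[R]_n -> 'rV[R]_n -> C) (M : R) : cmjoint F ->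
  (forall x y, normc (F x y) <= M) ->
  (forall x y, M < `|x| -> F x y = 0) -> (forall x y, M < `|y| -> F x y = 0) ->
  \J (fun x => \J (F x)) = \J (fun y => \J (F ^~ y)) /\ cbcs (fun x => \J (F x)).
Proof.
move=> [mr mi] hM hx hy.
have [||| r1 r2] := fubini_real (M := M) mr.
- by move=> x y; apply: le_trans (Re_le_normc _) (hM x y).
- by move=> x y /hx ->.
- by move=> x y /hy ->.
have [||| i1 i2] := fubini_real (M := M) mi.
- by move=> x y; apply: le_trans (Im_le_normc _) (hM x y).
- by move=> x y /hx ->.
- by move=> x y /hy ->.
by split; [apply: complex_ext|apply: cbcsP].
Qed.

(** Used for the measurability of phi. *)
Lemma lip_mrow (f : 'rV[R]_n -> R) (L : R) : (forall x y, `|f x - f y| <= L * `|x - y|) -> mrow f.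
Proof.
move=> hL; apply: mrow_cont => x _.
rewrite /continuous_at; apply/(@cvgrPdist_le _ _ _ (nbhs x)) => e e0.
near=> y; apply: (le_trans (hL _ _)).
have L1 : 0 < `|L| + 1 by rewrite ltr_pwDr.
have : `|x - y| <= e / (`|L| + 1).
  by near: y; apply: near_ball_le; rewrite divr_gt0.
rewrite ler_pdivlMr// => h; have := ler_norm L; have := normr_ge0 (x - y); nra.
Unshelve. all: by end_near. Qed.

End Joint.

Section Interp.
Context (R : realType).
(** With a and b the weights at the two end points: D is at most u and at most a^2 + b^2, so at most
    a geometric mean of both. Half of the decay is kept for summability, and the rest is traded
    for the power t of the Lipschitz factor u; this is why t stops at 1/2. *)
Lemma interp_min (D u a b t : R) : 0 <= a <= 1 -> 0 <= b <= 1 -> 0 <= u ->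
  0 <= t <= 2^-1 -> D <= u -> D <= a ^+ 2 + b ^+ 2 -> D <= 2 * u `^ t * (a + b).
Proof.
move=> /andP[a0 a1] /andP[b0 b1] u0 /andP[t0 t1] Du Dab.
pose m := Num.max a b.
have m0 : 0 <= m by rewrite le_max a0.
have m1 : m <= 1 by rewrite ge_max a1 b1.
have am : a <= m by rewrite le_max lexx.
have bm : b <= m by rewrite le_max lexx orbT.
have mab : m <= a + b by rewrite ge_max lerDl lerDr a0 b0.
have ut : 0 <= u `^ t by exact: powR_ge0.
have D2 : D <= 2 * m ^+ 2.
  apply: (le_trans Dab); rewrite mulr_natl mulr2n lerD// lerXn2r//.
(* As t <= 1/2 and m <= 1. *)
have mt : (m ^+ 2) `^ (1 - t) <= m.
  have [->|mn0] := eqVneq m 0.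
    by rewrite expr0n/= powR0// gt_eqF//; lra.
  have mp : 0 < m by rewrite lt_neqAle eq_sym mn0.
  have m2 : 0 < m ^+ 2 by rewrite exprn_gt0.
  apply: (@le_trans _ _ ((m ^+ 2) `^ (2^-1))).
    by apply: ger_powR; [rewrite m2 exprn_ile1|lra].
  by rewrite powR12_sqrt ?sqr_ge0// sqrtr_sqr ger0_norm.
suff : D <= 2 * u `^ t * m.
  by move=> h; apply: (le_trans h); rewrite ler_wpM2l// mulr_ge0.
have split1 x : 0 <= x -> x = x `^ t * x `^ (1 - t).
  move=> x0; rewrite -powRD; last by rewrite subrKC oner_eq0.
  by rewrite subrKC powRr1.
have [h|h] := leP u (m ^+ 2).
  apply: (le_trans Du); rewrite {1}(split1 u u0).
  have : u `^ (1 - t) <= m.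
    by apply: le_trans mt; apply: ge0_ler_powR; rewrite ?nnegrE ?sqr_ge0//; lra.
  move=> h2; rewrite -mulrA [X in _ <= X]mulrC -mulrA ler_wpM2l//; lra.
apply: (le_trans D2); rewrite -mulrA ler_wpM2l//.
rewrite {1}(split1 _ (sqr_ge0 m)) ler_pM ?powR_ge0//.
by apply: ge0_ler_powR; rewrite ?nnegrE ?sqr_ge0// ltW.
Qed.
End Interp.

Section Kern.
Context (R : realType) (n : nat) (n0 : (0 < n)%N) (psi : 'rV[R]_n -> R) (hpsi : cutoff psi).
Local Notation C := R[i].
Local Notation "\I f" := (integral_Rn f) (at level 10).
Local Notation "\J f" := (cintegral_Rn f) (at level 10).
Local Notation phi := (phi psi).
Local Notation chi_dil := (chi_dil psi).
Local Notation V := (boxvol R n).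

(** At a lattice point this is the Fourier coefficient of the multiplier F K, localized to the
    neighbourhood of one point of (1/q) Z^n. *)
Definition kern (K : 'rV[R]_n -> C) lam y : C :=
  \J (fun eta => expi (dot eta y) * (fourier_Rn K eta * ((chi_dil lam eta)%:C)%C)).

(** Fubini. The same computation at y = 0 gives the second part. *)
Lemma fourier_kern (K : 'rV[R]_n -> C) lam y : cbcs K -> 0 < lam ->
  kern K lam y = \J (fun z => K z * phi lam (y - z)) /\
  cbcs (fun eta => fourier_Rn K eta * ((chi_dil lam eta)%:C)%C).
Proof.
move=> bK l0.
have [mK [M hM]] := bK.
have bc := bcs_chi_dil hpsi l0.
have key y' : kern K lam y' = \J (fun z => K z * phi lam (y' - z)) /\
    cbcs (fun eta => expi (dot eta y') * (fourier_Rn K eta * ((chi_dil lam eta)%:C)%C)).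
  (* Both integrals are iterated integrals of F, once the characters are regrouped. *)
  pose F eta z := (expi (dot eta y') * ((chi_dil lam eta)%:C)%C) * (expi (- dot eta z) * K z).
  have M0 : 0 <= M by apply: le_trans (hM 0).1; exact: normc_ge0.
  have l2 : 0 < 2 / lam by rewrite divr_gt0.
  have mF : cmjoint F.
    apply: cmjointM.
      apply: cmjoint_fst; apply: cmrowM; last by apply: cmrow_real; case: bc.
      by apply: cmrow_expi; exact: mrow_dot.
    apply: cmjointM; last exact: cmjoint_snd.
    apply: cmjoint_expi.
    apply: (@mjoint_ext _ _ (fun x y => 0 - dot x y)); first by move=> x z; rewrite sub0r.
    by apply: mjointB; [exact: (mjoint_fst (mrow_cst 0))|exact: mjoint_dot].
  have [||| e1 e2] := @cfubini _ _ F (3 * M + 2 / lam + M) mF.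
  - move=> x z; rewrite /F !normcM !normc_expi !mul1r normcR.
    have := hM z => -[h _]; have h2 := chi_bound hpsi (lam *: x).
    have := ler_pM (normr_ge0 _) (normc_ge0 _) h2 h; rewrite /chi_dil; lra.
  - move=> x z h; rewrite /F chi_dil_out// ?mulr0 ?mul0r//; lra.
  - by move=> x z h; rewrite /F (hM z).2 ?mulr0//; lra.
  have E eta : \J (F eta) = expi (dot eta y') * (fourier_Rn K eta * ((chi_dil lam eta)%:C)%C).
    have be : cbcs (fun z => expi (- dot eta z) * K z).
      apply: (@cbcsMl R n K (fun z => expi (- dot eta z)) 1 bK).
        apply: cmrow_expi; apply: mrowN.
        by apply: mrow_ext (mrow_dot eta) => x; rewrite dotC.
      by move=> x; rewrite normc_expi.
    rewrite /F (cintZ _ be) -/(fourier_Rn K eta).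
    by rewrite -!mulrA [_ * fourier_Rn K eta]mulrC.
  split; last by apply: cbcs_ext e2 => eta; rewrite E.
  rewrite /kern -(cint_ext E) e1; apply: cint_ext => z.
  rewrite /phi /invF -cintZ; last by apply: cbcs_expi; exact: cbcs_real.
  apply: cint_ext => eta; rewrite /F dotDr dotNr expiD; ring.
split; first exact: (key y).1.
have [_ h] := key 0; apply: cbcs_ext h => eta.
have -> : dot eta 0 = 0 by rewrite /dot big1// => i _; rewrite mxE mulr0.
by rewrite expi0 mul1r.
Qed.

Lemma kern_conv (K : 'rV[R]_n -> C) lam y : cbcs K -> 0 < lam ->
  kern K lam y = \J (fun z => K z * phi lam (y - z)).
Proof. by move=> bK l0; have [] := fourier_kern y bK l0. Qed.

Lemma phi_dist lam : 0 < lam -> exists L : R, forall x y, normc (phi lam x - phi lam y) <= L * `|x - y|.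
Proof.
move=> l0; have [B [B0 hB]] := phi_lip hpsi.
exists (B * lam ^- n / lam) => x y.
have := hB lam y (y - x) l0; rewrite opprB [y + _]addrC subrK => h.
by apply: (le_trans h); rewrite distrC -[leRHS]mulrA [lam^-1 * _]mulrC.
Qed.

Lemma cmrow_phi lam y : 0 < lam -> cmrow (fun z => phi lam (y - z)).
Proof.
move=> l0; have [L hL] := phi_dist l0.
have h u v : `|(y - u) - (y - v)| = `|u - v| by rewrite opprB addrC addrA subrK distrC.
split; apply: (@lip_mrow _ _ _ L) => u v /=; rewrite -h; apply: le_trans (hL _ _).
  by apply: le_trans (Re_le_normc _); rewrite ReD ReN.
by apply: le_trans (Im_le_normc _); rewrite ImD ImN.
Qed.

Lemma cmrow_normc (f : 'rV[R]_n -> C) : cmrow f -> mrow (fun x => normc (f x)).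
Proof.
move=> [f1 f2].
apply: (@mrow_ext _ _ (fun x => Num.sqrt (complex.Re (f x) ^+ 2 + complex.Im (f x) ^+ 2))).
  by move=> x; rewrite normc_ReIm.
apply: (@mrow_comp _ _ Num.sqrt); first by apply: continuous_measurable_fun; exact: sqrt_continuous.
apply: mrowD.
  by apply: (mrow_ext (f := fun x => complex.Re (f x) * complex.Re (f x))) => //; exact: mrowM.
by apply: (mrow_ext (f := fun x => complex.Im (f x) * complex.Im (f x))) => //; exact: mrowM.
Qed.

Lemma phi_bounded lam : 0 < lam -> exists M : R, forall y, normc (phi lam y) <= M.
Proof. by move=> l0; eexists => y; exact: (phi_triv hpsi). Qed.

(** Interpolate between the Lipschitz bound and the decay of phi, then sum the weights over the
    lattice. *)
Lemma phi_diff_sum : exists B : R, 0 <= B /\ forall lam (z : 'rV[R]_n) t (X : seq 'rV[int]_n),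
  1 <= lam -> 0 <= t <= 2^-1 -> uniq X ->
  \sum_(y <- X) normc (phi lam (realvec R y - z) - phi lam (realvec R y)) <= B * (`|z| / lam) `^ t.
Proof.
have [B1 [B10 h1]] := phi_decay hpsi n0.
have [B2 [B20 h2]] := phi_lip hpsi.
exists ((B1 + B2) * 4 * 4 ^+ n); split.
  by rewrite !mulr_ge0 ?exprn_ge0 ?addr_ge0.
move=> lam z t X l1 ht uX; have l0 : 0 < lam by lra.
have A0 : 0 < lam ^- n by rewrite invr_gt0 exprn_gt0.
set u := `|z| / lam; have u0 : 0 <= u by rewrite divr_ge0// ltW.
have P01 (y : 'rV[R]_n) : 0 <= decay_prod lam y ^+ 2 <= 1.
  by rewrite sqr_ge0 exprn_ile1// ?decay_prod_le1// ltW// decay_prod_gt0.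
have pt (y : 'rV[R]_n) : normc (phi lam (y - z) - phi lam y) <=
   (B1 + B2) * lam ^- n * (2 * u `^ t * (decay_prod lam (y - z) ^+ 2 + decay_prod lam (y - 0) ^+ 2)).
  rewrite subr0.
  have BA : 0 <= (B1 + B2) * lam ^- n by rewrite mulr_ge0 ?addr_ge0// ltW.
  (* The constant is divided out below, so the trivial case where it vanishes comes first. *)
  have [BA0|BA0] := eqVneq ((B1 + B2) * lam ^- n) 0.
    have B1B2 : B1 + B2 = 0.
      by move/eqP : BA0; rewrite mulf_eq0 (gt_eqF A0) orbF => /eqP.
    have B2e : B2 = 0 by lra.
    by rewrite BA0 mul0r; have := h2 lam y z l0; rewrite B2e !mul0r.
  have BAp : 0 < (B1 + B2) * lam ^- n by rewrite lt_neqAle eq_sym BA0.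
  rewrite mulrC -ler_pdivrMr//.
  apply: interp_min => //.
    rewrite ler_pdivrMr//; apply: (le_trans (h2 lam y z l0)).
    by rewrite mulrC ler_wpM2l// ler_wpM2r ?(ltW A0)// lerDr.
  rewrite ler_pdivrMr// -!exprM (le_trans (normcB _ _))// mulrC mulrDr.
  apply: lerD; apply: (le_trans (h1 _ _ l0)); apply: ler_wpM2r.
  - by rewrite exprn_ge0// ltW// decay_prod_gt0.
  - by rewrite ler_wpM2r ?(ltW A0)// ?lerDl ?lerDr.
  - by rewrite exprn_ge0// ltW// decay_prod_gt0.
  - by rewrite ler_wpM2r ?(ltW A0)// ?lerDl ?lerDr.
apply: (le_trans (ler_sum _ (fun y _ => pt (realvec R y)))).
rewrite -mulr_sumr -mulr_sumr big_split/=.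
have s1 := decay_prod_sum z l1 uX; have s2 := decay_prod_sum 0 l1 uX.
have ut : 0 <= u `^ t by exact: powR_ge0.
apply: (@le_trans _ _ ((B1 + B2) * lam ^- n * (2 * u `^ t * (2 * (4 * lam) ^+ n)))).
  rewrite ler_wpM2l ?mulr_ge0 ?addr_ge0 ?(ltW A0)// ler_wpM2l ?mulr_ge0//.
  by rewrite mulr_natl mulr2n lerD.
rewrite exprMn.
rewrite le_eqVlt; apply/orP; left; apply/eqP; field.
by rewrite expf_neq0// gt_eqF.
Qed.

(** Since K has mean zero, phi(y - z) may be replaced by phi(y - z) - phi(y) in the convolution;
    then [phi_diff_sum] is integrated over the box |z| <= rho. *)
Lemma kern_l1 : exists B : R, 0 <= B /\
  forall (K : 'rV[R]_n -> C) (A rho lam t : R) (X : seq 'rV[int]_n),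
  cbcs K -> 0 < rho -> 0 <= A -> 1 <= lam -> 0 <= t <= 2^-1 -> uniq X ->
  (forall x, normc (K x) <= A * rho ^- n) -> (forall x, rho < `|x| -> K x = 0) ->
  \J K = 0 ->
  \sum_(y <- X) normc (kern K lam (realvec R y)) <= B * A * (rho / lam) `^ t.
Proof.
have [B [B0 hB]] := phi_diff_sum.
have V0 := boxvol_ge0 R n.
exists (2 * B * V); split; first by rewrite !mulr_ge0.
move=> K A rho lam t X bK r0 A0 l1 ht uX hK hK0 JK.
have l0 : 0 < lam by lra.
have [M hM] := phi_bounded l0.
pose g (y : 'rV[int]_n) z := A * rho ^- n * (ibox rho z *
   normc (phi lam (realvec R y - z) - phi lam (realvec R y))).
have c0 : 0 <= A * rho ^- n by rewrite mulr_ge0// invr_ge0 exprn_ge0// ltW.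
have mdiff (y : 'rV[int]_n) :
    cmrow (fun z => phi lam (realvec R y - z) - phi lam (realvec R y)).
  by apply: cmrowD; [exact: cmrow_phi|exact: cmrow_cst].
have bd (y z : 'rV[R]_n) : normc (phi lam (y - z) - phi lam y) <= M + M.
  by rewrite (le_trans (normcB _ _))// lerD.
have bg y : bcs (g y).
  apply: bcsZ; apply: (@bcsM _ _ _ _ (M + M)).
  - exact/bcs_ibox/ltW.
  - exact: cmrow_normc.
  - by move=> z; rewrite ger0_norm ?normc_ge0// bd.
have h1 y : normc (kern K lam (realvec R y)) <= 2 * \I (g y).
  have bKp : cbcs (fun z => K z * phi lam (realvec R y - z)).
    by apply: (@cbcsM _ _ _ _ M) => //; exact: cmrow_phi.
  have bKd : cbcs (fun z => K z * (phi lam (realvec R y - z) - phi lam (realvec R y))).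
    exact: (cbcsM (N := M + M)).
  (* Mean zero enters here. *)
  have -> : kern K lam (realvec R y) =
      \J (fun z => K z * (phi lam (realvec R y - z) - phi lam (realvec R y))).
    rewrite kern_conv//.
    transitivity (\J (fun z => K z * phi lam (realvec R y - z)) - phi lam (realvec R y) * \J K).
      by rewrite JK mulr0 subr0.
    rewrite -cintZ// -cintB//; last exact: cbcsZ.
    by apply: cint_ext => z; rewrite mulrBr [phi _ _ * K z]mulrC.
  apply: cint_le => // z; rewrite normcM /g /ibox; case: ifPn => h.
    by rewrite mul1r ler_wpM2r ?normc_ge0.
  by rewrite hK0 ?normc0 ?mul0r ?mulr0// ltNge.
apply: (le_trans (ler_sum _ (fun y _ => h1 y))).
rewrite -mulr_sumr -iRn_sum//.
have S : \I (fun z => \sum_(y <- X) g y z) <=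
   \I (fun z : 'rV[R]_n => A * rho ^- n * (B * (rho / lam) `^ t) * ibox rho z).
  apply: iRn_le; [exact: bcs_sum|exact/bcsZ/bcs_ibox/ltW|move=> z].
  rewrite /g -mulr_sumr -[leRHS]mulrA ler_wpM2l// -mulr_sumr mulrC /ibox.
  case: ifPn => h; last by rewrite !mulr0.
  rewrite !mulr1 (le_trans (hB _ _ _ _ l1 ht uX))// ler_wpM2l//.
  apply: ge0_ler_powR; rewrite ?nnegrE ?divr_ge0 ?(ltW l0) ?(ltW r0)//; first by case/andP: ht.
  by rewrite ler_wpM2r// invr_ge0 ltW.
apply: (@le_trans _ _ (2 * (A * rho ^- n * (B * (rho / lam) `^ t) * (rho ^+ n * V)))).
  by rewrite ler_wpM2l//; rewrite iRnZ ?int_ibox// in S; exact/bcs_ibox/ltW.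
rewrite le_eqVlt; apply/orP; left; apply/eqP; field.
by rewrite expf_neq0// gt_eqF.
Qed.

(** The convolution is at most the supremum of K times the integral of |phi|, and the latter is
    bounded uniformly in lam by [int_le_lattice]. *)
Lemma kern_sup : exists B : R, 0 <= B /\
  forall (K : 'rV[R]_n -> C) (A rho lam : R) (y : 'rV[R]_n),
  cbcs K -> 0 < rho -> 0 <= A -> 1 <= lam ->
  (forall x, normc (K x) <= A * rho ^- n) -> (forall x, rho < `|x| -> K x = 0) ->
  normc (kern K lam y) <= B * A * rho ^- n.
Proof.
have [B [B0 hB]] := phi_decay hpsi n0.
have V0 := boxvol_ge0 R n.
exists (2 * (B * 4 ^+ n) * V); split; first by rewrite !mulr_ge0 ?exprn_ge0.
move=> K A rho lam y bK r0 A0 l1 hK hK0.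
have l0 : 0 < lam by lra.
have [M hM] := phi_bounded l0.
pose g z := ibox rho z * normc (phi lam (y - z)).
have c0 : 0 <= A * rho ^- n by rewrite mulr_ge0// invr_ge0 exprn_ge0// ltW.
have bg : bcs g.
  apply: (@bcsM _ _ _ _ M).
  - exact/bcs_ibox/ltW.
  - by apply: cmrow_normc; exact: cmrow_phi.
  - by move=> z; rewrite ger0_norm ?normc_ge0.
have h1 : normc (kern K lam y) <= 2 * \I (fun z => A * rho ^- n * g z).
  rewrite kern_conv//; apply: cint_le; first by apply: (cbcsM (N := M)) => //; exact: cmrow_phi.
    exact: bcsZ.
  move=> z; rewrite normcM /g /ibox; case: ifPn => h.
    by rewrite mul1r ler_wpM2r ?normc_ge0.
  by rewrite hK0 ?normc0 ?mul0r ?mulr0// ltNge.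
have A1 : 0 < lam ^- n by rewrite invr_gt0 exprn_gt0.
have h2 : \I g <= B * 4 ^+ n * V.
  apply: int_le_lattice => //.
  - by move=> z; rewrite mulr_ge0 ?ibox_ge0 ?normc_ge0.
  - by rewrite mulr_ge0 ?exprn_ge0.
  move=> x N.
  apply: (@le_trans _ _ (\sum_(l : 'rV['I_N.*2.+1]_n)
      B * lam ^- n * decay_prod lam (realvec R (zrow l) - (x - y)) ^+ 2)).
    apply: ler_sum => l _; rewrite /g.
    apply: (@le_trans _ _ (normc (phi lam (y - (x - realvec R (zrow l)))))).
      by rewrite ler_piMl ?normc_ge0// /ibox; case: ifP.
    apply: (le_trans (hB _ _ l0)); rewrite ler_wpM2l ?mulr_ge0 ?(ltW A1)//.
    rewrite (_ : y - (x - realvec R (zrow l)) = realvec R (zrow l) - (x - y)); last first.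
      by rewrite !opprB addrCA.
    set P := decay_prod _ _; have P0 : 0 < P by exact: decay_prod_gt0.
    have P1 : P <= 1 by exact: decay_prod_le1.
    (* The weights are at most 1, so that their fourth power may be lowered to the square. *)
    by apply: ler_wiXn2l => //; exact: ltW.
  rewrite -mulr_sumr (le_trans (ler_wpM2l _ (decay_prod_box N (x - y) l1))) ?mulr_ge0 ?(ltW A1)//.
  rewrite exprMn le_eqVlt; apply/orP; left; apply/eqP; field.
  by rewrite expf_neq0// gt_eqF.
apply: (le_trans h1); rewrite iRnZ//.
rewrite (_ : 2 * (B * 4 ^+ n) * V * A * rho ^- n = 2 * (A * rho ^- n * (B * 4 ^+ n * V))); last by ring.
by rewrite ler_wpM2l// ler_wpM2l.
Qed.

End Kern.

(** * The dyadic pieces of the singular kernel *)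

Section Singular.
Context (R : realType) (n : nat) (n0 : (0 < n)%N) (Omega : 'rV[R]_n -> R[i])
  (hOmega : kernel_symbol Omega).
Local Notation C := R[i].
Local Notation "\I f" := (integral_Rn f) (at level 10).
Local Notation "\J f" := (cintegral_Rn f) (at level 10).
Local Notation K := (K_of Omega).

Let openN0 : open [set x : 'rV[R]_n | x != 0].
Proof.
rewrite (_ : [set x | _] = Num.norm @^-1` [set y : R | y != 0]).
  by apply: open_comp; [move=> x _; exact: norm_continuous|exact: open_neq].
by apply/seteqP; split=> x /=; rewrite normr_eq0.
Qed.

Lemma Omega_cont x : x != 0 -> {for x, continuous ((@complex.Re R) \o Omega)} /\
  {for x, continuous ((@complex.Im R) \o Omega)}.
Proof.
case: hOmega => h1 h2 _ _ x0; split.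
  exact: (C1_continuous openN0 h1 x0).
exact: (C1_continuous openN0 h2 x0).
Qed.

Lemma cmrow_Omega : cmrow Omega.
Proof. by split; apply: mrow_cont => x /Omega_cont[]. Qed.

Lemma Omega_bounded : exists A : R, 0 <= A /\ forall x, x != 0 -> normc (Omega x) <= A.
Proof.
have n1 (x : 'rV[R]_n) : `|x| = 1 -> x != 0 by move=> h; rewrite -normr_eq0 h oner_eq0.
have [M1 h1] := cont_bounded (@sphere_compact R n) (fun x hx => (Omega_cont (n1 x hx)).1).
have [M2 h2] := cont_bounded (@sphere_compact R n) (fun x hx => (Omega_cont (n1 x hx)).2).
exists (`|M1| + `|M2|); split; first by rewrite addr_ge0.
move=> x x0; have px : 0 < `|x| by rewrite normr_gt0.
case: hOmega => _ _ hom _.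
rewrite -(hom `|x|^-1 x) ?invr_gt0//.
have hx : `| (`|x|^-1 *: x) | = 1 by rewrite normrZ ger0_norm ?invr_ge0// mulVf// gt_eqF.
rewrite (le_trans (normc_le_ReIm _))// lerD//.
  exact: le_trans (h1 _ hx) (ler_norm _).
exact: le_trans (h2 _ hx) (ler_norm _).
Qed.

Lemma cmrow_K : cmrow K.
Proof.
have mi : mrow (fun x : 'rV[R]_n => (enorm x ^+ n)^-1).
  apply: (@mrow_ext _ _ (fun x => (enorm x ^+ n) `^ (-1))).
    by move=> x; rewrite powR_inv1// exprn_ge0// enorm_ge0.
  apply: (@mrow_comp _ _ (fun a => a `^ (-1))); first exact: measurable_powR.
  exact: (measurable_funX n (@mrow_enorm R n)).
apply: (@cmrow_ext _ _ (fun x => Omega x * (((enorm x ^+ n)^-1)%:C)%C)).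
  by move=> x; rewrite /K_of fmorphV.
by apply: cmrowM; [exact: cmrow_Omega|exact: cmrow_real].
Qed.

(** Homogeneity; at the origin both sides vanish. *)
Lemma K_scale c x : 0 < c -> K (c *: x) = ((c ^- n)%:C)%C * K x.
Proof.
move=> c0; have [->|x0] := eqVneq x 0.
  have K0 : K 0 = 0 by rewrite /K_of enorm0 expr0n gtn_eqF// invr0 mulr0.
  by rewrite scaler0 K0 mulr0.
case: hOmega => _ _ hom _.
rewrite /K_of hom// enormZ gtr0_norm// exprMn.
rewrite !rmorphM/= fmorphV/= invfM; ring.
Qed.

Lemma K_bound (A : R) : (forall x, x != 0 -> normc (Omega x) <= A) -> 0 <= A ->
  forall x a, 0 < a -> a <= enorm x -> normc (K x) <= A * a ^- n.
Proof.
move=> hA A0 x a a0 ax; have e0 : 0 < enorm x by lra.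
rewrite /K_of normcM normcV normcR ger0_norm ?exprn_ge0 ?(ltW e0)//.
apply: ler_pM; rewrite ?normc_ge0 ?invr_ge0 ?exprn_ge0 ?(ltW e0)//.
  by apply: hA; rewrite -enorm_gt0P.
by rewrite lef_pV2 ?posrE ?exprn_gt0//; apply: lerXn2r; rewrite ?nnegrE ?(ltW e0) ?(ltW a0).
Qed.

(** The singularity is cut away by h. *)
Lemma cbcs_Kh (h : 'rV[R]_n -> R) (a b H : R) : mrow h -> 0 < a ->
  (forall x, `|h x| <= H) -> (forall x, enorm x < a -> h x = 0) ->
  (forall x, b < enorm x -> h x = 0) -> cbcs (fun x => K x * ((h x)%:C)%C).
Proof.
move=> mh a0 hH ha hb.
have [A [A0 hA]] := Omega_bounded.
have H0 : 0 <= H by apply: le_trans (hH 0).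
have B0 : 0 <= A * a ^- n * H.
  by rewrite mulr_ge0// mulr_ge0// invr_ge0 exprn_ge0// ltW.
split; first by apply: cmrowM; [exact: cmrow_K|exact: cmrow_real].
exists (A * a ^- n * H + `|b|) => x; split.
  rewrite normcM normcR.
  have [h1|h1] := ltP (enorm x) a; first by rewrite ha// normr0 mulr0 addr_ge0.
  have := K_bound hA A0 a0 h1 => h2.
  have := ler_pM (normc_ge0 _) (normr_ge0 _) h2 (hH x); have := normr_ge0 b; lra.
move=> hx; rewrite hb ?mulr0//; have := norm_le_enorm x; have := ler_norm b; lra.
Qed.

(** The Jacobian of the dilation cancels the homogeneity of K. *)
Lemma JK_scale (h : 'rV[R]_n -> R) c : 0 < c -> cbcs (fun x => K x * ((h x)%:C)%C) ->
  \J (fun x => K x * ((h (c *: x))%:C)%C) = \J (fun x => K x * ((h x)%:C)%C).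
Proof.
move=> c0 bK.
have cn : c ^+ n != 0 by rewrite expf_neq0// gt_eqF.
have bc : cbcs (fun x => K (c *: x) * ((h (c *: x))%:C)%C).
  by apply: cbcs_ext (cbcs_affine 0 c0 bK) => x; rewrite addr0.
transitivity (((c ^+ n)%:C)%C * \J (fun x => K (c *: x) * ((h (c *: x))%:C)%C)).
  rewrite -cintZ//; apply: cint_ext => x; rewrite K_scale// !mulrA -rmorphM/=.
  by rewrite divff// mul1r.
by rewrite (cint_scale c0 bK) mulrA -rmorphM/= divff// mul1r.
Qed.

Definition eball (r : R) (x : 'rV[R]_n) : R := if enorm x <= r then 1 else 0.
Definition ann r x : R := eball r x - eball 1 x.

Lemma mrow_eball r : mrow (eball r).
Proof.
by apply: (@mrow_if _ _ (fun x => enorm x <= r) (fun=> 1) (fun=> 0));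
  [exact: mbool_enorm_le|exact: mrow_cst|exact: mrow_cst].
Qed.

Lemma bcs_eball r : bcs (eball r).
Proof.
split; first exact: mrow_eball.
exists (1 + `|r|) => x; rewrite /eball; case: ifPn => h.
  rewrite normr1; split; first by rewrite lerDl.
  move=> h2; exfalso; have := norm_le_enorm x; have := ler_norm r; lra.
by rewrite normr0; split => //; rewrite addr_ge0.
Qed.

Lemma eball_scale c r x : 0 < c -> eball r (c *: x) = eball (r / c) x.
Proof. by move=> c0; rewrite /eball enormZ gtr0_norm// ler_pdivlMr// mulrC. Qed.

Lemma eball01 r x : 0 <= eball r x <= 1.
Proof. by rewrite /eball; case: ifP; rewrite ?ler01 lexx. Qed.

Lemma int_eball r : 0 < r -> \I (eball r) = r ^+ n * \I (eball 1).
Proof.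
move=> r0; have ri : 0 < r^-1 by rewrite invr_gt0.
have -> : r ^+ n = r^-1 ^- n by rewrite exprVn invrK.
rewrite -(iRn_scale ri (bcs_eball 1)); apply: iRn_ext => x.
by rewrite eball_scale// invrK mul1r.
Qed.

Lemma bcs_ann r : bcs (ann r). Proof. by apply: bcsB; exact: bcs_eball. Qed.

Lemma annE r x : 1 <= r -> ann r x = if 1 < enorm x <= r then 1 else 0.
Proof.
move=> r1; rewrite /ann /eball.
by case: (leP (enorm x) 1) => h1; case: (leP (enorm x) r) => h2; rewrite ?subrr ?subr0//=; lra.
Qed.

Lemma ann_norm r x : `|ann r x| <= 1.
Proof.
have /andP[h1 h2] := eball01 r x; have /andP[h3 h4] := eball01 1 x.
by rewrite /ann ler_norml; apply/andP; split; lra.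
Qed.

Lemma cbcs_Kann r : 1 <= r -> cbcs (fun x => K x * ((ann r x)%:C)%C).
Proof.
move=> r1; apply: (@cbcs_Kh _ 1 r 1) => //.
- exact: (bcs_ann r).1.
- exact: ann_norm.
- by move=> x h; rewrite annE// ifF//; apply/negP => /andP[]; lra.
- by move=> x h; rewrite annE// ifF//; apply/negP => /andP[]; lra.
Qed.

Definition Omega_ball r x : C := if 0 < enorm x <= r then Omega x else 0.

Lemma cbcs_Omega_ball r : cbcs (Omega_ball r).
Proof.
have [A [A0 hA]] := Omega_bounded.
split.
  apply: (@cmrow_ext _ _ (fun x => if 0 < enorm x then (if enorm x <= r then Omega x else 0) else 0)).
    by move=> x; rewrite /Omega_ball; case: (0 < enorm x).
  apply: (@cmrow_if _ _ (fun x => 0 < enorm x)); [exact: mbool_enorm_gt| |exact: cmrow_cst].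
  apply: (@cmrow_if _ _ (fun x => enorm x <= r)); [exact: mbool_enorm_le| |exact: cmrow_cst].
  exact: cmrow_Omega.
exists (A + `|r|) => x; rewrite /Omega_ball; case: ifPn => h; last first.
  by rewrite normc0; split => //; rewrite addr_ge0.
move/andP : h => [h1 h2]; split.
  by apply: (le_trans (hA x _)); rewrite ?lerDl// -enorm_gt0P.
move=> hx; exfalso; have := norm_le_enorm x; have := ler_norm r; lra.
Qed.

Lemma int_Omega_ball r : 0 < r -> \J (Omega_ball r) = 0.
Proof.
move=> r0; have ri : 0 < r^-1 by rewrite invr_gt0.
case: hOmega => _ _ hom hs.
have J1 : \J (Omega_ball 1) = 0.
  move/eqP : hs; rewrite /cintegral_sphere mulf_eq0 pnatr_eq0 gtn_eqF//= => /eqP hs.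
  rewrite -[RHS]hs; apply: cint_ext => x; rewrite /Omega_ball; case: ifP => // /andP[h _].
  by rewrite hom// ?invr_gt0// -enorm_gt0P.
rewrite -(cint_ext (f := fun x => Omega_ball 1 (r^-1 *: x))).
  by rewrite (cint_scale ri (cbcs_Omega_ball 1)) J1 mulr0.
move=> x; rewrite /Omega_ball enormZ gtr0_norm// ler_pdivrMl// mulr1 pmulr_rgt0//.
by case: ifP => // /andP[h _]; rewrite hom// -enorm_gt0P.
Qed.

(** Used to write the integral of Omega over an annulus as a difference of two vanishing integrals. *)
Lemma Omega_ball_ann r x : 1 <= r -> Omega_ball r x - Omega_ball 1 x = Omega x * ((ann r x)%:C)%C.
Proof.
move=> r1; rewrite annE// /Omega_ball.
case: (ltP 0 (enorm x)) => h0 /=.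
  by case: (leP (enorm x) 1) => h1; case: (leP (enorm x) r) => h2 /=;
    rewrite ?subrr ?subr0 ?mulr1 ?mulr0//; exfalso; lra.
by rewrite subr0 ifF ?mulr0//; apply/negP => /andP[]; lra.
Qed.

Definition annulus_int r : C := \J (fun x => K x * ((ann r x)%:C)%C).

(** Omega has mean zero on the annulus, so K may be replaced by K - Omega, whose modulus is
    O(r^n - 1); the volume of the annulus provides the second factor r^n - 1. *)
Lemma annulus_int_small : exists B : R, 0 <= B /\ forall r, 1 <= r -> normc (annulus_int r) <= B * (r ^+ n - 1) ^+ 2.
Proof.
have [A [A0 hA]] := Omega_bounded.
set v := \I (eball 1).
have v0 : 0 <= v by apply: iRn_ge0 => x; have /andP[] := eball01 1 x.
exists (2 * (A * v)); split; first by rewrite !mulr_ge0.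
move=> r r1; have r0 : 0 < r by lra.
have rn1 : 1 <= r ^+ n by rewrite exprn_ege1.
have bO : cbcs (fun x => Omega x * ((ann r x)%:C)%C).
  apply: (cbcs_ext (f := fun x => Omega_ball r x - Omega_ball 1 x)) => [x|]; first exact: Omega_ball_ann.
  by apply: cbcsD; [exact: cbcs_Omega_ball|apply: cbcsN; exact: cbcs_Omega_ball].
have JO : \J (fun x => Omega x * ((ann r x)%:C)%C) = 0.
  rewrite -(cint_ext (fun x => Omega_ball_ann x r1)) cintB ?int_Omega_ball ?subr0//; exact: cbcs_Omega_ball.
have -> : annulus_int r = \J (fun x => K x * ((ann r x)%:C)%C - Omega x * ((ann r x)%:C)%C).
  by rewrite cintB ?JO ?subr0//; exact: cbcs_Kann.
have Iann : \I (ann r) = (r ^+ n - 1) * v.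
  rewrite /ann iRnB; [|exact: bcs_eball|exact: bcs_eball].
  by rewrite int_eball// mulrBl mul1r.
have -> : 2 * (A * v) * (r ^+ n - 1) ^+ 2 = 2 * (A * (r ^+ n - 1) * \I (ann r)).
  by rewrite Iann; ring.
rewrite -iRnZ; last exact: bcs_ann.
apply: cint_le.
- apply: cbcsD; first exact: cbcs_Kann.
  exact: cbcsN.
- by apply: bcsZ; exact: bcs_ann.
move=> x; rewrite annE//; case: ifPn => h; last by rewrite !mulr0 subrr normc0.
rewrite !mulr1; move/andP : h => [h1 h2].
have x0 : x != 0 by rewrite -enorm_gt0P; lra.
have e0 : 0 < enorm x by lra.
have -> : K x - Omega x = Omega x * ((((enorm x ^+ n)^-1 - 1)%:C)%C).
  by rewrite /K_of rmorphB/= fmorphV mulrBr mulr1.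
rewrite normcM normcR; apply: ler_pM; rewrite ?normc_ge0//; first exact: hA.
have en1 : 1 <= enorm x ^+ n by rewrite exprn_ege1// ltW.
have enr : enorm x ^+ n <= r ^+ n by apply: lerXn2r; rewrite ?nnegrE ?(ltW e0) ?(ltW r0).
have i1 : (enorm x ^+ n)^-1 <= 1 by rewrite invf_le1//; lra.
rewrite distrC ger0_norm ?subr_ge0//.
(* 1 - 1/e <= e - 1 for e = |x|^n. *)
have : 2 - enorm x ^+ n <= (enorm x ^+ n)^-1.
  rewrite -[leRHS]mul1r ler_pdivlMr; last lra.
  set e := enorm x ^+ n; have := sqr_ge0 (e - 1); nra.
lra.
Qed.

(** By dilation invariance the integral over q-fold annuli does not depend on their position. *)
Lemma annulus_intM r q : 1 <= r -> 1 <= q -> annulus_int (r * q) = annulus_int r + annulus_int q.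
Proof.
move=> r1 q1; have r0 : 0 < r by lra.
have rq : 1 <= r * q by nra.
have ri : 0 < r^-1 by rewrite invr_gt0.
rewrite {3}/annulus_int -(JK_scale ri (cbcs_Kann q1)) /annulus_int -cintD; last 2 first.
- exact: cbcs_Kann.
- apply: (cbcs_ext (f := fun x => K x * ((ann (r * q) x)%:C)%C - K x * ((ann r x)%:C)%C)).
    move=> x; rewrite -mulrBr -rmorphB/= /ann !eball_scale// invrK mul1r [q * r]mulrC.
    by congr (_ * (_%:C)%C); ring.
  by apply: cbcsD; [|apply: cbcsN]; exact: cbcs_Kann.
apply: cint_ext => x; rewrite -mulrDr -rmorphD/= /ann !eball_scale// invrK mul1r [q * r]mulrC.
by congr (_ * (_%:C)%C); ring.
Qed.

Lemma annulus_int_expn r m : 1 <= r -> annulus_int (r ^+ m) = m%:R * annulus_int r.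
Proof.
move=> r1; elim: m => [|m IH].
  rewrite expr0 mul0r /annulus_int -[RHS](cint0 R n); apply: cint_ext => x.
  by rewrite /ann subrr mulr0.
rewrite exprS annulus_intM// ?exprn_ege1// IH -natr1; ring.
Qed.

(** Write 2 = r^m with r = 2^(1/m). Then the integral is m times the integral for r, which is
    m O((r^n - 1)^2) = O(1/m). This replaces integration in polar coordinates. *)
Lemma annulus_int2 : annulus_int 2 = 0.
Proof.
have [B [B0 hB]] := annulus_int_small.
set D := B * (2 ^+ n - 1) ^+ 2.
have D0 : 0 <= D by rewrite mulr_ge0// sqr_ge0.
have key m : (0 < m)%N -> normc (annulus_int 2) * m%:R <= D.
  move=> m0; have mp : 0 < m%:R :> R by rewrite ltr0n.
  pose r : R := 2 `^ (m%:R^-1).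
  have rm : r ^+ m = 2.
    rewrite /r -powR_mulrn ?powR_ge0// -powRrM mulVf ?gt_eqF//.
    by rewrite powRr1.
  have r1 : 1 <= r.
    rewrite leNgt; apply/negP => h.
    have : r ^+ m <= 1 by rewrite exprn_ile1 ?powR_ge0// ltW.
    by rewrite rm; lra.
  set tau := r ^+ n.
  have tau1 : 1 <= tau by rewrite exprn_ege1.
  have taum : tau ^+ m = 2 ^+ n by rewrite /tau -!exprM mulnC exprM rm.
  (* Bernoulli: m (tau - 1) <= 2^n - 1, so tau - 1 = O(1/m). *)
  have bern k : 1 + k%:R * (tau - 1) <= tau ^+ k.
    elim: k => [|k IHk]; first by rewrite mul0r addr0 expr0.
    have t0 : 0 <= tau by apply: le_trans tau1.
    rewrite exprS -natr1; apply: (le_trans _ (ler_wpM2l t0 IHk)); rewrite -subr_ge0.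
    have -> : tau * (1 + k%:R * (tau - 1)) - (1 + (k%:R + 1) * (tau - 1)) =
       k%:R * (tau - 1) ^+ 2 by ring.
    by rewrite mulr_ge0// sqr_ge0.
  have h1 := bern m; rewrite taum in h1.
  have h2 : m%:R * (tau - 1) <= 2 ^+ n - 1 by lra.
  have h3 := hB r r1; rewrite -/tau in h3.
  rewrite -rm annulus_int_expn// normcM normc_nat.
  apply: (@le_trans _ _ (B * (m%:R * (tau - 1)) ^+ 2)).
    have -> : B * (m%:R * (tau - 1)) ^+ 2 = m%:R * (B * (tau - 1) ^+ 2) * m%:R by ring.
    by rewrite ler_wpM2r ?(ltW mp)// ler_wpM2l// ltW.
  have h0 : 0 <= m%:R * (tau - 1) by rewrite mulr_ge0 ?(ltW mp)//; lra.
  by rewrite ler_wpM2l//; apply: lerXn2r; rewrite ?nnegrE//; lra.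
apply: eq0_normc; apply/eqP; rewrite eq_le normc_ge0 andbT leNgt; apply/negP => g0.
(* A modulus whose product with every integer is bounded vanishes. *)
have := archi_boundP (divr_ge0 D0 (ltW g0)).
set N := Num.bound _ => hN.
have Np : (0 < N)%N by rewrite -(ltr0n R) (le_lt_trans _ hN)// divr_ge0// ltW.
have := key N Np; rewrite ltr_pdivrMr// in hN; lra.
Qed.

Section WithPsi.
Context (psi : 'rV[R]_n -> R) (hpsi : cutoff psi).

Definition Kj (j : nat) x : C := K x * ((dilate psi j%:Z x)%:C)%C.

Lemma cbcs_Kpsi : cbcs (fun x => K x * ((psi (2^-1 *: x))%:C)%C).
Proof.
have h01 : forall x, 0 <= psi x <= 1 by case: hpsi.
have E (x : 'rV[R]_n) : enorm (2^-1 *: x) = 2^-1 * enorm x by rewrite enormZ gtr0_norm.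
apply: (@cbcs_Kh _ 1 4 1) => //.
- exact: (mrow_psi hpsi).
- by move=> x; have /andP[h1 h2] := h01 (2^-1 *: x); rewrite ger0_norm.
- by move=> x h; apply: (psi_out hpsi); left; rewrite E; lra.
- by move=> x h; apply: (psi_out hpsi); right; rewrite E; lra.
Qed.

(** psi_1 differs from the indicator of the annulus 1 < |x| <= 2 by E(x/2) - E(x), where E is chi
    minus the indicator of the unit ball; dilation invariance makes the two E terms cancel. *)
Lemma int_Kpsi : \J (fun x => K x * ((psi (2^-1 *: x))%:C)%C) = 0.
Proof.
pose E x := chi_of psi x - eball 1 x.
have c2 : cbcs (fun x => K x * ((E x)%:C)%C).
  apply: (@cbcs_Kh _ 1 2 4) => //.
  - by apply: mrowB; [exact: mrow_chi|exact: mrow_eball].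
  - move=> x; rewrite (le_trans (ler_normB _ _))//.
    have := chi_bound hpsi x; have /andP[h1 h2] := eball01 1 x; rewrite (ger0_norm h1); lra.
  - by move=> x h; rewrite /E (chi_one hpsi) ?(ltW h)// /eball ifT ?subrr// ltW.
  - move=> x h; rewrite /E (chi_ge2 hpsi) ?ltW// /eball ifF ?subr0//.
    by apply/negP; lra.
have h20 : 0 < 2^-1 :> R by rewrite invr_gt0.
have c2h : cbcs (fun x => K x * ((E (2^-1 *: x))%:C)%C).
  apply: (cbcs_ext (f := fun x => K x * ((psi (2^-1 *: x))%:C)%C + K x * ((E x)%:C)%C -
     K x * ((ann 2 x)%:C)%C)).
    move=> x; rewrite -mulrDr -mulrBr -rmorphD/= -rmorphB/= (psi1E hpsi) /E /ann eball_scale//.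
    by rewrite invrK mul1r; congr (_ * (_%:C)%C); ring.
  apply: cbcsD; first by apply: cbcsD => //; exact: cbcs_Kpsi.
  by apply: cbcsN; apply: cbcs_Kann; lra.
transitivity (\J (fun x => K x * ((E (2^-1 *: x))%:C)%C) - \J (fun x => K x * ((E x)%:C)%C)
   + annulus_int 2).
  rewrite -cintB// /annulus_int -cintD; last 2 first.
  - by apply: cbcsD => //; exact: cbcsN.
  - by apply: cbcs_Kann; lra.
  apply: cint_ext => x; rewrite -mulrBr -mulrDr -rmorphB/= -rmorphD/= (psi1E hpsi) /E /ann eball_scale//.
  by rewrite invrK mul1r; congr (_ * (_%:C)%C); ring.
by rewrite (JK_scale h20 c2) subrr annulus_int2 addr0.
Qed.

Lemma KjE j x : Kj j x = K x * ((psi (2^-1 *: ((2 * 2^-1 ^+ j) *: x)))%:C)%C.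
Proof.
rewrite /Kj dilate_nat; congr (K x * ((psi _)%:C)%C).
by rewrite scalerA mulrA mulVf// mul1r.
Qed.

Lemma cbcs_Kj j : cbcs (Kj j).
Proof.
have h01 : forall x, 0 <= psi x <= 1 by case: hpsi.
have p0 : 0 < 2^-1 ^+ j :> R by rewrite exprn_gt0.
have E (x : 'rV[R]_n) : enorm (2^-1 ^+ j *: x) = 2^-1 ^+ j * enorm x.
  by rewrite enormZ gtr0_norm.
apply: (@cbcs_ext _ _ (fun x => K x * ((psi (2^-1 ^+ j *: x))%:C)%C)).
  by move=> x; rewrite /Kj dilate_nat.
apply: (@cbcs_Kh _ (2^-1 / 2^-1 ^+ j) (2 / 2^-1 ^+ j) 1) => //.
- exact: (mrow_psi hpsi).
- by move=> x; have /andP[h1 h2] := h01 (2^-1 ^+ j *: x); rewrite ger0_norm.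
- by move=> x; rewrite ltr_pdivlMr// => h; apply: (psi_out hpsi); left; rewrite E mulrC ltW.
- by move=> x; rewrite ltr_pdivrMr// => h; apply: (psi_out hpsi); right; rewrite E mulrC ltW.
Qed.

Lemma int_Kj j : \J (Kj j) = 0.
Proof.
rewrite (cint_ext (KjE j)).
have p0 : 0 < 2 * 2^-1 ^+ j :> R by rewrite mulr_gt0// exprn_gt0.
by rewrite (JK_scale (h := fun x => psi (2^-1 *: x)) p0 cbcs_Kpsi) int_Kpsi.
Qed.

Lemma Kj_out j x : 2 ^+ j.+1 < `|x| -> Kj j x = 0.
Proof.
move=> h; rewrite /Kj dilate_nat (psi_out hpsi) ?mulr0//; right.
rewrite enormZ ger0_norm ?exprn_ge0//.
have h2 : 2 ^+ j.+1 <= enorm x by apply: le_trans (norm_le_enorm x); exact: ltW.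
rewrite exprVn ler_pdivlMl ?exprn_gt0// -exprSr //.
Qed.

Lemma Kj_bound : exists A : R, 0 <= A /\ forall j x, normc (Kj j x) <= A * (2 ^+ j.+1) ^- n.
Proof.
have h01 : forall x, 0 <= psi x <= 1 by case: hpsi.
have [A [A0 hA]] := Omega_bounded.
exists (A * 4 ^+ n); split; first by rewrite mulr_ge0// exprn_ge0.
move=> j x.
have pj : 0 < 2 ^+ j :> R by rewrite exprn_gt0.
have R0 : 0 <= A * 4 ^+ n * (2 ^+ j.+1) ^- n.
  by rewrite !mulr_ge0 ?invr_ge0 ?exprn_ge0.
have [h|h] := leP (enorm (2^-1 ^+ j *: x)) 2^-1.
  by rewrite /Kj dilate_nat (psi_out hpsi) ?mulr0 ?normc0//; left.
rewrite /Kj dilate_nat normcM normcR.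
have /andP[h1 h2] := h01 (2^-1 ^+ j *: x); rewrite ger0_norm//.
apply: (@le_trans _ _ (normc (K x))); first by rewrite ler_piMr ?normc_ge0.
have q0 : 0 < 2^-1 * 2 ^+ j :> R by rewrite mulr_gt0.
have hx : 2^-1 * 2 ^+ j <= enorm x.
  move: h; rewrite enormZ ger0_norm ?exprn_ge0// exprVn => h.
  by rewrite -ler_pdivlMr// mulrC ltW.
apply: (le_trans (K_bound hA A0 q0 hx)).
rewrite -mulrA ler_wpM2l// exprS !exprMn !exprVn !invfM invrK.
have -> : (4 : R) ^+ n = 2 ^+ n * 2 ^+ n by rewrite -exprMn; congr (_ ^+ _); ring.
by rewrite [leRHS]mulrA mulfK ?expf_neq0.
Qed.

Lemma fourier_Ktrunc j xi : fourier_Rn (K_trunc Omega psi 0 j) xi =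
  \sum_(0 <= i < j) fourier_Rn (Kj i) xi.
Proof.
rewrite /fourier_Rn -cint_sum.
  by apply: cint_ext => x; rewrite /K_trunc mulr_sumr.
move=> i; apply: (@cbcsMl _ _ (Kj i) (fun x => expi (- dot xi x)) 1); first exact: cbcs_Kj.
  apply: cmrow_expi; apply: mrowN.
  by apply: mrow_ext (mrow_dot xi) => x; rewrite dotC.
by move=> x; rewrite normc_expi.
Qed.
End WithPsi.
End Singular.

(** * From periodic multipliers to convolutions *)

Section Mult.
Context (R : realType) (n d : nat).
Local Notation C := R[i].
Local Notation "\J f" := (cintegral_Rn f) (at level 10).

Lemma dot_int (a b : 'rV[int]_n) : dot (realvec R a) (realvec R b) = (\sum_i a ord0 i * b ord0 i)%:~R.
Proof.
rewrite /dot rmorph_sum/=; apply: eq_bigr => i _.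
by rewrite !realvec_coord intrM.
Qed.

Lemma realvecD (a b : 'rV[int]_n) : realvec R (a + b) = realvec R a + realvec R b.
Proof. by rewrite /realvec map_mxD. Qed.

Lemma realvecB (a b : 'rV[int]_n) : realvec R (a - b) = realvec R a - realvec R b.
Proof. by rewrite /realvec map_mxB. Qed.

Lemma denom_gt0 (alpha : rat) : (0 < denom alpha)%N.
Proof. by rewrite /denom absz_gt0 denq_neq0. Qed.

(** A shift of beta by a lattice vector multiplies each term by exp(2 pi i m) with m an integer. *)
Lemma gauss_periodic (alpha : rat) (beta : 'rV[R]_n) (l : 'rV[int]_n) :
  gauss_sum d alpha (beta + realvec R l) = gauss_sum d alpha beta.
Proof.
rewrite /gauss_sum /=; congr (_ * _); apply: eq_bigr => rho _.
rewrite dotDl addrA expiD.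
set v := \row_i _.
have -> : v = realvec R (\row_i (rho ord0 i).+1%:Z) by apply/rowP => i; rewrite !mxE.
by rewrite (dot_int l) expi_int mulr1.
Qed.

Lemma gauss_bound (alpha : rat) (beta : 'rV[R]_n) : normc (gauss_sum d alpha beta) <= 1.
Proof.
have q0 := denom_gt0 alpha; set q := denom alpha in q0 *.
have qn : 0 < (q%:R : R) ^+ n by rewrite exprn_gt0// ltr0n.
rewrite /gauss_sum /= -/q normcM normcV normcX normc_nat.
rewrite mulrC ler_pdivrMr// mul1r (le_trans (normc_sum _ _ _))//.
rewrite (eq_bigr (fun=> 1)); last by move=> rho _; rewrite normc_expi.
by rewrite sumr_const card_mx card_ord mul1n -natrX.
Qed.

Definition brow q (b : 'rV['I_q]_n) : 'rV[int]_n := \row_i (b ord0 i : nat)%:Z.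

Lemma brow_div (q : nat) (b : 'rV['I_q]_n) (l : 'rV[int]_n) i : (0 < q)%N ->
  ((brow b + q%:Z *: l) ord0 i %/ q%:Z)%Z = l ord0 i.
Proof.
move=> q0; rewrite !mxE addrC mulrC divzMDl; last by rewrite eqz_nat -lt0n.
by rewrite divz_small ?addr0// ltz_nat ltn_ord.
Qed.

(** Euclidean division of integer vectors by q. *)
Lemma brow_inj (q N : nat) : (0 < q)%N ->
  injective (fun p : 'rV['I_N.*2.+1]_n * 'rV['I_q]_n => brow p.2 + q%:Z *: zrow p.1).
Proof.
move=> q0 [l b] [l' b'] /= E.
have El : l = l'.
  apply: (@zrow_inj n N); apply/rowP => i.
  by rewrite -(brow_div b (zrow l) i q0) E brow_div.
rewrite El in E *; move/addIr : E => /rowP Eb; congr pair.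
by apply/rowP => i; apply/val_inj; have := Eb i; rewrite !mxE => -[].
Qed.

Section WithPsi.
Context (psi : 'rV[R]_n -> R) (hpsi : cutoff psi).
Context (kappa : R) (s : nat).
(** The dilation in [chi_s]. *)
Definition lam_ : R := 2 `^ (4 * s%:R * 2 `^ (2 * kappa * s%:R)).
Context (lam2 : 2 <= lam_).
Local Notation chi_dil := (chi_dil psi lam_).

Let lam0 : 0 < lam_. Proof. exact: lt_le_trans lam2. Qed.

Definition betaq (q : nat) (b : 'rV['I_q]_n) : 'rV[R]_n := (q%:R : R)^-1 *: realvec R (brow b).

Lemma betaq_shift (q : nat) (b : 'rV['I_q]_n) (l : 'rV[int]_n) : (0 < q)%N ->
  (q%:R : R)^-1 *: realvec R (brow b + q%:Z *: l) = betaq b + realvec R l.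
Proof.
move=> q0; rewrite realvecD scalerDr; congr (_ + _).
apply/rowP => i; rewrite !mxE intrM mulrA mulVf ?mul1r//.
by rewrite pnatr_eq0 -lt0n.
Qed.

(** The sum over beta in (1/q) Z^n is a periodization: write beta = b/q + l with b in {0, .., q-1}^n
    and l integral, where the Gauss sum depends on b only. For xi in the unit cube and lam >= 2
    only shifts with |l| <= 3 meet the support of the cutoff. *)
Lemma L_mult_cube (alpha : rat) (m : 'rV[R]_n -> C) xi : cube xi ->
  L_mult d psi kappa s alpha m xi =
  \sum_(l : 'rV['I_3.*2.+1]_n) \sum_(b : 'rV['I_(denom alpha)]_n)
    gauss_sum d alpha (betaq b) *
      (m (xi - betaq b - realvec R (zrow l)) *
        ((chi_dil (xi - betaq b - realvec R (zrow l)))%:C)%C).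
Proof.
move=> hc; have q0 := denom_gt0 alpha; set q := denom alpha in q0 *.
have qR : 0 < q%:R :> R by rewrite ltr0n.
pose F (b : 'rV[int]_n) : C := let beta := (q%:R : R)^-1 *: realvec R b in
  gauss_sum d alpha beta * m (xi - beta) * ((chi_dil (xi - beta))%:C)%C.
pose h (p : 'rV['I_3.*2.+1]_n * 'rV['I_q]_n) := brow p.2 + q%:Z *: zrow p.1.
pose t := [seq h p | p <- enum {: 'rV['I_3.*2.+1]_n * 'rV['I_q]_n}].
have ut : uniq t by rewrite map_inj_uniq ?enum_uniq//; exact: brow_inj.
have -> : L_mult d psi kappa s alpha m xi = \sum_(b \in [set: 'rV[int]_n]) F b by [].
have -> : \sum_(b \in [set: 'rV[int]_n]) F b = \sum_(b \in [set` t]) F b.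
  apply/esym/fsbig_widen => // b [_ /= bt].
  have [e|e] := eqVneq (chi_dil (xi - q%:R^-1 *: realvec R b)) 0.
    by rewrite /F/= e mulr0.
  exfalso; apply: bt.
  have hn : `|xi - q%:R^-1 *: realvec R b| <= 1.
    rewrite leNgt; apply/negP => h1; move/eqP: e; apply.
    apply: (chi_dil_out hpsi) => //; apply: le_trans (ltW h1).
    by rewrite ler_pdivrMr// mul1r.
  (* The integer part of beta: since xi is in the unit cube and |xi - beta| <= 1, each coordinate
     of beta lies in [-1, 2]. *)
  have hl i : - 3%:Z <= (b ord0 i %/ q%:Z)%Z <= 3%:Z.
    have := le_trans (row_coord (xi - q%:R^-1 *: realvec R b) i) hn.
    rewrite !mxE ler_norml => /andP[h1 h2].
    move/asboolP : hc => /(_ i) /andP[h3 h4].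
    have h5 : q%:R^-1 * (b ord0 i)%:~R <= 2 :> R by lra.
    have h6 : -1 <= q%:R^-1 * (b ord0 i)%:~R :> R by lra.
    rewrite mulrC ler_pdivrMr// in h5.
    rewrite mulrC ler_pdivlMr// in h6.
    have {}h5 : b ord0 i <= 2 * q%:Z by rewrite -(ler_int R) intrM.
    have {}h6 : - q%:Z <= b ord0 i by rewrite -(ler_int R) rmorphN/=; lra.
    have E := divz_eq (b ord0 i) q%:Z.
    have m0 : 0 <= (b ord0 i %% q%:Z)%Z by rewrite modz_ge0// eqz_nat -lt0n.
    have m1 : (b ord0 i %% q%:Z)%Z < q%:Z by rewrite ltz_pmod.
    move: E m0 m1 h5 h6; set a := (_ %/ _)%Z; set c := (_ %% _)%Z; move: (b ord0 i) => z.
    by clearbody a c; nia.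
  have [l hlE] := @zrow_surj n 3 (\row_i (b ord0 i %/ q%:Z)%Z)
    (fun i => eq_ind_r (fun z => - 3%:Z <= z <= 3%:Z) (hl i) (mxE _ _ _ _)).
  have rq i : (`|b ord0 i %% q%:Z|%Z < q)%N.
    by rewrite -ltz_nat gez0_abs ?ltz_pmod// modz_ge0// eqz_nat -lt0n.
  apply/mapP; exists (l, \row_i Ordinal (rq i)); first by rewrite mem_enum.
  rewrite /h /= hlE; apply/rowP => i; rewrite !mxE /=.
  rewrite gez0_abs; last by rewrite modz_ge0// eqz_nat -lt0n.
  by rewrite addrC mulrC -divz_eq.
rewrite -fsbig_seq// /t big_map big_enum /=.
rewrite [RHS]pair_big /=; apply: eq_bigr => -[l b] _ /=.
rewrite /F /h /= betaq_shift// gauss_periodic -mulrA.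
by rewrite opprD addrA.
Qed.

(** The character is invariant under integer shifts, so [unfold_int] applies; the shift by beta
    produces the factor in front. *)
Lemma int_period (M : 'rV[R]_n -> C) (beta : 'rV[R]_n) (y : 'rV[int]_n) :
  cbcs M -> (forall x, 1 < `|x| -> M x = 0) -> `|beta| <= 1 ->
  \sum_(l : 'rV['I_3.*2.+1]_n) \J (fun xi => if cube xi then
      expi (dot xi (realvec R y)) * M (xi - beta - realvec R (zrow l)) else 0) =
  expi (dot beta (realvec R y)) * \J (fun xi => expi (dot xi (realvec R y)) * M xi).
Proof.
move=> bM M1 b1.
pose h xi := expi (dot xi (realvec R y)) * M (xi - beta).
have bh : cbcs h.
  apply: cbcs_expi.
  by apply: cbcs_ext (cbcs_affine (- beta) ltr01 bM) => x; rewrite scale1r.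
(* 1 for the support of M and 1 for beta, below the radius 3 of the shifts. *)
have h3 x : 3%:R < `|x| -> h x = 0.
  move=> hx; rewrite /h M1 ?mulr0//.
  have := ler_normB (x - beta) (- beta); rewrite opprK subrK normrN; lra.
rewrite (eq_bigr (fun l : 'rV['I_3.*2.+1]_n => \J (fun xi => if cube xi then
   h (xi - realvec R (zrow l)) else 0))); last first.
  move=> l _; apply: cint_ext => xi; case: ifP => // _.
  rewrite /h dotDl expiD dotNl.
  have -> : expi (- dot (realvec R (zrow l)) (realvec R y)) = 1.
    by rewrite dot_int -rmorphN/= expi_int.
  by rewrite mulr1 addrAC.
rewrite -unfold_int// -(cint_shift beta bh) -cintZ; last exact: cbcs_expi.
apply: cint_ext => x; rewrite /h addrK dotDl expiD; ring.
Qed.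

(** Unfold the torus: the convolution kernel factors into an arithmetic part, depending on alpha,
    and the Fourier coefficient of the localized multiplier. *)
Lemma mult_opE (alpha : rat) (m : 'rV[R]_n -> C) (g : 'rV[int]_n -> C) (X : seq 'rV[int]_n) x :
  cbcs (fun xi => m xi * ((chi_dil xi)%:C)%C) -> uniq X -> (forall u, g u != 0 -> u \in X) ->
  mult_op (L_mult d psi kappa s alpha m) g x =
  \sum_(u <- X) g u * ((\sum_(b : 'rV['I_(denom alpha)]_n) gauss_sum d alpha (betaq b) *
      expi (dot (betaq b) (realvec R (x - u)))) *
     \J (fun xi => expi (dot xi (realvec R (x - u))) * (m xi * ((chi_dil xi)%:C)%C))).
Proof.
move=> bM uX hX; have q0 := denom_gt0 alpha; set q := denom alpha in q0 *.
have qR : 0 < q%:R :> R by rewrite ltr0n.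
pose M xi := m xi * ((chi_dil xi)%:C)%C.
have M1 xi : 1 < `|xi| -> M xi = 0.
  move=> h; rewrite /M (chi_dil_out hpsi) ?mulr0//.
  by apply: le_trans (ltW h); rewrite ler_pdivrMr// mul1r.
have b1 (b : 'rV['I_q]_n) : `|betaq b| <= 1.
  apply: row_norm_le => // i; rewrite !mxE normrM ger0_norm ?invr_ge0 ?(ltW qR)//.
  by rewrite ler_pdivrMl// mulr1 normr_nat ler_nat ltnW.
have bl (u : 'rV[int]_n) (b : 'rV['I_q]_n) (l : 'rV['I_3.*2.+1]_n) :
    cbcs (fun xi => if cube xi then
      expi (dot xi (realvec R (x - u))) * M (xi - betaq b - realvec R (zrow l)) else 0).
  have b2 : cbcs (fun xi => expi (dot xi (realvec R (x - u))) *
      M (xi - betaq b - realvec R (zrow l))).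
    apply: cbcs_expi.
    by apply: cbcs_ext (cbcs_affine (- betaq b - realvec R (zrow l)) ltr01 bM) => z;
      rewrite scale1r addrA.
  apply: (@cbcs_ext _ _ _ _ _ (@cbcsM R n _ (fun xi => if cube xi then 1 else 0) 1 b2 _ _)).
  - by move=> z /=; case: ifP => _; rewrite ?mulr1 ?mulr0.
  - by apply: cmrow_if; [exact: mbool_cube|exact: cmrow_cst|exact: cmrow_cst].
  - by move=> z; case: ifP; rewrite ?normc1 ?normc0.
(* The integrand over the torus with the sums over u, b and the integer shifts l spelled out. *)
pose G xi := \sum_(u <- X) \sum_(b : 'rV['I_q]_n) (g u * gauss_sum d alpha (betaq b)) *
  \sum_(l : 'rV['I_3.*2.+1]_n) (if cube xi then
      expi (dot xi (realvec R (x - u))) * M (xi - betaq b - realvec R (zrow l)) else 0).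
transitivity (\J G).
  rewrite /mult_op /cintegral_torus; apply: cint_ext => xi.
  rewrite -/(cube xi) /G; case hc : (cube xi); last first.
    by rewrite big1// => u _; rewrite big1// => b _; rewrite big1 ?mulr0.
  rewrite L_mult_cube//.
  have -> : fourier_Zn g xi = \sum_(u <- X) expi (- dot xi (realvec R u)) * g u.
    rewrite /fourier_Zn (fsbig_seq _ _ uX); apply/esym/fsbig_widen => // u [_ /= uX'].
    have [->|/hX] := eqVneq (g u) 0; first by rewrite mulr0.
    by move=> h; case: uX'.
  rewrite mulr_sumr; apply: eq_bigr => u _.
  rewrite exchange_big /= mulr_sumr mulr_suml; apply: eq_bigr => b _.
  rewrite -mulr_sumr !mulr_sumr mulr_suml; apply: eq_bigr => l _.
  rewrite realvecB dotDr dotNr expiD /M; ring.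
have bin u (b : 'rV['I_q]_n) : cbcs (fun xi => \sum_(l : 'rV['I_3.*2.+1]_n) (if cube xi then
      expi (dot xi (realvec R (x - u))) * M (xi - betaq b - realvec R (zrow l)) else 0)).
  by apply: cbcs_sum => l; exact: bl.
rewrite /G cint_sum; last by move=> u; apply: cbcs_sum => b; apply: cbcsZ; exact: bin.
apply: eq_bigr => u _.
rewrite cint_sum; last by move=> b; apply: cbcsZ; exact: bin.
rewrite mulr_suml mulr_sumr; apply: eq_bigr => b _.
rewrite (cintZ _ (bin u b)) cint_sum; last by move=> l; exact: bl.
by rewrite (int_period (x - u) bM M1 (b1 b)) !mulrA.
Qed.

End WithPsi.
End Mult.

(** * Finite sums in l^p *)

Section Jensen.
Context (R : realType) (p : R) (p1 : 1 < p).
Let p0 : 0 < p. Proof. exact: lt_trans ltr01 p1. Qed.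

(** Convexity of t^p, as the tangent line at mu; an instance of Young's inequality for products. *)
Lemma powR_tangent (t mu : R) : 0 <= t -> 0 <= mu ->
  p * mu `^ (p - 1) * t <= t `^ p + (p - 1) * mu `^ p.
Proof.
move=> t0 mu0.
have pm : 0 < p - 1 by rewrite subr_gt0.
have q0 : 0 < p / (p - 1) by rewrite divr_gt0.
have pq : p^-1 + (p / (p - 1))^-1 = 1 by field; rewrite !gt_eqF.
have := conjugate_powR t0 (powR_ge0 mu (p - 1)) p0 q0 pq.
rewrite -powRrM mulrCA mulfV ?mulr1; last by rewrite gt_eqF.
have -> : mu `^ p / (p / (p - 1)) = (p - 1) * mu `^ p / p by field; rewrite !gt_eqF.
rewrite -mulrDl ler_pdivlMr// => h.
by rewrite (le_trans _ h)// le_eqVlt; apply/orP; left; apply/eqP; ring.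
Qed.

Lemma powR_split (x : R) : 0 <= x -> x `^ p = x `^ (p - 1) * x.
Proof.
move=> x0; rewrite -[X in _ * X](powRr1 x0) -powRD ?subrK//.
by rewrite gt_eqF.
Qed.

Lemma powR_le (x y : R) : 0 <= x -> x <= y -> x `^ p <= y `^ p.
Proof.
by move=> x0 xy; apply: ge0_ler_powR; rewrite ?nnegrE ?(ltW p0)//; apply: le_trans xy.
Qed.

(** Sum the tangent lines at the weighted mean. *)
Lemma jensen_sum (I : eqType) (s : seq I) (w t : I -> R) :
  (forall i, 0 <= w i) -> (forall i, 0 <= t i) ->
  (\sum_(i <- s) w i * t i) `^ p <= (\sum_(i <- s) w i) `^ (p - 1) * \sum_(i <- s) w i * t i `^ p.
Proof.
move=> w0 t0; set W := \sum_(i <- s) w i; set A := \sum_(i <- s) w i * t i.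
have W0 : 0 <= W by apply: sumr_ge0.
have A0 : 0 <= A by apply: sumr_ge0 => i _; rewrite mulr_ge0.
set B := \sum_(i <- s) _.
have B0 : 0 <= B by apply: sumr_ge0 => i _; rewrite mulr_ge0 ?powR_ge0.
have [W00|Wn0] := eqVneq W 0.
  have A00 : A = 0.
    move/eqP : W00; rewrite /W psumr_eq0// => /allP h.
    by rewrite /A big_seq big1// => i /h /eqP ->; rewrite mul0r.
  by rewrite A00 powR0 ?mulr_ge0 ?powR_ge0// gt_eqF.
have Wp : 0 < W by rewrite lt_neqAle eq_sym Wn0.
pose mu := A / W; have mu0 : 0 <= mu by rewrite divr_ge0.
have key : mu `^ p * W <= B.
  have : \sum_(i <- s) w i * (p * mu `^ (p - 1) * t i) <=
      \sum_(i <- s) w i * (t i `^ p + (p - 1) * mu `^ p).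
    by apply: ler_sum => i _; rewrite ler_wpM2l// powR_tangent.
  have -> : \sum_(i <- s) w i * (p * mu `^ (p - 1) * t i) = p * mu `^ (p - 1) * A.
    by rewrite /A mulr_sumr; apply: eq_bigr => i _; ring.
  have -> : \sum_(i <- s) w i * (t i `^ p + (p - 1) * mu `^ p) = B + (p - 1) * mu `^ p * W.
    rewrite /B /W mulr_sumr -big_split; apply: eq_bigr => i _ /=; ring.
  have -> : p * mu `^ (p - 1) * A = p * (mu `^ p * W).
    by rewrite (powR_split mu0) /mu; field.
  lra.
have -> : A `^ p = W `^ (p - 1) * (mu `^ p * W).
  rewrite mulrCA -(powR_split W0) -powRM//.
  by rewrite /mu divfK.
by rewrite ler_wpM2l// powR_ge0.
Qed.

Lemma powR_add2 (a b : R) : 0 <= a -> 0 <= b -> (a + b) `^ p <= 2 `^ p * (a `^ p + b `^ p).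
Proof.
move=> a0 b0; rewrite -[leRHS](_ : 2 `^ p * a `^ p + 2 `^ p * b `^ p = _); last by ring.
rewrite -!powRM//.
have [ab|ab] := leP a b.
  apply: (@le_trans _ _ ((2 * b) `^ p)); last by rewrite lerDr powR_ge0.
  by apply: powR_le; rewrite ?addr_ge0//; lra.
apply: (@le_trans _ _ ((2 * a) `^ p)); last by rewrite lerDl powR_ge0.
by apply: powR_le; rewrite ?addr_ge0//; lra.
Qed.

Lemma cvg_sum_seq (I : Type) (s : seq I) (f : I -> nat -> R) (l : I -> R) :
  (forall i, f i k @[k --> \oo] --> l i) ->
  \sum_(i <- s) f i k @[k --> \oo] --> \sum_(i <- s) l i.
Proof.
move=> h; elim: s => [|a s IH].
  rewrite big_nil; rewrite (_ : (fun k => _) = fun=> 0); first exact: cvg_cst.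
  by apply/funext => k; rewrite big_nil.
rewrite big_cons (_ : (fun k => _) = (fun k => f a k + \sum_(i <- s) f i k)).
  by apply: cvgD.
by apply/funext => k; rewrite big_cons.
Qed.

(** The tangent line at the limit is a linear minorant, for which convergence is immediate. *)
Lemma powR_sum_lsc (I : Type) (s : seq I) (y : I -> nat -> R) (Y : I -> R) (C : R) :
  (forall i k, 0 <= y i k) -> (forall i, 0 <= Y i) ->
  (forall i, y i k @[k --> \oo] --> Y i) ->
  (forall k, \sum_(i <- s) y i k `^ p <= C) -> \sum_(i <- s) Y i `^ p <= C.
Proof.
move=> y0 Y0 yY hC.
(* z k is the linear minorant of the defect; it tends to 0. *)
pose z k := \sum_(i <- s) p * Y i `^ (p - 1) * (Y i - y i k).
have z0 : z k @[k --> \oo] --> (0 : R).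
  rewrite -(_ : \sum_(i <- s) p * Y i `^ (p - 1) * (Y i - Y i) = 0).
    apply: cvg_sum_seq => i; apply: cvgMr; apply: cvgB => //; exact: cvg_cst.
  by rewrite big1// => i _; rewrite subrr mulr0.
have hz k : \sum_(i <- s) Y i `^ p - C <= z k.
  rewrite lerBlDr (le_trans _ (lerD (lexx _) (hC k)))// /z -big_split /=.
  apply: ler_sum => i _; rewrite mulrBr.
  have := powR_tangent (y0 i k) (Y0 i).
  have -> : p * Y i `^ (p - 1) * Y i = p * Y i `^ p by rewrite (powR_split (Y0 i)) mulrA.
  lra.
rewrite -subr_le0.
have nz : \forall k \near \oo, \sum_(i <- s) Y i `^ p - C <= z k by apply: nearW.
have := limr_ge (cvgP _ z0) nz.
have e : limn z = 0 by apply/cvg_lim.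
by rewrite e; apply.
Qed.

End Jensen.

Section FiniteBound.
Context (R : realType) (p : R) (p1 : 1 < p) (U : zmodType).
Let p0 : 0 < p. Proof. exact: lt_trans ltr01 p1. Qed.

(** The map y -> x - y is injective, so it sends repetition-free sequences to such sequences. *)
Lemma sum_reflect (h : U -> R) s x (Z : seq U) : (forall Z, uniq Z -> \sum_(y <- Z) h y <= s) ->
  uniq Z -> \sum_(u <- Z) h (x - u) <= s.
Proof.
move=> H uZ; rewrite -(big_map (fun u => x - u) predT h); apply: H.
by rewrite map_inj_uniq// => u v /addrI /oppr_inj.
Qed.

(** Jensen, then an exchange of the sums. *)
Lemma young_fin (k : U -> R) (a : R) (B X : seq U) (g : U -> R) :
  (forall y, 0 <= k y) -> (forall u, 0 <= g u) -> uniq B -> uniq X ->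
  (forall Z, uniq Z -> \sum_(y <- Z) k y <= a) ->
  \sum_(x <- B) (\sum_(u <- X) k (x - u) * g u) `^ p <= a `^ p * \sum_(u <- X) g u `^ p.
Proof.
move=> k0 g0 uB uX ha.
have a0 : 0 <= a by have := ha [::] isT; rewrite big_nil.
have hx x : \sum_(u <- X) k (x - u) <= a by exact: sum_reflect.
have hu u : \sum_(x <- B) k (x - u) <= a.
  rewrite -(big_map (fun x => x - u) predT k); apply: ha.
  by rewrite map_inj_uniq// => x y /addIr.
apply: (@le_trans _ _ (\sum_(x <- B) a `^ (p - 1) * \sum_(u <- X) k (x - u) * g u `^ p)).
  apply: ler_sum => x _; apply: (le_trans (jensen_sum p1 X (fun u => k0 (x - u)) g0)).
  rewrite ler_wpM2r//; first by apply: sumr_ge0 => u _; rewrite mulr_ge0 ?powR_ge0.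
  apply: ge0_ler_powR; rewrite ?nnegrE//; first by rewrite subr_ge0 ltW.
  by apply: sumr_ge0 => u _; exact: k0.
rewrite -mulr_sumr exchange_big /= (powR_split p1 a0) -mulrA ler_wpM2l ?powR_ge0//.
rewrite mulr_sumr; apply: ler_sum => u _.
by rewrite -mulr_suml ler_wpM2r ?powR_ge0.
Qed.

(** Jensen, with the pointwise bound m for the remaining weight. *)
Lemma sup_fin (k : U -> R) (a m : R) (X : seq U) (g : U -> R) x :
  (forall y, 0 <= k y) -> (forall u, 0 <= g u) -> uniq X ->
  (forall Z, uniq Z -> \sum_(y <- Z) k y <= a) -> (forall y, k y <= m) ->
  (\sum_(u <- X) k (x - u) * g u) `^ p <= a `^ (p - 1) * m * \sum_(u <- X) g u `^ p.
Proof.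
move=> k0 g0 uX ha hm.
have a0 : 0 <= a by have := ha [::] isT; rewrite big_nil.
have hx : \sum_(u <- X) k (x - u) <= a by exact: sum_reflect.
apply: (le_trans (jensen_sum p1 X (fun u => k0 (x - u)) g0)).
rewrite -mulrA; apply: ler_pM; rewrite ?powR_ge0//.
- by apply: sumr_ge0 => u _; rewrite mulr_ge0 ?powR_ge0.
- apply: ge0_ler_powR; rewrite ?nnegrE//; first by rewrite subr_ge0 ltW.
  by apply: sumr_ge0 => u _; exact: k0.
- by rewrite mulr_sumr; apply: ler_sum => u _; rewrite ler_wpM2r ?powR_ge0.
Qed.

(** The scales below I0 are added up and treated as one convolution by [young_fin]. The others are
    bounded uniformly in x by [sup_fin] and cost the number of points of B. *)
Lemma scales_bound (k : nat -> U -> R) (I0 : nat) (a S e N : R) (m : nat -> R)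
    (B X : seq U) (g : U -> R) (J : nat) :
  (forall i y, 0 <= k i y) -> (forall u, 0 <= g u) -> uniq B -> uniq X ->
  (forall Z, uniq Z -> \sum_(y <- Z) \sum_(i < I0) k i y <= a) ->
  (forall i Z, uniq Z -> \sum_(y <- Z) k i y <= S) -> (forall i y, k i y <= m i) ->
  (forall J, \sum_(I0 <= i < J) (S `^ (p - 1) * m i) `^ p^-1 <= e) ->
  (size B)%:R <= N ->
  \sum_(x <- B) (\sum_(i < J) \sum_(u <- X) k i (x - u) * g u) `^ p <=
  (4 * (a + N `^ p^-1 * e)) `^ p * \sum_(u <- X) g u `^ p.
Proof.
move=> k0 g0 uB uX ha hS hm he hN.
have a0 : 0 <= a by have := ha [::] isT; rewrite big_nil.
have S0 : 0 <= S by have := hS 0%N [::] isT; rewrite big_nil.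
have N0 : 0 <= N by apply: le_trans hN.
have m0 i : 0 <= m i by apply: le_trans (hm i 0).
have e0 : 0 <= e by have := he I0; rewrite big_geq.
set G := \sum_(u <- X) g u `^ p.
have G0 : 0 <= G by apply: sumr_ge0 => u _; rewrite powR_ge0.
pose h i x := \sum_(u <- X) k i (x - u) * g u.
have h0 i x : 0 <= h i x by apply: sumr_ge0 => u _; rewrite mulr_ge0.
pose h1 x := \sum_(u <- X) (\sum_(i < I0) k i (x - u)) * g u.
have h10 x : 0 <= h1 x.
  by apply: sumr_ge0 => u _; rewrite mulr_ge0// sumr_ge0.
(* The scales above I0 contribute at most c at every point. *)
pose c := e * G `^ p^-1.
have c0 : 0 <= c by rewrite mulr_ge0 ?powR_ge0.
have hh x : \sum_(i < J) h i x <= h1 x + c.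
  have h1E : h1 x = \sum_(i < I0) h i x.
    by rewrite /h1 /h exchange_big /=; apply: eq_bigr => u _; rewrite mulr_suml.
  (* Enlarge the range of the scales so that it can be cut at I0 whatever J is. *)
  apply: (@le_trans _ _ (\sum_(0 <= i < I0 + J) h i x)).
    rewrite -(big_mkord predT (fun i => h i x)) (@big_cat_nat _ _ _ J 0 (I0 + J))//= ?leq_addl//.
    by rewrite lerDl; apply: sumr_ge0.
  rewrite (@big_cat_nat _ _ _ I0 0 (I0 + J))//= ?leq_addr// big_mkord -h1E lerD2l.
  apply: (@le_trans _ _ (\sum_(I0 <= i < I0 + J) (S `^ (p - 1) * m i) `^ p^-1 * G `^ p^-1)).
    apply: ler_sum => i _.
    have q := sup_fin x (k0 i) g0 uX (hS i) (hm i).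
    have q2 : ((h i x) `^ p) `^ p^-1 <= (S `^ (p - 1) * m i * G) `^ p^-1.
      apply: ge0_ler_powR; rewrite ?nnegrE ?powR_ge0 ?invr_ge0 ?(ltW p0)//.
      by rewrite mulr_ge0// mulr_ge0 ?powR_ge0.
    rewrite -powRrM mulfV ?gt_eqF// powRr1// powRM// in q2.
    by rewrite mulr_ge0 ?powR_ge0.
  by rewrite -mulr_suml ler_wpM2r ?powR_ge0.
set D := a + N `^ p^-1 * e.
have D1 : a <= D by rewrite lerDl mulr_ge0 ?powR_ge0.
have D0 : 0 <= D by apply: le_trans D1.
have D2 : N `^ p^-1 * e <= D by rewrite lerDr.
apply: (@le_trans _ _ (\sum_(x <- B) (2 `^ p * ((h1 x) `^ p + c `^ p)))).
  apply: ler_sum => x _; apply: le_trans (powR_add2 p1 (h10 x) c0).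
  by apply: powR_le => //; [apply: sumr_ge0 => i _; exact: h0|exact: hh].
rewrite -mulr_sumr big_split /= big_const_seq count_predT iter_addr_0.
have k1 y : 0 <= \sum_(i < I0) k i y by apply: sumr_ge0.
have y1 := young_fin k1 g0 uB uX ha.
have y2 : c `^ p *+ size B <= D `^ p * G.
  rewrite /c powRM ?powR_ge0// -powRrM mulVf ?gt_eqF// powRr1//.
  rewrite -mulr_natr mulrAC ler_wpM2r//.
  apply: (@le_trans _ _ (e `^ p * N)); first by rewrite ler_wpM2l ?powR_ge0.
  have -> : e `^ p * N = (N `^ p^-1 * e) `^ p.
    by rewrite powRM ?powR_ge0// -powRrM mulVf ?gt_eqF// powRr1// mulrC.
  by apply: powR_le => //; rewrite mulr_ge0 ?powR_ge0.
have y3 : a `^ p * G <= D `^ p * G by rewrite ler_wpM2r// powR_le.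
rewrite powRM//.
have t1 : 2 `^ p * 2 <= 4 `^ p :> R.
  rewrite (_ : 4 = 2 * 2 :> R); last by ring.
  have t2 : 2 `^ 1 <= 2 `^ p :> R by apply: ler_powR; [rewrite ler1n|exact: ltW].
  by rewrite powRr1// in t2; rewrite powRM// ler_wpM2l ?powR_ge0.
apply: (@le_trans _ _ (2 `^ p * (D `^ p * G + D `^ p * G))).
  rewrite ler_wpM2l ?powR_ge0// lerD// (le_trans y1)//.
have DG : 0 <= D `^ p * G by rewrite mulr_ge0 ?powR_ge0.
have -> : 2 `^ p * (D `^ p * G + D `^ p * G) = 2 `^ p * 2 * (D `^ p * G) by ring.
by rewrite -[leRHS]mulrA ler_wpM2r.
Qed.
End FiniteBound.

(** * Extension by density and the variation norm *)

Section Ext.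
Context (R : realType) (n : nat) (p : R) (p1 : 1 < p).
Local Notation C := R[i].
Local Notation U := 'rV[int]_n.
Let p0 : 0 < p. Proof. exact: lt_trans ltr01 p1. Qed.

Lemma powRK (x : R) : 0 <= x -> (x `^ p) `^ p^-1 = x.
Proof. by move=> x0; rewrite -powRrM mulfV ?gt_eqF// powRr1. Qed.

Lemma powRVK (x : R) : 0 <= x -> (x `^ p^-1) `^ p = x.
Proof. by move=> x0; rewrite -powRrM mulVf ?gt_eqF// powRr1. Qed.

Lemma powRV_le (x y : R) : 0 <= x -> x <= y -> x `^ p^-1 <= y `^ p^-1.
Proof.
move=> x0 xy; apply: ge0_ler_powR; rewrite ?nnegrE ?invr_ge0 ?(ltW p0)//.
exact: le_trans xy.
Qed.

Lemma powR_le_inv (x y : R) : 0 <= x -> 0 <= y -> x `^ p <= y `^ p -> x <= y.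
Proof. by move=> x0 y0 h; rewrite -(powRK x0) -(powRK y0) powRV_le ?powR_ge0. Qed.

(** The p-th power of the l^p norm. It is finite exactly when the norm is, and additive over
    disjoint supports. *)
Definition psum (f : U -> C) : \bar R := \esum_(x in [set: U]) (normc (f x) `^ p)%:E.

Lemma psum_ge0 f : (0 <= psum f)%E.
Proof. by apply: esum_ge0 => x _; rewrite lee_fin powR_ge0. Qed.

Lemma lp_normE f : lp_norm p setT (cabs f) = (psum f `^ p^-1)%E.
Proof. by rewrite /lp_norm; congr (_ `^ _)%E; apply: eq_esum => x _; rewrite poweR_EFin. Qed.

Lemma lp_norm_leP f (D : R) : 0 <= D -> (lp_norm p setT (cabs f) <= (D `^ p^-1)%:E)%E ->
  (psum f <= D%:E)%E.
Proof.
move=> D0; rewrite lp_normE; have := psum_ge0 f; case: (psum f) => [x|//|//].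
  rewrite lee_fin => x0; rewrite poweR_EFin !lee_fin => h.
  by rewrite -(powRVK x0) -(powRVK D0) powR_le ?powR_ge0.
by rewrite poweRyr ?leye_eq// gt_eqF// invr_gt0.
Qed.

Lemma lp_norm_lty f : (lp_norm p setT (cabs f) < +oo)%E -> (psum f < +oo)%E.
Proof.
rewrite lp_normE; have := psum_ge0 f; case: (psum f) => [x|//|//]; first by move=> *; rewrite ltry.
by rewrite poweRyr// gt_eqF// invr_gt0.
Qed.

Lemma psum_seq f (X : seq U) : uniq X ->
  ((\sum_(u <- X) normc (f u) `^ p)%:E <= psum f)%E.
Proof.
move=> uX; apply: esum_ge; exists [set` X]; first by split => //; exact: finite_seq.
rewrite -fsbig_seq// sumEFin //.
Qed.

Lemma psum_le f (D : R) : (forall X, uniq X -> \sum_(u <- X) normc (f u) `^ p <= D) ->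
  (psum f <= D%:E)%E.
Proof.
move=> h; apply: ge_ereal_sup => _ [A [finA _] <-].
rewrite fsbig_finite//= sumEFin lee_fin; apply: h; exact: finmap.fset_uniq.
Qed.

Definition zbox (k : nat) : seq U := [seq zrow l | l <- enum {: 'rV['I_k.*2.+1]_n}].
Lemma zbox_uniq k : uniq (zbox k).
Proof. by rewrite map_inj_uniq ?enum_uniq//; exact: zrow_inj. Qed.

Lemma zboxP k (u : U) : (forall i, - k%:Z <= u ord0 i <= k%:Z) -> u \in zbox k.
Proof. by move=> /zrow_surj[l <-]; apply: map_f; rewrite mem_enum. Qed.

Lemma zbox_sub (X : seq U) : exists K, forall k, (K <= k)%N -> {subset X <= zbox k}.
Proof.
have [K hK] := seq_in_box X; exists K => k Kk u uX; apply: zboxP => i.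
have /andP[h1 h2] := hK u uX i; apply/andP; split.
  by apply: le_trans h1; rewrite lerN2 lez_nat.
by apply: (le_trans h2); rewrite lez_nat.
Qed.

Lemma size_zbox k : size (zbox k) = (k.*2.+1 ^ n)%N.
Proof. by rewrite size_map -cardE card_mx card_ord mul1n. Qed.

Definition boxtrunc (k : nat) (f : U -> C) : U -> C := fun u => if u \in zbox k then f u else 0.

Lemma boxtrunc_fin k f : finitely_supported (boxtrunc k f).
Proof.
apply: (@sub_finite_set _ _ [set` zbox k]) => //.
by move=> u /=; rewrite /boxtrunc; case: ifP => //; rewrite eqxx.
Qed.

(** A finite set carrying all but D of the mass lies in some box. *)
Lemma tail_small f (D : R) : (psum f < +oo)%E -> 0 < D ->
  exists K, forall k, (K <= k)%N -> (psum (fun u => boxtrunc k f u - f u)%R <= D%:E)%E.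
Proof.
move=> fo D0.
have ff : psum f \is a fin_num by rewrite ge0_fin_numE// psum_ge0.
have [_ [A [finA _] <-]] := ub_ereal_sup_adherent D0 ff.
rewrite fsbig_finite//= sumEFin => hA0.
have hA : (psum f - D%:E < (\sum_(u <- finmap.enum_fset (fset_set A)) normc (f u) `^ p)%R%:E)%E := hA0.
have [K hK] := zbox_sub (finmap.enum_fset (fset_set A)).
exists K => k Kk; apply: psum_le => X uX.
pose Y := finmap.enum_fset (fset_set A); pose Z := [seq u <- X | u \notin zbox k].
have uYZ : uniq (Y ++ Z).
  rewrite cat_uniq finmap.fset_uniq filter_uniq// andbT /=.
  apply/hasPn => u; rewrite mem_filter => /andP[uk _]; apply/negP => uY.
  by rewrite (hK k Kk u uY) in uk.
have h1 := psum_seq f uYZ; rewrite big_cat /= in h1.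
have -> : \sum_(u <- X) normc (boxtrunc k f u - f u) `^ p = \sum_(u <- Z) normc (f u) `^ p.
  rewrite /Z big_filter [LHS](bigID (fun u => u \in zbox k)) /= big1 ?add0r.
    by apply: eq_bigr => u uk; rewrite /boxtrunc (negbTE uk) sub0r normcN.
  by move=> u uk; rewrite /boxtrunc uk subrr normc0 powR0// gt_eqF.
move: hA h1; rewrite -(fineK ff) -EFinB lte_fin lee_fin; lra.
Qed.

Lemma cvge_near (u : nat -> \bar R) (D : R) : u k @[k --> \oo] --> (0 : \bar R)%E -> 0 < D ->
  \forall k \near \oo, (u k <= D%:E)%E.
Proof.
move=> hu D0.
have : nbhs (0 : \bar R)%E [set x | (x <= D%:E)%E].
  apply: (@filterS _ _ _ [set x | (x < D%:E)%E]); first by move=> x /= /ltW.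
  by apply: open_nbhs_nbhs; split; [exact: open_ereal_lt_ereal|rewrite /= lte_fin].
exact: hu.
Qed.

Lemma boxtrunc_cvg f : (psum f < +oo)%E ->
  lp_norm p setT (cabs (fun x => boxtrunc k f x - f x)) @[k --> \oo] --> (0 : \bar R).
Proof.
move=> fo.
have hfin : forall D : R, 0 < D -> \forall k \near \oo,
    (lp_norm p setT (cabs (fun x => boxtrunc k f x - f x)%R) <= D%:E)%E.
  move=> D D0; have Dp : 0 < D `^ p by rewrite powR_gt0.
  have [K hK] := tail_small fo Dp.
  exists K => // k /= Kk; rewrite (lp_normE (fun x => boxtrunc k f x - f x)).
  have := hK k Kk; have := psum_ge0 (fun u => boxtrunc k f u - f u).
  case: (psum (fun u => boxtrunc k f u - f u)) => [x|//|//]; rewrite !lee_fin => x0 xD.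
  by rewrite -(powRK (ltW D0)) powRV_le.
have g0 k : (0 <= lp_norm p setT (cabs (fun x => boxtrunc k f x - f x)%R))%E by exact: poweR_ge0.
apply/fine_cvgP; split.
  have := hfin 1 ltr01; apply: filterS => k h.
  by rewrite ge0_fin_numE//; apply: le_lt_trans h (ltry _).
apply/cvgrPdist_le => e e0; have := hfin e e0; apply: filterS => k h.
rewrite sub0r normrN /= ger0_norm ?fine_ge0//.
by rewrite -lee_fin fineK// ge0_fin_numE//; apply: le_lt_trans h (ltry _).
Qed.

Section Functional.
Context (T : (U -> C) -> C) (b : U -> C) (S M : R).
Context (hT : forall g X, uniq X -> (forall u, g u != 0 -> u \in X) ->
  T g = \sum_(u <- X) g u * b u).
Context (hS : forall Z, uniq Z -> \sum_(u <- Z) normc (b u) <= S).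
Context (hM : forall u, normc (b u) <= M).

(** T is given by a kernel b that is summable and bounded, hence it is bounded on l^p; the estimate
    is phrased for two approximations g and g' of f. *)
Lemma functional_diff f g g' (D D' : R) : finitely_supported g -> finitely_supported g' ->
  (psum (fun u => g u - f u)%R <= D%:E)%E -> (psum (fun u => g' u - f u)%R <= D'%:E)%E ->
  normc (T g - T g') `^ p <= S `^ (p - 1) * M * (2 `^ p * (D + D')).
Proof.
move=> fg fg' hD hD'.
pose X := undup (finmap.enum_fset (fset_set [set u | g u != 0]) ++ finmap.enum_fset (fset_set [set u | g' u != 0])).
have uX : uniq X by exact: undup_uniq.
have gX u : g u != 0 -> u \in X.
  by move=> h; rewrite mem_undup mem_cat in_fset_set// mem_set.
have gX' u : g' u != 0 -> u \in X.
  by move=> h; rewrite mem_undup mem_cat orbC in_fset_set// mem_set.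
rewrite (hT uX gX) (hT uX gX') -sumrB.
have S0 : 0 <= S by have := hS (Z := [::]) isT; rewrite big_nil.
have M0 : 0 <= M by apply: le_trans (hM 0); exact: normc_ge0.
have s1 : \sum_(u <- X) normc (g u - f u) `^ p <= D.
  by rewrite -lee_fin; apply: le_trans hD; exact: (psum_seq (fun u => g u - f u)).
have s2 : \sum_(u <- X) normc (g' u - f u) `^ p <= D'.
  by rewrite -lee_fin; apply: le_trans hD'; exact: (psum_seq (fun u => g' u - f u)).
have s3 : \sum_(u <- X) normc (g u - g' u) `^ p <= 2 `^ p * (D + D').
  apply: (@le_trans _ _ (\sum_(u <- X) 2 `^ p * (normc (g u - f u) `^ p + normc (g' u - f u) `^ p))).
    apply: ler_sum => u _; apply: le_trans (powR_add2 p1 (normc_ge0 _) (normc_ge0 _)).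
    apply: powR_le => //; first exact: normc_ge0.
    have -> : g u - g' u = (g u - f u) - (g' u - f u) by ring.
    exact: normcB.
  by rewrite -mulr_sumr big_split /= ler_wpM2l ?powR_ge0// lerD.
have t1 : normc (\sum_(u <- X) (g u * b u - g' u * b u)) <=
    \sum_(u <- X) normc (b u) * normc (g u - g' u).
  rewrite (le_trans (normc_sum _ _ _))//; apply: ler_sum => u _.
  by rewrite -mulrBl normcM mulrC.
apply: (le_trans (powR_le p1 (normc_ge0 _) t1)).
apply: (le_trans (jensen_sum p1 X (fun u => normc_ge0 (b u)) (fun u => normc_ge0 (g u - g' u)))).
rewrite -mulrA; apply: ler_pM; rewrite ?powR_ge0//.
- by apply: sumr_ge0 => u _; rewrite mulr_ge0 ?powR_ge0 ?normc_ge0.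
- apply: ge0_ler_powR; rewrite ?nnegrE ?subr_ge0 ?(ltW p1)//; last exact: hS.
  by apply: sumr_ge0 => u _; exact: normc_ge0.
- apply: (@le_trans _ _ (M * \sum_(u <- X) normc (g u - g' u) `^ p)); last by rewrite ler_wpM2l.
  by rewrite mulr_sumr; apply: ler_sum => u _; rewrite ler_wpM2r ?powR_ge0.
Qed.

(** The values at the truncations of f form a Cauchy sequence by [functional_diff], and every
    other approximating sequence has the same limit. *)
Lemma ext_exists f : (psum f < +oo)%E -> exists z, lp_extension_value p T f z.
Proof.
move=> fo.
have S0 : 0 <= S by have := hS (Z := [::]) isT; rewrite big_nil.
have M0 : 0 <= M by apply: le_trans (hM 0); exact: normc_ge0.
pose c := S `^ (p - 1) * M * 2 `^ p.
have c0 : 0 <= c by rewrite !mulr_ge0 ?powR_ge0.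
(* Uniform continuity of T near f, measured by the p-th powers of the distances. *)
have mod (e : R) : 0 < e -> exists2 D : R, 0 < D & forall g g', finitely_supported g ->
    finitely_supported g' -> (psum (fun u => g u - f u)%R <= D%:E)%E ->
    (psum (fun u => g' u - f u)%R <= D%:E)%E -> normc (T g - T g') <= e.
  move=> e0; have ep : 0 < e `^ p by rewrite powR_gt0.
  exists (e `^ p / (2 * (c + 1))).
    by rewrite divr_gt0// mulr_gt0// ltr_wpDl.
  move=> g g' fg fg' h h'; apply: powR_le_inv; rewrite ?normc_ge0 ?(ltW e0)//.
  apply: (le_trans (functional_diff fg fg' h h')).
  have c1 : c + 1 != 0 by rewrite gt_eqF// ltr_wpDl.
  have -> : S `^ (p - 1) * M * (2 `^ p * (e `^ p / (2 * (c + 1)) + e `^ p / (2 * (c + 1)))) =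
     c / (c + 1) * e `^ p by rewrite /c; field.
  by rewrite ler_piMl ?(ltW ep)// ler_pdivrMr ?mul1r ?lerDl// ltr_wpDl.
pose a k := T (boxtrunc k f).
have cauchy (h : C -> R) : (forall x y, `|h x - h y| <= normc (x - y)) -> cvgn (fun k => h (a k)).
  move=> hh; apply: cauchy_cvg; apply: cauchy_exP => e e0.
  have e2 : 0 < e / 2 by rewrite divr_gt0.
  have [D D0 hD] := mod _ e2; have [K hK] := tail_small fo D0.
  exists (h (a K)); exists K => // k /= Kk.
  rewrite /ball /= (le_lt_trans (hh _ _))//.
  have := hD _ _ (boxtrunc_fin K f) (boxtrunc_fin k f) (hK K (leqnn _)) (hK k Kk).
  rewrite -/(a K) -/(a k); lra.
have cR : cvgn (fun k => complex.Re (a k)).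
  by apply: cauchy => x y; apply: le_trans (Re_le_normc _); rewrite ReD ReN.
have cI : cvgn (fun k => complex.Im (a k)).
  by apply: cauchy => x y; apply: le_trans (Im_le_normc _); rewrite ImD ImN.
pose z : C := (limn (fun k => complex.Re (a k)) +i* limn (fun k => complex.Im (a k)))%C.
exists z => g fg hg.
apply/cvgrPdist_le => e e0.
have e2 : 0 < e / 2 by rewrite divr_gt0.
have e4 : 0 < e / 4 by rewrite divr_gt0.
have [D D0 hD] := mod _ e2; have [K hK] := tail_small fo D0.
have Dp : 0 < D `^ p^-1 by rewrite powR_gt0.
have nR : \forall k \near \oo, `|limn (fun k => complex.Re (a k)) - complex.Re (a k)| <= e / 4.
  by move/cvgrPdist_le : cR; apply.
have nI : \forall k \near \oo, `|limn (fun k => complex.Im (a k)) - complex.Im (a k)| <= e / 4.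
  by move/cvgrPdist_le : cI; apply.
have nK : \forall k \near \oo, (K <= k)%N by exists K.
have [m [[hR hI] Km]] := filter_ex (filterI (filterI nR nI) nK).
have hz : normc (a m - z) <= e / 2.
  apply: (le_trans (normc_le_ReIm _)); rewrite ReD ReN ImD ImN /=.
  rewrite distrC [X in _ + X]distrC; lra.
have := cvge_near hg Dp; apply: filterS => k hk.
rewrite sub0r normrN ger0_norm ?normc_ge0//.
have -> : T (g k) - z = (T (g k) - a m) + (a m - z) by rewrite addrA subrK.
apply: (le_trans (le_normcD _ _)).
have := hD _ _ (fg k) (boxtrunc_fin m f) (lp_norm_leP (ltW D0) hk) (hK m Km).
rewrite -/(a m); lra.
Qed.
End Functional.
End Ext.

Section Variation.
Context (R : realType) (r : R) (r1 : 1 < r).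
Local Notation C := R[i].

Lemma sum_powR_le (I : eqType) (s : seq I) (x : I -> R) : (forall i, 0 <= x i) ->
  \sum_(i <- s) x i `^ r <= (\sum_(i <- s) x i) `^ r.
Proof.
move=> x0; set X := \sum_(i <- s) x i.
have X0 : 0 <= X by apply: sumr_ge0.
rewrite (powR_split r1 X0) {2}/X mulr_sumr big_seq [leRHS]big_seq.
apply: ler_sum => i si; rewrite (powR_split r1 (x0 i)) ler_wpM2r//.
apply: ge0_ler_powR; rewrite ?nnegrE ?subr_ge0 ?(ltW r1)//.
by rewrite /X (big_rem i)//= lerDl; apply: sumr_ge0.
Qed.

(** V^r is dominated by V^1, and the increments over any subsequence by the elementary increments.
    As F vanishes at 0, the same sum bounds the supremum of F. *)
Lemma V_norm_le (F : nat -> C) (S : R) : F 0%N = 0 ->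
  (forall J, \sum_(i < J) normc (F i.+1 - F i) <= S) ->
  (V_norm r [set j | (0 < j)%N] F <= (2 * S)%:E)%E.
Proof.
move=> F0 hS; rewrite mulr_natl mulr2n EFinD; apply: leeD.
  apply: ge_ereal_sup => _ [j _ <-]; rewrite lee_fin.
  apply: le_trans (hS j).
  rewrite -[F j]subr0 -F0 -(telescope_sumr F (leq0n j)) big_mkord.
  exact: normc_sum.
apply: ge_ereal_sup => _ [J [t [tm tI ->]]]; rewrite lee_fin.
apply: (@le_trans _ _ (\sum_(j < J) normc (F (t j.+1) - F (t j)))).
  rewrite -[leRHS](powRK r1); last by apply: sumr_ge0 => j _; exact: normc_ge0.
  apply: (powRV_le r1); first by apply: sumr_ge0 => i _; rewrite powR_ge0.
  by apply: sum_powR_le => j; exact: normc_ge0.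
apply: le_trans (hS (t J)).
have key m : (m <= J)%N -> \sum_(j < m) normc (F (t j.+1) - F (t j)) <=
    \sum_(i < t m) normc (F i.+1 - F i).
  elim: m => [|m IH] mJ.
    by rewrite big_ord0; apply: sumr_ge0 => i _; exact: normc_ge0.
  have tt : (t m <= t m.+1)%N by exact/ltnW/tm.
  rewrite big_ord_recr /= -(big_mkord predT (fun i => normc (F i.+1 - F i))).
  rewrite (@big_cat_nat _ _ _ (t m))//=.
  apply: lerD; first by rewrite big_mkord; apply: IH; exact: ltnW.
  by rewrite -(telescope_sumr F)//; exact: normc_sum.
exact: key.
Qed.
End Variation.

(** * Choice of the parameters *)

Section Numeric.
Context (R : realType).

Lemma pow2D (x y : R) : 2 `^ (x + y) = 2 `^ x * 2 `^ y :> R.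
Proof. by rewrite powRD// pnatr_eq0 implybT. Qed.

Lemma powR_expn (b t : R) k : 0 <= b -> (b ^+ k) `^ t = (b `^ t) ^+ k.
Proof. by move=> b0; rewrite -(powR_mulrn k b0) -(powR_mulrn k (powR_ge0 b t)) -!powRrM mulrC. Qed.

Lemma geo_up (th : R) I0 : 1 < th -> \sum_(i < I0) th ^+ i.+1 <= th / (th - 1) * th ^+ I0.
Proof.
move=> h; have d : 0 < th - 1 by rewrite subr_gt0.
rewrite mulrAC ler_pdivlMr//.
elim: I0 => [|I0 IH]; first by rewrite big_ord0 mul0r expr0 mulr1; lra.
rewrite big_ord_recr /= mulrDl (le_trans (lerD IH (lexx _)))//.
by rewrite !exprS; have := exprn_ge0 I0 (le_trans ler01 (ltW h)); nra.
Qed.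

Lemma geo_down (th : R) I0 J : 0 < th < 1 -> \sum_(I0 <= i < J) th ^+ i.+1 <= th ^+ I0 / (1 - th).
Proof.
move=> /andP[h0 h1]; have d : 0 < 1 - th by rewrite subr_gt0.
have pw k : 0 <= th ^+ k by rewrite exprn_ge0// ltW.
rewrite ler_pdivlMr//.
have [JI|IJ] := leqP J I0; first by rewrite big_geq// mul0r.
rewrite mulr_suml (eq_big_nat _ _ (F2 := fun i => - th ^+ i.+2 - - th ^+ i.+1)); last first.
  by move=> i _; rewrite [th ^+ i.+2]exprS; ring.
rewrite telescope_sumr; last exact: ltnW.
have := pw J.+1; have : th ^+ I0.+1 <= th ^+ I0 by rewrite exprS ler_piMl// ltW.
lra.
Qed.

Lemma dyadic (Y : R) : 1 <= Y -> exists I0 : nat, Y <= 2 ^+ I0 <= 2 * Y.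
Proof.
move=> Y1.
have ex : exists k : nat, Y <= 2 ^+ k.
  exists (Num.bound Y).
  have h : Y < (Num.bound Y)%:R by apply: archi_boundP; lra.
  apply: (le_trans (ltW h)); rewrite -natrX ler_nat ltnW//; exact: ltn_expl.
pose k := ex_minn ex; exists k.
rewrite /k; case: ex_minnP => m hm mmin; rewrite hm /=.
case: m hm mmin => [|m] hm mmin; first by rewrite expr0; lra.
rewrite exprS ler_wpM2l// leNgt; apply/negP => h.
by have := mmin m (ltW h); rewrite ltnn.
Qed.

Lemma lam_ge2 (kappa : R) s : 0 < kappa -> (0 < s)%N -> 2 <= lam_ kappa s.
Proof.
move=> k0 s0; have s1 : 1 <= s%:R :> R by rewrite ler1n.
have h : 1 <= 2 `^ (2 * kappa * s%:R) :> R.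
  have h0 : 2 `^ 0 <= 2 `^ (2 * kappa * s%:R) :> R by apply: ler_powR; [rewrite ler1n|nra].
  by rewrite powRr0 in h0.
have : 2 `^ 1 <= lam_ kappa s by apply: ler_powR; [rewrite ler1n|nra].
by rewrite powRr1.
Qed.

(** The exponent of 2 on the left is s n - 2 tau s 2^(2 kappa s), in which 2^(2 kappa s) grows at
    least linearly in s. A linear term minus a quadratic one is bounded above. *)
Lemma lam_absorbs (n : nat) (kappa tau : R) : 0 < kappa -> 0 < tau ->
  exists c : R, 0 <= c /\ forall s : nat,
    (2 ^+ s) ^+ n * ((lam_ kappa s) `^ 2^-1) `^ (- tau) <= c * 2 `^ (- s%:R).
Proof.
move=> k0 t0.
have l2 : 0 < ln 2 :> R by rewrite ln_gt0// ltr1n.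
pose b := 2 * tau * (2 * kappa * ln 2).
have b0 : 0 < b by rewrite !mulr_gt0.
exists (2 `^ ((n%:R + 1) ^+ 2 / (4 * b))); split; first exact: powR_ge0.
move=> s; set x : R := s%:R.
have x0 : 0 <= x by [].
have -> : (2 ^+ s) ^+ n = 2 `^ (x * n%:R) :> R.
  by rewrite -exprM -powR_mulrn// natrM.
have -> : ((lam_ kappa s) `^ 2^-1) `^ (- tau) = 2 `^ (- (2 * tau * x * 2 `^ (2 * kappa * x))).
  by rewrite /lam_ -!powRrM; congr (2 `^ _); rewrite -/x; field.
rewrite -!pow2D ler_powR ?ler1n//.
(* 1 + u <= exp u with u = 2 kappa x ln 2. *)
have h : 2 * kappa * ln 2 * x <= 2 `^ (2 * kappa * x).
  rewrite /powR pnatr_eq0/=; apply: le_trans (expR_ge1Dx _).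
  by rewrite mulrAC; lra.
have h2 : b * x ^+ 2 <= 2 * tau * x * 2 `^ (2 * kappa * x).
  have -> : b * x ^+ 2 = 2 * tau * x * (2 * kappa * ln 2 * x) by rewrite /b; ring.
  by rewrite ler_wpM2l// !mulr_ge0// ltW.
have h3 : (n%:R + 1) * x <= (n%:R + 1) ^+ 2 / (4 * b) + b * x ^+ 2.
  rewrite -subr_ge0.
  have -> : (n%:R + 1) ^+ 2 / (4 * b) + b * x ^+ 2 - (n%:R + 1) * x =
     b * (x - (n%:R + 1) / (2 * b)) ^+ 2 by field; rewrite gt_eqF.
  by rewrite mulr_ge0 ?sqr_ge0// ltW.
lra.
Qed.

(** The arithmetic of the argument. P1 and P2 stand for the constants of the two kernel bounds,
    t is min(epsilon/2, 1/2), I0 is chosen with 2^I0 close to lambda^(1/2) rad^2, and a, e are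
    the sums of the two geometric series over the scales below and above I0. *)
Lemma constants (n : nat) (p eps kappa P1 P2 : R) : (0 < n)%N -> 1 < p -> 0 < eps ->
  0 < kappa -> 0 <= P1 -> 0 <= P2 ->
  exists t : R, 0 <= t <= 2^-1 /\ exists c : R, 0 <= c /\ forall (s : nat) (rad : R),
    (0 < s)%N -> 1 <= rad ->
    exists (I0 : nat) (a e : R),
    [/\ \sum_(i < I0) P1 * (2 ^+ i.+1 / lam_ kappa s) `^ t <= a,
        forall J, \sum_(I0 <= i < J) (P1 `^ (p - 1) * (P2 * (2 ^+ i.+1) ^- n)) `^ p^-1 <= e
      & 8 * (2 ^+ s) ^+ n * (a + ((3 * rad) ^+ n) `^ p^-1 * e) <= c * rad `^ eps * 2 `^ (- s%:R)].
Proof.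
move=> n0 p1 eps0 k0 P10 P20.
have p0 : 0 < p by lra.
have nR : 0 < n%:R :> R by rewrite ltr0n.
pose t : R := Num.min (eps / 2) 2^-1.
have t0 : 0 < t by rewrite lt_min divr_gt0//= invr_gt0.
have t2 : t <= 2^-1 by rewrite ge_min lexx orbT.
have te : 2 * t <= eps.
  have : t <= eps / 2 by rewrite ge_min lexx.
  lra.
exists t; split; first by rewrite (ltW t0).
(* 2^(-v) is the ratio of the geometric series above I0. *)
pose v : R := n%:R / p.
have v0 : 0 < v by rewrite divr_gt0.
pose th : R := 2 `^ t.
have th1 : 1 < th.
  rewrite /th /powR pnatr_eq0/= -[ltLHS]expR0 ltr_expR mulr_gt0// ln_gt0// ltr1n//.
pose ph : R := 2 `^ (- v).
have ph0 : 0 < ph by rewrite powR_gt0.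
have ph1 : ph < 1.
  rewrite /ph /powR pnatr_eq0/= -[ltRHS]expR0 ltr_expR mulNr oppr_lt0 mulr_gt0// ln_gt0// ltr1n//.
pose tau : R := Num.min t v.
have tau0 : 0 < tau by rewrite lt_min t0.
have tau1 : tau <= t by rewrite ge_min lexx.
have tau2 : tau <= v by rewrite ge_min lexx orbT.
have [c [c0 hc]] := lam_absorbs n k0 tau0.
pose c1 := P1 * (th / (th - 1)) * 2 `^ t.
have c10 : 0 <= c1.
  by rewrite !mulr_ge0 ?powR_ge0 ?invr_ge0// subr_ge0 ltW.
pose c2 := (P1 `^ (p - 1) * P2) `^ p^-1 / (1 - ph).
have c20 : 0 <= c2 by rewrite divr_ge0 ?powR_ge0// subr_ge0 ltW.
pose c3 := c1 + 3 `^ v * c2.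
have c30 : 0 <= c3 by rewrite addr_ge0// mulr_ge0// powR_ge0.
exists (8 * c3 * c); split; first by rewrite !mulr_ge0.
move=> s rad s0 rad1.
have lam2 : 2 <= lam_ kappa s by exact: lam_ge2.
have hQ := hc s; move: (lam_ kappa s) lam2 hQ => lam lam2 hQ.
have lam0 : 0 <= lam by lra.
(* 2^I0 is within a factor 2 of mu rad^2, with mu = lambda^(1/2). *)
pose mu := lam `^ 2^-1.
have mu1 : 1 <= mu.
  rewrite -[leLHS](powRr0 lam) ler_powR//; lra.
have mu0 : 0 < mu by lra.
have rad0 : 0 < rad by lra.
have lamE : lam = mu * mu.
  have lamn0 : lam != 0 by rewrite gt_eqF//; lra.
  rewrite /mu -powRD; last by rewrite lamn0 implybT.
  by rewrite (_ : 2^-1 + 2^-1 = 1 :> R) ?powRr1//; field.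
have Y1 : 1 <= mu * rad ^+ 2.
  by rewrite mulr_ege1// exprn_ege1.
have Y0 : 0 < mu * rad ^+ 2 by lra.
have [I0 /andP[hI1 hI2]] := dyadic Y1.
have q0 : 0 < 2 ^+ I0 :> R by rewrite exprn_gt0.
pose a := P1 * (th / (th - 1) * th ^+ I0) * lam `^ (- t).
pose e := (P1 `^ (p - 1) * P2) `^ p^-1 * (ph ^+ I0 / (1 - ph)).
exists I0, a, e; split.
- rewrite -mulr_sumr /a -mulrA ler_wpM2l//.
  rewrite (eq_bigr (fun i : 'I_I0 => th ^+ i.+1 * lam `^ (- t))); last first.
    move=> i _; have w1 : 0 <= 2 ^+ i.+1 :> R by rewrite exprn_ge0.
    have w2 : 0 <= lam^-1 by rewrite invr_ge0.
    by rewrite (powRM t w1 w2) (powR_expn _ _ (ler0n R 2)) -(powR_inv1 lam0) -powRrM mulN1r.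
  by rewrite -mulr_suml ler_wpM2r ?powR_ge0// geo_up.
- move=> J; pose D := (P1 `^ (p - 1) * P2) `^ p^-1.
  have key (i : nat) : (P1 `^ (p - 1) * (P2 * (2 ^+ i.+1) ^- n)) `^ p^-1 = D * ph ^+ i.+1.
    have w0 : 0 <= (2 ^+ i.+1) ^- n :> R by rewrite invr_ge0 exprn_ge0// exprn_ge0.
    rewrite mulrA powRM//; last by rewrite mulr_ge0// powR_ge0.
    congr (_ * _); rewrite /ph -powR_expn// -[in RHS]powR_mulrn// -powRrM.
    rewrite -exprM -powR_mulrn// -powRN -powRrM; congr (2 `^ _).
    by rewrite natrM /v; field; rewrite gt_eqF.
  rewrite (eq_big_nat _ _ (fun i _ => key i)) -mulr_sumr /e.
  by rewrite ler_wpM2l ?powR_ge0// geo_down// ph0.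
have mt : 0 <= mu `^ (- tau) by exact: powR_ge0.
have re1 : 1 <= rad `^ eps by rewrite -[leLHS](powRr0 rad) ler_powR// ltW.
(* (2^I0 / lambda)^t <= 2^t mu^(-t) rad^(2t). *)
have ha : a <= c1 * (rad `^ eps * mu `^ (- tau)).
  have h1 : th ^+ I0 <= 2 `^ t * mu `^ t * rad `^ eps.
    rewrite /th -powR_expn//.
    apply: (@le_trans _ _ ((2 * (mu * rad ^+ 2)) `^ t)).
      by apply: ge0_ler_powR; rewrite ?nnegrE ?(ltW t0) ?(ltW q0)// mulr_ge0// ltW.
    rewrite powRM ?(ltW Y0)// powRM ?sqr_ge0 ?(ltW mu0)// mulrA ler_wpM2l ?mulr_ge0 ?powR_ge0//.
    by rewrite -powR_mulrn ?(ltW rad0)// -powRrM ler_powR.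
  have h2 : lam `^ (- t) = mu `^ (- t) * mu `^ (- t) by rewrite lamE powRM// ltW.
  have h3 : mu `^ t * mu `^ (- t) = 1 by rewrite -powRD ?subrr ?powRr0// eqxx/= gt_eqF.
  have h4 : mu `^ (- t) <= mu `^ (- tau) by rewrite ler_powR// lerN2.
  have k1 : 0 <= P1 * (th / (th - 1)).
    by rewrite mulr_ge0// divr_ge0 ?powR_ge0// subr_ge0 ltW.
  rewrite /a mulrA -mulrA.
  apply: (@le_trans _ _ (P1 * (th / (th - 1)) * ((2 `^ t * mu `^ t * rad `^ eps) * lam `^ (- t)))).
    by rewrite ler_wpM2l// ler_wpM2r ?powR_ge0.
  rewrite h2.
  have -> : P1 * (th / (th - 1)) * (2 `^ t * mu `^ t * rad `^ eps * (mu `^ (- t) * mu `^ (- t))) =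
    c1 * (rad `^ eps * mu `^ (- t)) * (mu `^ t * mu `^ (- t)) by rewrite /c1; ring.
  by rewrite h3 mulr1 ler_wpM2l// ler_wpM2l// powR_ge0.
(* rad^v 2^(-v I0) <= mu^(-v) rad^(-v). *)
have hb : ((3 * rad) ^+ n) `^ p^-1 * e <= 3 `^ v * c2 * (rad `^ eps * mu `^ (- tau)).
  have h1 : ((3 * rad) ^+ n) `^ p^-1 = 3 `^ v * rad `^ v.
    by rewrite -powR_mulrn ?mulr_ge0 ?(ltW rad0)// -powRrM powRM// ltW.
  have h2 : ph ^+ I0 <= mu `^ (- v) * (rad `^ (- v) * rad `^ (- v)).
    rewrite /ph -powR_expn// -!powRM ?(ltW rad0) ?(ltW mu0) ?mulr_ge0 ?(ltW rad0)//.
    rewrite -expr2 !powRN lef_pV2 ?posrE ?powR_gt0//.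
    by apply: ge0_ler_powR; rewrite ?nnegrE ?(ltW v0) ?(ltW q0) ?(ltW Y0).
  have h3 : rad `^ v * rad `^ (- v) = 1 by rewrite -powRD ?subrr ?powRr0// eqxx/= gt_eqF.
  have h4 : rad `^ (- v) <= rad `^ eps by rewrite ler_powR//; lra.
  have h5 : mu `^ (- v) <= mu `^ (- tau) by rewrite ler_powR// lerN2.
  rewrite h1 /e.
  apply: (@le_trans _ _ (3 `^ v * rad `^ v * (c2 * (mu `^ (- v) * (rad `^ (- v) * rad `^ (- v)))))).
    rewrite ler_wpM2l ?mulr_ge0 ?powR_ge0//.
    rewrite mulrA mulrAC -/c2 ler_wpM2l//.
  have -> : 3 `^ v * rad `^ v * (c2 * (mu `^ (- v) * (rad `^ (- v) * rad `^ (- v)))) =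
    3 `^ v * c2 * (rad `^ (- v) * mu `^ (- v)) * (rad `^ v * rad `^ (- v)) by ring.
  rewrite h3 mulr1 -mulrA -[leRHS]mulrA ler_wpM2l ?powR_ge0// ler_wpM2l//.
  exact: (ler_pM (powR_ge0 rad (- v)) (powR_ge0 mu (- v)) h4 h5).
rewrite -/mu in hQ.
have Q0 : 0 <= (2 ^+ s) ^+ n :> R by rewrite !exprn_ge0.
apply: (@le_trans _ _ (8 * (2 ^+ s) ^+ n * (c3 * (rad `^ eps * mu `^ (- tau))))).
  apply: ler_wpM2l; first by rewrite mulr_ge0.
  by rewrite [c3 * _]mulrDl; exact: (lerD ha hb).
have -> : 8 * (2 ^+ s) ^+ n * (c3 * (rad `^ eps * mu `^ (- tau))) =
   8 * c3 * rad `^ eps * ((2 ^+ s) ^+ n * mu `^ (- tau)) by ring.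
have -> : 8 * c3 * c * rad `^ eps * 2 `^ (- s%:R) = 8 * c3 * rad `^ eps * (c * 2 `^ (- s%:R)) by ring.
by rewrite ler_wpM2l// !mulr_ge0// powR_ge0.
Qed.
End Numeric.

(** * Summing the scales *)

Section Maximal.
Context (R : realType) (n : nat) (p r : R) (p1 : 1 < p) (r1 : 1 < r).
Local Notation C := R[i].
Local Notation U := 'rV[int]_n.
Let p0 : 0 < p. Proof. exact: lt_trans p1. Qed.

(** Convergence in modulus is all that the definition of the extension provides. *)
Lemma normc_diff_cvg (a b : nat -> C) (za zb : C) :
  normc (a k - za) @[k --> \oo] --> (0 : R) -> normc (b k - zb) @[k --> \oo] --> (0 : R) ->
  normc (a k - b k) @[k --> \oo] --> normc (za - zb).
Proof.
move=> ha hb.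
have hab : normc (a k - za) + normc (b k - zb) @[k --> \oo] --> (0 : R).
  by rewrite -[X in _ --> X](addr0 (0 : R)); exact: cvgD.
apply/cvgrPdist_le => e e0.
move/cvgrPdist_le : hab => /(_ e e0); apply: filterS => k.
rewrite sub0r normrN ger0_norm ?addr_ge0 ?normc_ge0// => h.
apply: le_trans h.
have t1 : normc (za - zb) <= normc (a k - b k) + (normc (a k - za) + normc (b k - zb)).
  have -> : za - zb = (a k - b k) + (- (a k - za) + (b k - zb)) by ring.
  apply: (le_trans (le_normcD _ _)); rewrite lerD2l (le_trans (le_normcD _ _))//.
  by rewrite normcN.
have t2 : normc (a k - b k) <= normc (za - zb) + (normc (a k - za) + normc (b k - zb)).
  have -> : a k - b k = (za - zb) + ((a k - za) - (b k - zb)) by ring.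
  apply: (le_trans (le_normcD _ _)); rewrite lerD2l (le_trans (le_normcD _ _))//.
  by rewrite normcN.
by rewrite ler_norml; apply/andP; split; lra.
Qed.

Context (B : seq U) (uB : uniq B) (T : U -> nat -> (U -> C) -> C) (G : U -> U -> C)
  (kk : nat -> U -> C) (Q a e S N : R) (I0 : nat) (m : nat -> R).
Context (hT : forall x j g X, uniq X -> (forall u, g u != 0 -> u \in X) ->
  T x j g = \sum_(u <- X) g u * \sum_(i < j) G x (x - u) * kk i (x - u)).
Context (Q0 : 0 <= Q).
Context (hG : forall x y, normc (G x y) <= Q).
Context (ha : forall Z, uniq Z -> \sum_(y <- Z) \sum_(i < I0) normc (kk i y) <= a).
Context (hS : forall i Z, uniq Z -> \sum_(y <- Z) normc (kk i y) <= S).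
Context (hm : forall i y, normc (kk i y) <= m i).
Context (he : forall J, \sum_(I0 <= i < J) (S `^ (p - 1) * m i) `^ p^-1 <= e).
Context (hN : (size B)%:R <= N).

(** For each x and j the operator is a functional with a finite combination of the kernels kk i. *)
Lemma ext_values_exist f : (psum p f < +oo)%E ->
  exists F : U -> nat -> C, forall x j, lp_extension_value p (T x j) f (F x j).
Proof.
move=> fo.
have key (xj : U * nat) : exists z, lp_extension_value p (T xj.1 xj.2) f z.
  case: xj => x j /=.
  have m0 i : 0 <= m i by apply: le_trans (hm i 0); exact: normc_ge0.
  have hb u : normc (\sum_(i < j) G x (x - u) * kk i (x - u)) <=
      Q * \sum_(i < j) normc (kk i (x - u)).
    apply: (le_trans (normc_sum _ _ _)); rewrite mulr_sumr; apply: ler_sum => l _.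
    by rewrite normcM ler_wpM2r ?normc_ge0.
  apply: (ext_exists (b := fun u => \sum_(i < j) G x (x - u) * kk i (x - u))
    (S := Q * (j%:R * S)) (M := Q * \sum_(i < j) m i) p1 (hT x j)) fo => [Z uZ|u].
    apply: (@le_trans _ _ (\sum_(u <- Z) Q * \sum_(i < j) normc (kk i (x - u)))).
      by apply: ler_sum => u _; exact: hb.
    rewrite -mulr_sumr ler_wpM2l// exchange_big/=.
    apply: (@le_trans _ _ (\sum_(i < j) S)); last by rewrite sumr_const card_ord mulr_natl.
    by apply: ler_sum => i _; apply: (@sum_reflect R _ (fun y => normc (kk i y))) => // W; exact: hS.
  by apply: le_trans (hb u) _; rewrite ler_wpM2l//; apply: ler_sum => i _; exact: hm.
have [F hF] := boolp.choice key.
by exists (fun x j => F (x, j)) => x j; exact: (hF (x, j)).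
Qed.

(** Only the scale i enters the increment; the factor G, which carries the dependence on x,
    is bounded by Q and disappears. *)
Lemma op_step x i k f : normc (T x i.+1 (boxtrunc k f) - T x i (boxtrunc k f)) <=
  Q * \sum_(u <- zbox n k) normc (kk i (x - u)) * normc (boxtrunc k f u).
Proof.
have sup u : boxtrunc k f u != 0 -> u \in zbox n k.
  by rewrite /boxtrunc; case: ifP => //; rewrite eqxx.
rewrite (hT x i.+1 (zbox_uniq n k) sup) (hT x i (zbox_uniq n k) sup) -sumrB.
apply: (le_trans (normc_sum _ _ _)); rewrite mulr_sumr; apply: ler_sum => u _.
rewrite -mulrBr big_ord_recr /= [_ + G x _ * _]addrC addrK !normcM.
rewrite mulrC -mulrA ler_wpM2r ?mulr_ge0 ?normc_ge0//.
Qed.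

(** For fixed J the variation along the truncations of f is bounded by [scales_bound] and passes to
    the limit by lower semicontinuity. Then J tends to infinity by monotonicity. *)
Lemma variation_lp f : (psum p f < +oo)%E ->
  exists F : U -> nat -> C, (forall x j, lp_extension_value p (T x j) f (F x j)) /\
  (lp_norm p [set` B] (fun x => V_norm r [set j | (0 < j)%N] (F x)) <=
    (2 * (Q * (4 * (a + N `^ p^-1 * e))))%:E * lp_norm p setT (cabs f))%E.
Proof.
move=> fo; have [F hF] := ext_values_exist fo; exists F; split=> //.
have tc x j := hF x j _ (fun k => boxtrunc_fin k f) (boxtrunc_cvg p1 fo).
(* The empty truncation of the kernel is 0; this anchors the variation. *)
have F0 x : F x 0%N = 0.
  have E : (fun k => normc (T x 0 (boxtrunc k f) - F x 0%N)) = fun=> normc (F x 0%N).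
    apply/funext => k.
    rewrite (hT x 0 (zbox_uniq n k)); last by move=> u; rewrite /boxtrunc; case: ifP => //; rewrite eqxx.
    by rewrite big1 ?sub0r ?normcN// => u _; rewrite big_ord0 mulr0.
  have h0 := tc x 0%N; rewrite E in h0; apply: eq0_normc.
  by apply: (cvg_unique _ (cvg_cst _) h0).
set D := 4 * (a + N `^ p^-1 * e).
have a0 : 0 <= a by have := ha (Z := [::]) isT; rewrite big_nil.
have e0 : 0 <= e by have := he 0%N; rewrite big_geq.
have D0 : 0 <= D by rewrite mulr_ge0// addr_ge0// mulr_ge0// powR_ge0.
have fE : psum p f \is a fin_num by rewrite ge0_fin_numE// psum_ge0.
set E := fine (psum p f).
have EE : psum p f = E%:E by rewrite fineK.
have E0 : 0 <= E by rewrite fine_ge0// psum_ge0.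
pose Ct := (Q * D) `^ p * E.
have Ct0 : 0 <= Ct by rewrite mulr_ge0// powR_ge0.
pose W J x := \sum_(i < J) normc (F x i.+1 - F x i).
have W0 J x : 0 <= W J x by apply: sumr_ge0 => i _; exact: normc_ge0.
have hW J : \sum_(x <- B) W J x `^ p <= Ct.
  pose y x k := \sum_(i < J) normc (T x i.+1 (boxtrunc k f) - T x i (boxtrunc k f)).
  apply: (powR_sum_lsc p1 (y := y)) => [x k|x|x|k].
  - by apply: sumr_ge0 => i _; exact: normc_ge0.
  - exact: W0.
  - by apply: cvg_sum_seq => i; apply: normc_diff_cvg; exact: tc.
  apply: (@le_trans _ _ (\sum_(x <- B) Q `^ p *
     (\sum_(i < J) \sum_(u <- zbox n k) normc (kk i (x - u)) * normc (boxtrunc k f u)) `^ p)).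
    apply: ler_sum => x _; rewrite -powRM//; last first.
      by apply: sumr_ge0 => i _; apply: sumr_ge0 => u _; rewrite mulr_ge0// normc_ge0.
    apply: (powR_le p1); first by apply: sumr_ge0 => i _; exact: normc_ge0.
    by rewrite mulr_sumr; apply: ler_sum => i _; exact: op_step.
  rewrite -mulr_sumr /Ct powRM// -mulrA ler_wpM2l ?powR_ge0//.
  apply: (le_trans (@scales_bound R p p1 U (fun i y => normc (kk i y)) I0 a S e N m B (zbox n k)
     (fun u => normc (boxtrunc k f u)) J _ _ uB (zbox_uniq n k) ha hS hm he hN)).
  - by move=> i y0; exact: normc_ge0.
  - by move=> u; exact: normc_ge0.
  rewrite -/D ler_wpM2l ?powR_ge0// -lee_fin -EE.
  apply: le_trans (psum_seq p f (zbox_uniq n k)).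
  rewrite lee_fin big_seq [leRHS]big_seq; apply: ler_sum => u ub.
  by rewrite /boxtrunc ub.
have WB x J : x \in B -> W J x <= Ct `^ p^-1.
  move=> xB; rewrite -(powRK p1 (W0 J x)); apply: powRV_le => //; first exact: powR_ge0.
  apply: le_trans (hW J); rewrite (big_rem x)//= lerDl.
  by apply: sumr_ge0 => u _; exact: powR_ge0.
(* Outside B nothing bounds the variation, so it is replaced by 0 there. *)
pose y x J := if x \in B then W J x else 0.
have ynd x : nondecreasing_seq (y x).
  apply/nondecreasing_seqP => J; rewrite /y; case: ifP => // _.
  by rewrite /W big_ord_recr /= lerDl normc_ge0.
have yc x : cvgn (y x).
  apply: nondecreasing_is_cvgn => //; exists (Ct `^ p^-1) => _ [J _ <-].
  by rewrite /y; case: ifP => [/WB//|_]; exact: powR_ge0.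
pose Y x := limn (y x).
have yY x J : y x J <= Y x by exact: nondecreasing_cvgn_le.
have Y0 x : 0 <= Y x.
  by apply: le_trans (yY x 0%N); rewrite /y; case: ifP.
have hY : \sum_(x <- B) Y x `^ p <= Ct.
  apply: (powR_sum_lsc p1 (y := y)) => [x k|x|x|k].
  - by rewrite /y; case: ifP.
  - exact: Y0.
  - exact: yc.
  apply: le_trans (hW k); rewrite big_seq [leRHS]big_seq; apply: ler_sum => x xB.
  by rewrite /y xB.
have hV x : x \in B -> (V_norm r [set j | (0 < j)%N] (F x) <= (2 * Y x)%:E)%E.
  move=> xB; apply: V_norm_le => // J.
  by apply: le_trans (yY x J); rewrite /y xB.
have V0 x : (0 <= V_norm r [set j | (0 < j)%N] (F x))%E.
  apply: adde_ge0.
    apply: (@le_trans _ _ (normc (F x 1%N))%:E); first by rewrite lee_fin normc_ge0.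
    by apply: ereal_sup_ubound; exists 1%N.
  apply: (@le_trans _ _ 0%:E) => //; apply: ereal_sup_ubound.
  exists 0%N, (fun=> 1%N); split => //.
  by rewrite big_ord0 powR0// invr_eq0 gt_eqF// (lt_trans ltr01 r1).
rewrite (lp_normE p f) EE poweR_EFin -EFinM /lp_norm.
have -> : 2 * (Q * D) * E `^ p^-1 = ((2 `^ p * Ct) `^ p^-1).
  have QD0 : 0 <= Q * D by rewrite mulr_ge0.
  by rewrite /Ct [2 `^ p * _]mulrA -(powRM _ (ler0n R 2) QD0) (powRM _ (powR_ge0 _ _) E0) powRK// mulr_ge0.
rewrite -poweR_EFin; apply: gt0_ler_poweR; rewrite ?invr_ge0 ?(ltW p0)//.
- by rewrite in_itv /= leey andbT; apply: esum_ge0 => x _; exact: poweR_ge0.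
- by rewrite in_itv /= leey andbT lee_fin mulr_ge0 ?powR_ge0.
rewrite (esum_fset (finite_seq B)); last by move=> i _; exact: poweR_ge0.
rewrite -fsbig_seq// big_seq.
apply: (@le_trans _ _ (\sum_(x <- B | x \in B) ((2 * Y x) `^ p)%:E)%E).
  apply: lee_sum => x xB; rewrite -poweR_EFin; apply: gt0_ler_poweR => //.
  - exact: ltW.
  - by rewrite in_itv /= leey andbT.
  - by rewrite in_itv /= leey andbT lee_fin mulr_ge0.
  exact: hV.
rewrite -big_seq sumEFin lee_fin.
rewrite (eq_bigr (fun x => 2 `^ p * Y x `^ p)); last by move=> x _; rewrite powRM.
by rewrite -mulr_sumr ler_wpM2l ?powR_ge0.
Qed.
End Maximal.

(** * The variational estimate *)

Section Kernel.
Context (R : realType) (n d : nat) (Omega : 'rV[R]_n -> R[i])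
  (hOmega : kernel_symbol Omega) (psi : 'rV[R]_n -> R) (hpsi : cutoff psi).
Local Notation C := R[i].
Local Notation U := 'rV[int]_n.

(** The arithmetic factor of the convolution kernel. *)
Definition gauss_kernel (alpha : rat) (y : U) : C :=
  \sum_(b : 'rV['I_(denom alpha)]_n)
    gauss_sum d alpha (betaq R b) * expi (dot (betaq R b) (realvec R y)).

(** Each of the q^n terms has modulus at most 1. *)
Lemma gauss_kernel_bound alpha y : normc (gauss_kernel alpha y) <= (denom alpha)%:R ^+ n.
Proof.
apply: (le_trans (normc_sum _ _ _)).
apply: (@le_trans _ _ (\sum_(b : 'rV['I_(denom alpha)]_n) 1)).
  by apply: ler_sum => b _; rewrite normcM normc_expi mulr1 gauss_bound.
by rewrite sumr_const card_mx card_ord mul1n -natrX.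
Qed.

(** By linearity in the multiplier, one convolution kernel for each dyadic scale. *)
Lemma L_Ktrunc_kernel kappa s alpha j g X x : 2 <= lam_ kappa s -> uniq X ->
  (forall u : U, g u != 0 -> u \in X) ->
  mult_op (L_mult d psi kappa s alpha (fourier_Rn (K_trunc Omega psi 0 j))) g x =
  \sum_(u <- X) g u * \sum_(i < j) gauss_kernel alpha (x - u) *
     kern psi (Kj Omega psi i) (lam_ kappa s) (realvec R (x - u)).
Proof.
move=> l2 uX hX.
have l0 : 0 < lam_ kappa s by apply: lt_le_trans l2.
have bK i : cbcs (fun xi => fourier_Rn (Kj Omega psi i) xi * ((chi_dil psi (lam_ kappa s) xi)%:C)%C).
  exact: (fourier_kern hpsi 0 (cbcs_Kj hOmega hpsi i) l0).2.
have E xi : fourier_Rn (K_trunc Omega psi 0 j) xi * ((chi_dil psi (lam_ kappa s) xi)%:C)%C =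
    \sum_(0 <= i < j) fourier_Rn (Kj Omega psi i) xi * ((chi_dil psi (lam_ kappa s) xi)%:C)%C.
  by rewrite (fourier_Ktrunc hOmega hpsi) mulr_suml.
have bm : cbcs (fun xi => fourier_Rn (K_trunc Omega psi 0 j) xi *
    ((chi_dil psi (lam_ kappa s) xi)%:C)%C).
  by apply: (cbcs_ext (fun xi => esym (E xi))); exact: cbcs_sum.
rewrite (mult_opE d hpsi l2 alpha x bm uX hX); apply: eq_bigr => u _; congr (_ * _).
rewrite -mulr_sumr; congr (_ * _).
rewrite -(big_mkord predT (fun i => kern psi (Kj Omega psi i) (lam_ kappa s) (realvec R (x - u)))).
rewrite /kern -cint_sum; last by move=> i; exact: cbcs_expi.
by apply: cint_ext => xi; rewrite E mulr_sumr.
Qed.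

End Kernel.

Section Ball.
Context (R : realType) (n : nat).
(** Coordinates of lattice points in the ball have modulus at most N = floor(rad), and
    (2N + 1)^n <= (3 rad)^n. *)
Lemma ball_seq (rad : R) : 1 <= rad -> exists B : seq 'rV[int]_n,
  [/\ uniq B, [set` B] = B_ R n rad & (size B)%:R <= (3 * rad) ^+ n].
Proof.
move=> rad1; have rad0 : 0 <= rad by lra.
pose N := Num.truncn rad.
have /andP[N1 N2] : N%:R <= rad < N.+1%:R by exact: truncn_itv.
exists [seq x <- zbox n N | `[< B_ R n rad x >]]; split.
- by rewrite filter_uniq// zbox_uniq.
- apply/seteqP; split=> x /=; rewrite mem_filter.
    by move=> /andP[/asboolP].
  move=> hx; apply/andP; split; first exact/asboolP.
  apply: zboxP => i.
  have h : `|(x ord0 i)%:~R| <= rad :> R.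
    by rewrite -(realvec_coord R x i); apply: (le_trans (coord_le_enorm _ i)).
  rewrite -ler_norml -(ler_int R) intr_norm.
  have : `|x ord0 i| < N.+1%:Z by rewrite -(ltr_int R) intr_norm (le_lt_trans h).
  by rewrite -[N.+1]addn1 PoszD ltzD1 -(ler_int R) intr_norm.
- apply: (@le_trans _ _ (size (zbox n N))%:R); first by rewrite ler_nat size_filter count_size.
  rewrite size_zbox natrX; apply: lerXn2r; rewrite ?nnegrE ?mulr_ge0//.
  by rewrite -natr1 -muln2 natrM; lra.
Qed.
End Ball.

Theorem lemma4p4 (R : realType) (n d : nat) (hn : (0 < n)%N) (hd : (0 < d)%N)
    (Omega : 'rV[R]_n -> R[i]) (hOmega : kernel_symbol Omega)
    (psi : 'rV[R]_n -> R) (hpsi : cutoff psi)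
    (kappa : R) (hkappa : 0 < kappa < 1)
    (gamma : R -> R) (hgamma : maximal_decay d psi kappa gamma)
    (r : R) (hr : 2 < r) (p : R) (hp : 1 < p) (eps : R) (heps : 0 < eps) :
  exists c : R,
  forall (s : nat) (rad : R) (alpha : 'rV[int]_n -> rat) (f : 'rV[int]_n -> R[i]),
    (0 < s)%N -> 1 <= rad -> (forall x, A_ s (alpha x)) ->
    (lp_norm p setT (cabs f) < +oo)%E ->
    exists F : 'rV[int]_n -> nat -> R[i],
      (forall x j, (0 < j)%N ->
         lp_extension_value p
           (fun g => mult_op
              (L_mult d psi kappa s (alpha x) (fourier_Rn (K_trunc Omega psi 0 j)))
              g x)
           f (F x j)) /\
      (lp_norm p (B_ R n rad) (fun x => V_norm r [set j | (0 < j)%N] (F x))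
       <= (c * rad `^ eps * 2 `^ (- gamma p * s%:R))%:E * lp_norm p setT (cabs f))%E.
Proof.
have /andP[k0 _] := hkappa.
have [/andP[_ gam1] _] := hgamma p hp.
have r1 : 1 < r by lra.
have [A [A0 hA]] := Kj_bound hOmega hpsi.
have [B1 [B10 hB1]] := kern_l1 hn hpsi.
have [B2 [B20 hB2]] := kern_sup hn hpsi.
have [t [ht [c [c0 hc]]]] := constants hn hp heps k0 (mulr_ge0 B10 A0) (mulr_ge0 B20 A0).
exists c => s rad alpha f s0 rad1 hal hf.
have l2 : 2 <= lam_ kappa s by exact: lam_ge2.
have l1 : 1 <= lam_ kappa s by lra.
have fo := lp_norm_lty hp hf.
have [I0 [a [e [hIa hIe hfin]]]] := hc s rad s0 rad1.
have [B [uB EB sB]] := ball_seq n rad1.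
pose ki i y := kern psi (Kj Omega psi i) (lam_ kappa s) (realvec R y).
have w0 i : 0 < 2 ^+ i.+1 :> R by rewrite exprn_gt0.
have l1bound i tt Z : 0 <= tt <= 2^-1 -> uniq Z -> \sum_(y <- Z) normc (ki i y) <=
    B1 * A * (2 ^+ i.+1 / lam_ kappa s) `^ tt.
  move=> htt uZ; apply: (hB1 (Kj Omega psi i) A _ _ _ Z (cbcs_Kj hOmega hpsi i) (w0 i) A0 l1 htt uZ) => [x|x|].
  - exact: hA.
  - exact: Kj_out.
  - exact: int_Kj.
have hm i y : normc (ki i y) <= B2 * A * (2 ^+ i.+1) ^- n.
  apply: (hB2 (Kj Omega psi i) A _ _ _ (cbcs_Kj hOmega hpsi i) (w0 i) A0 l1) => [x|x].
  - exact: hA.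
  - exact: Kj_out.
have hT (x : 'rV[int]_n) j g X : uniq X -> (forall u, g u != 0 -> u \in X) ->
    mult_op (L_mult d psi kappa s (alpha x) (fourier_Rn (K_trunc Omega psi 0 j))) g x =
    \sum_(u <- X) g u * \sum_(i < j) gauss_kernel R d (alpha x) (x - u) * ki i (x - u).
  exact: L_Ktrunc_kernel.
have hG (x y : 'rV[int]_n) : normc (gauss_kernel R d (alpha x) y) <= (2 ^+ s) ^+ n.
  apply: (@le_trans _ _ ((denom (alpha x))%:R ^+ n)); first exact: gauss_kernel_bound.
  have [/andP[_ q2] _] := hal x.
  by apply: lerXn2r; rewrite ?nnegrE ?exprn_ge0// -natrX ler_nat ltnW.
have ha Z : uniq Z -> \sum_(y <- Z) \sum_(i < I0) normc (ki i y) <= a.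
  move=> uZ; rewrite exchange_big/=; apply: le_trans hIa.
  by apply: ler_sum => i _; exact: l1bound.
(* The bound without gain, t = 0, for the scales above I0. *)
have hS i Z : uniq Z -> \sum_(y <- Z) normc (ki i y) <= B1 * A.
  move=> uZ; have h0 : 0 <= (0 : R) <= 2^-1 by apply/andP; split; rewrite ?invr_ge0 ?ler0n.
  by have := l1bound i 0 Z h0 uZ; rewrite powRr0 mulr1.
have Q0 : 0 <= (2 ^+ s) ^+ n :> R by rewrite !exprn_ge0.
have [F [hF hV]] := variation_lp hp r1 uB hT Q0 hG ha hS hm hIe sB fo.
exists F; split => [x j _|]; first exact: hF.
rewrite -EB; apply: (le_trans hV).
apply: lee_wpmul2r; first exact: poweR_ge0.
rewrite lee_fin (_ : 2 * _ = 8 * (2 ^+ s) ^+ n * (a + ((3 * rad) ^+ n) `^ p^-1 * e)); last by ring.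
apply: (le_trans hfin); rewrite ler_wpM2l ?mulr_ge0 ?powR_ge0//.
(* 2^(-s) <= 2^(-gamma_p s). *)
by apply: ler_powR; [rewrite ler1n|rewrite mulNr lerN2 ler_piMl// ltW].
Qed.
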